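(* Let $\mu \in \mathcal{T}_{-}$ and $s\in E(\mu)$. For all $0<\epsilon < 10^{-5}$, there is an $n_0>40$ such that, for all $n>n_0$, the following hold. (i) If $|A_{n,s} B_{n,s}|\ge \epsilon$, then $$\min\{|z-s|: \phi_{n}(z)=0\} \le 10^4\epsilon^{-1}n^{-1} .$$ (ii) If in addition $e^{\epsilon^{-1}} > |w(s)|$, then $$\min\{|z-s|: \phi_{n}(z)=0\} \le \epsilon^{-1}n^{-1}$$ implies $$|A_{n,s} B_{n,s}|\ge e^{-10\epsilon^{-1}} .$$
   Context: $\mathbb{T}$ is the unit circle in $\mathbb{C}$, $\mathbb{N}_0=\{0,1,2,\dots\}$. For a function $g$ of a complex variable, $g^*(z):=\overline{g(\overline{z}^{-1})}$ (on $\mathbb{T}$ this is complex conjugation). A complex probability measure on $\mathbb{T}$ is a complex Borel measure $\mu$ with $\int_{\mathbb{T}}d\mu=1$. For polynomials $f,g$ put $\langle f,g\rangle_\mu:=\int_{\mathbb{T}} f g^*\,d\mu$. A polynomial $\Phi$ is left (right) orthogonal if $\langle \Phi,p\rangle_\mu=0$ (respectively $\langle p,\Phi\rangle_\mu=0$) for all polynomials $p$ of degree strictly less than that of $\Phi$. $\mathcal{T}$ is the class of complex probability measures $\mu$ on $\mathbb{T}$ such that for each $n\in\mathbb{N}_0$ there exist a unique left orthogonal monic polynomial $\Phi_n$ and a unique right orthogonal monic polynomial $\tilde\Phi_n$ of degree $n$. For $\mu\in\mathcal{T}$ there are unique complex numbers $F_{n+1},\tilde F_{n+1}$ ($n\in\mathbb{N}_0$)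 with $\Phi_{n+1}-z\Phi_n=\overline{F_{n+1}}z^n\tilde\Phi_n^*$ and $\tilde\Phi_{n+1}-z\tilde\Phi_n=\overline{\tilde F_{n+1}}z^n\Phi_n^*$. $\mathcal{T}_-$ is the class of $\mu\in\mathcal{T}$ with $F_n=-\tilde F_n$ for all $n\ge1$. For $\mu\in\mathcal{T}_-$ one has $\langle\Phi_n,\tilde\Phi_n\rangle_\mu=\prod_{j=1}^n(1+|F_j|^2)>0$, and the normalized left orthogonal polynomials are $\phi_n:=\Phi_n/\sqrt{\langle\Phi_n,\tilde\Phi_n\rangle_\mu}$. Let $\frac{w}{2\pi}$ be the Radon-Nikodym derivative of (the absolutely continuous part of) $\mu$ with respect to arclength on $\mathbb{T}$. $E(\mu)$ is the set of all $s\in\mathbb{T}$ such that $s$ is not in the support of the singular part of $\mu$ and $s$ is a Lebesgue point of $\frac{w}{2\pi}$, in particular $|w(s)|<\infty$. For $n\ge1$ and $s\in\mathbb{T}$, with $\gamma_n:=e^{i\pi/n}$, the local parameters are $$A_{n,s}:=\frac{\phi_n(s)-\phi_n(s\gamma_n)}{2s^n},\qquad B_{n,s}:=\frac{\phi_n(s)+\phi_n(s\gamma_n)}{2}.$$ *)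

(* Defs.v *)
(* MathComp-Analysis, over an arbitrary R : realType; the complex numbers are
   R[i] from mathcomp-real-closed, with real-valued modulus Normc.normc. *)
From HB Require Import structures.
From mathcomp Require Import all_boot all_order all_algebra complex.
From mathcomp Require Import all_classical all_reals all_analysis.

Set Implicit Arguments.
Unset Strict Implicit.
Unset Printing Implicit Defensive.

Import Order.TTheory GRing.Theory Num.Theory.
Import numFieldNormedType.Exports.
Import Normc.

Local Open Scope classical_set_scope.
Local Open Scope ring_scope.
Local Open Scope complex_scope.

(* R[i]^o rather than R[i]: the alias carries the usual topology of R[i], which
   makes [circle] a topological subspace of the plane. *)
Definition circle (R : realType) : Type :=
  set_type [set z : R[i]^o | normc z = 1].

Definition cval (R : realType) (s : circle R) : R[i] := val s.

Lemma normc_cos_sin (R : realType) (t : R) : normc (cos t +i* sin t) = 1.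
Proof. by rewrite /normc cos2Dsin2 sqrtr1. Qed.

Definition expi (R : realType) (t : R) : circle R :=
  exist _ (cos t +i* sin t : R[i]^o) (mem_set (normc_cos_sin t)).

HB.instance Definition _ (R : realType) :=
  Topological.copy (circle R) (set_type [set z : R[i]^o | normc z = 1]).
HB.instance Definition _ (R : realType) :=
  isPointed.Build (circle R) (expi 0).
HB.instance Definition _ (R : realType) :=
  Measurable.copy (circle R)
    (@g_sigma_algebraType (circle R) (@open (circle R))).

Lemma cos_sin_continuous (R : realType) :
  continuous (fun t : R => cos t +i* sin t : R[i]^o).
Proof.
move=> t; apply/cvgrPdist_lt => -[a b]; rewrite ltcE/= => /andP[/eqP-> a0].
have a20 : 0 < a / 2 by rewrite divr_gt0.
have ct : \forall u \near t, `|cos t - cos u| < a / 2.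
  by have /cvgrPdist_lt := @continuous_cos R t; exact.
have st : \forall u \near t, `|sin t - sin u| < a / 2.
  by have /cvgrPdist_lt := @continuous_sin R t; exact.
apply: filterS2 ct st => u cu su; rewrite normc_def ltcE/= eqxx/=.
apply: (@le_lt_trans _ _ (`|cos t - cos u| + `|sin t - sin u|)).
  rewrite -[leRHS]ger0_norm ?addr_ge0// -sqrtr_sqr ler_sqrt ?sqr_ge0//.
  by rewrite [leRHS]sqrrD !real_normK ?num_real// lerD2r lerDl mulrn_wge0.
by rewrite [ltRHS]splitr ltrD.
Qed.

Lemma expi_continuous (R : realType) : continuous (@expi R).
Proof. by apply: continuous_comp_initial; exact: cos_sin_continuous. Qed.

Lemma measurable_expi (R : realType) :
  measurable_fun [set: measurableTypeR R] (@expi R).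
Proof.
apply: (@measurability _ _ _ _ _ _ (@open (circle R))) => //.
move=> _ [U oU <-]; rewrite setTI.
apply: measurable_realfun.open_measurable; apply: open_comp => // t _; exact: expi_continuous.
Qed.

Section arclength.
Variable R : realType.

Definition arclength : set (circle R) -> \bar R :=
  pushforward (mrestr lebesgue_measure (measurable_itv `[0, 2 * pi[ ))
    (@expi R).

Let arclength0 : arclength set0 = 0%E.
Proof. by rewrite /arclength /pushforward preimage_set0 measure0. Qed.

Let arclength_ge0 A : (0 <= arclength A)%E.
Proof. by rewrite /arclength /pushforward; exact: measure_ge0. Qed.

Let arclength_sigma_additive : semi_sigma_additive arclength.
Proof.
move=> F mF tF mUF; rewrite /arclength /pushforward preimage_bigcup.
apply: measure_semi_sigma_additive.
- by move=> n; rewrite -[X in measurable X]setTI; exact: measurable_expi.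
- apply/trivIsetP => /= i j _ _ ij; rewrite -preimage_setI.
  by move/trivIsetP : tF => /(_ _ _ _ _ ij) ->//; rewrite preimage_set0.
- by rewrite -preimage_bigcup -[X in measurable X]setTI; exact: measurable_expi.
Qed.

HB.instance Definition _ := isMeasure.Build _ _ _ arclength
  arclength0 arclength_ge0 arclength_sigma_additive.

End arclength.
Arguments arclength R A : clear implicits.

(* A complex measure, through its real and imaginary parts; charges are finite
   on measurable sets, so [fine] in [cm_val] loses nothing. *)
Record complex_measure d (T : measurableType d) (R : realType) :=
  ComplexMeasure {
    cm_Re : {charge set T -> \bar R} ;
    cm_Im : {charge set T -> \bar R} }.

Definition cm_val d (T : measurableType d) (R : realType)
    (mu : complex_measure T R) (A : set T) : R[i] :=
  fine (cm_Re mu A) +i* fine (cm_Im mu A).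

Coercion cm_val : complex_measure >-> Funclass.

Section integration.
Context d (T : measurableType d) (R : realType).

Lemma Hahn_sig (nu : {charge set T -> \bar R}) :
  {PN : set T * set T | hahn_decomposition nu PN.1 PN.2}.
Proof.
apply: cid; have [P [N PN]] := Hahn_decomposition nu.
by exists (P, N).
Qed.

(* The value does not depend on the Hahn decomposition picked by [Hahn_sig]. *)
Definition charge_integral (nu : {charge set T -> \bar R}) (f : T -> R) : R :=
  \int[jordan_pos (svalP (Hahn_sig nu))]_x f x
  - \int[jordan_neg (svalP (Hahn_sig nu))]_x f x.

Definition cm_integral (mu : complex_measure T R) (f : T -> R[i]) : R[i] :=
  let u x := complex.Re (f x) in
  let v x := complex.Im (f x) in
  (charge_integral (cm_Re mu) u - charge_integral (cm_Im mu) v)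
  +i* (charge_integral (cm_Re mu) v + charge_integral (cm_Im mu) u).

Definition cintegrable (m : {measure set T -> \bar R}) (f : T -> R[i]) :=
  m.-integrable setT (EFin \o (fun x => complex.Re (f x))) /\
  m.-integrable setT (EFin \o (fun x => complex.Im (f x))).

Definition cintegral (m : {measure set T -> \bar R}) (D : set T)
    (f : T -> R[i]) : R[i] :=
  (\int[m]_(x in D) complex.Re (f x)) +i* (\int[m]_(x in D) complex.Im (f x)).

Definition cm_singular (nu : complex_measure T R)
    (m : {measure set T -> \bar R}) :=
  exists N : set T, [/\ measurable N, m N = 0%E &
    forall A, measurable A -> A `<=` ~` N -> nu A = 0].

End integration.

Section circle_measures.
Variable R : realType.
Local Notation C := R[i].
Local Notation cmeasure := (complex_measure (circle R) R).

Implicit Types (mu sigma : cmeasure) (w : circle R -> C) (n : nat).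

(* The existence of A says that the total variation of nu does not vanish on
   U. *)
Definition cm_support (nu : cmeasure) : set (circle R) :=
  [set s | forall U : set (circle R), open U -> U s ->
    exists A : set (circle R), [/\ measurable A, A `<=` U & nu A <> 0]].

(* w / (2 pi) is a version of the density of the absolutely continuous part of
   [mu] with respect to arclength, and [sigma] is the singular part. *)
Definition lebesgue_decomposition mu w sigma :=
  [/\ cintegrable (arclength R) w,
      cm_singular sigma (arclength R) &
      forall A, measurable A ->
        mu A = cintegral (arclength R) A (fun t => w t / (2 * pi)%:C)
               + sigma A].

(* The chordal balls are, for small r, the open arcs centred at s. *)
Definition circle_ball (s : circle R) (r : R) : set (circle R) :=
  [set t | normc (cval t - cval s) < r].

Definition circle_lebesgue_pt (f : circle R -> C) (s : circle R) :=
  ((arclength R (circle_ball s r))^-1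
    * \int[arclength R]_(t in circle_ball s r) (normc (f t - f s))%:E)%E
  @[r --> (0 : R)^'+] --> 0%E.

(* This is E(mu) when [lebesgue_decomposition mu w sigma] holds.  Only [sigma]
   is determined by mu: being a Lebesgue point depends on the version w, but
   then w s is the limit of the averages of w, hence also determined by mu. *)
Definition E_set w sigma : set (circle R) :=
  [set s | ~ cm_support sigma s /\
           circle_lebesgue_pt (fun t => w t / (2 * pi)%:C) s].

Definition star (g : C -> C) (z : C) : C := (g (z^*)^-1)^*.

Definition pairing mu (f g : {poly C}) : C :=
  cm_integral mu (fun s => f.[cval s] * star (horner g) (cval s)).

Definition left_orthogonal mu (P : {poly C}) :=
  forall p : {poly C}, (size p < size P)%N -> pairing mu P p = 0.

Definition right_orthogonal mu (P : {poly C}) :=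
  forall p : {poly C}, (size p < size P)%N -> pairing mu p P = 0.

Definition monic_left mu n : set {poly C} :=
  [set P | [/\ P \is monic, size P = n.+1 & left_orthogonal mu P]].

Definition monic_right mu n : set {poly C} :=
  [set P | [/\ P \is monic, size P = n.+1 & right_orthogonal mu P]].

Definition class_T mu :=
  mu setT = 1 /\
  forall n, (exists! P, monic_left mu n P) /\ (exists! P, monic_right mu n P).

(* For mu in [class_T], [xget] picks the unique element in each of the next
   four definitions; the default values are never used. *)
Definition Phi mu n : {poly C} := xget 0 (monic_left mu n).

Definition Phit mu n : {poly C} := xget 0 (monic_right mu n).

(* Indices are shifted: [vF mu n] is F_{n+1}, [vFt mu n] is its tilde version.
   The recurrence is an identity of functions on the nonzero complex numbers,
   where g^* makes sense. *)
Definition vF mu n : C := xget 0 [set c |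
  forall z : C, z != 0 ->
    (Phi mu n.+1).[z] - z * (Phi mu n).[z]
    = c^* * z ^+ n * star (horner (Phit mu n)) z].

Definition vFt mu n : C := xget 0 [set c |
  forall z : C, z != 0 ->
    (Phit mu n.+1).[z] - z * (Phit mu n).[z]
    = c^* * z ^+ n * star (horner (Phi mu n)) z].

Definition class_Tminus mu :=
  class_T mu /\ forall n, vF mu n = - vFt mu n.

Definition phi mu n : {poly C} :=
  (sqrtC (pairing mu (Phi mu n) (Phit mu n)))^-1 *: Phi mu n.

Definition rotn n : C := cos (pi / n%:R) +i* sin (pi / n%:R).

Definition localA mu n (s : circle R) : C :=
  ((phi mu n).[cval s] - (phi mu n).[cval s * rotn n]) / (2 * cval s ^+ n).

Definition localB mu n (s : circle R) : C :=
  ((phi mu n).[cval s] + (phi mu n).[cval s * rotn n]) / 2.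

(* A minimum as soon as p is not constant: the set is finite and nonempty. *)
Definition zero_dist (p : {poly C}) (s : circle R) : R :=
  inf [set normc (z - cval s) | z in [set z | root p z]].

End circle_measures.

(* Main.v *)
From HB Require Import structures.
Require Import Defs.
From mathcomp Require Import all_boot all_order all_algebra complex.
From mathcomp Require Import all_classical all_reals all_analysis.
From mathcomp Require Import measurable_realfun.
From mathcomp Require Import ring lra zify.
Set Implicit Arguments.
Unset Strict Implicit.
Unset Printing Implicit Defensive.
Import Order.TTheory GRing.Theory Num.Theory.
Import numFieldNormedType.Exports.
Import Normc.
Local Open Scope classical_set_scope.
Local Open Scope ring_scope.
Local Open Scope complex_scope.

(* Since F_n = - F~_n, the recurrences give |phi_n|^2 + |phi~_n|^2 = 2 on the
   circle.  Tested against kernels of size min(n, 1 / (n |u - s|^2)), mu behaves as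
   w(s) / (2 pi) times arclength, because s is a Lebesgue point outside the
   support of the singular part.  For z = v s with |v - 1| = O(1/n), the number
   phi_n(z) - A z^n - B is the arclength pairing of phi_n with a polynomial of
   degree less than n which is such a kernel, so left orthogonality gives
   phi_n(z) = A z^n + B + o(1), provided w(s) <> 0.  The latter holds because the
   Christoffel-Darboux kernel K_n has to reproduce localized test polynomials.
   (i) The zeros of A z^n + B persist for phi_n by the minimum modulus principle,
   which for polynomials follows by multiplying values over roots of unity.
   (ii) A zero of phi_n near s makes |A| and |B| comparable up to exp(O(1/eps)); if
   both were tiny, phi_n and hence K_n(s, .) would be too small for 1 = int p
   K_n(s, .) dmu with a test polynomial p, given that |w(s)| < exp(1/eps). *)

(** * Complex numbers and zeros of polynomials *)

(** Because [mu] is complex, the pairing has no positivity: no Cauchy-Schwarz inequality for [mu]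
    and no extremal description of the kernel. Two facts replace them: the identity on the circle
    bounds phi_n pointwise, hence |K_n| <= 2 n, and reproduction by K_n is exact algebra. All
    analysis is then an L1 estimate at the Lebesgue point, which is why every kernel must decay like
    1 / (n |u - s|^2). Put E = 1 / eps. In (ii) three ranges of |u - s| compete: below exp(-6E/5) /
    n only |K_n| <= 2 n is used; up to exp(E) / n the smallness of phi_n enters through
    Christoffel-Darboux; beyond, the test polynomial decays. With phi_n = O(exp(-5E/2)) they
    contribute, up to constants, exp(-6E/5), exp(-13E/10) and exp(-2E), each beating |w(s)| <
    exp(E); eps < 10^-5 absorbs the constants. So (ii) needs the local model out to exp(E) / n with
    error exp(-5E), while (i) needs it only out to a multiple of E / n with error of order 1 / E. *)

Section complex_modulus.
Variable R : realType.
Implicit Types (x y z : R[i]) (t : R).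

Lemma normc_ge0 z : 0 <= normc z.
Proof. by case: z => a b; rewrite /normc sqrtr_ge0. Qed.

Lemma normc_sqr z : normc z ^+ 2 = complex.Re z ^+ 2 + complex.Im z ^+ 2.
Proof. by case: z => a b; rewrite /normc sqr_sqrtr ?addr_ge0 ?sqr_ge0. Qed.

Lemma normcX z n : normc (z ^+ n) = normc z ^+ n.
Proof.
by elim: n => [|n IH]; rewrite ?expr0 ?normc1// !exprS normcM IH.
Qed.

Lemma normcR t : normc t%:C = `|t|.
Proof. by rewrite /normc/= expr0n addr0 sqrtr_sqr. Qed.

Lemma normc_nat n : normc n%:R = n%:R :> R.
Proof.
by rewrite -(rmorph_nat (real_complex R)) normcR ger0_norm ?ler0n.
Qed.

Lemma normc_conj z : normc (conjc z) = normc z.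
Proof. by case: z => a b; rewrite /normc /= sqrrN. Qed.

Lemma mulcJ z : z * conjc z = (normc z ^+ 2)%:C.
Proof.
rewrite normc_sqr; case: z => a b; simpc; apply/eqP; rewrite eq_complex/=.
by rewrite -!expr2 eqxx/= mulrC addNr.
Qed.

Lemma normc_eq0 z : (normc z == 0) = (z == 0).
Proof.
by apply/eqP/eqP => [/eq0_normc//|->]; rewrite normc0.
Qed.

Lemma normc_gt0 z : (0 < normc z) = (z != 0).
Proof. by rewrite lt_neqAle normc_ge0 andbT eq_sym normc_eq0. Qed.

Lemma normcB_sym x y : normc (x - y) = normc (y - x).
Proof. by rewrite -opprB (normcN (y - x : Rcomplex R)). Qed.

Lemma normcD_le x y : normc (x + y) <= normc x + normc y.
Proof. exact: (le_normcD (x : Rcomplex R) y). Qed.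

Lemma normcB_le x y : normc (x - y) <= normc x + normc y.
Proof. by rewrite (le_trans (normcD_le _ _))// (normcN (y : Rcomplex R)). Qed.

Lemma normcB_ge x y : normc x - normc y <= normc (x - y).
Proof. by rewrite lerBlDr -{1}[x](subrK y) normcD_le. Qed.

Lemma normcD_ge x y : normc x - normc y <= normc (x + y).
Proof.
by rewrite -{2}[y]opprK (le_trans _ (normcB_ge _ _))// (normcN (y : Rcomplex R)).
Qed.

Lemma normc_sum (I : Type) (r : seq I) (P : pred I) (F : I -> R[i]) :
  normc (\sum_(i <- r | P i) F i) <= \sum_(i <- r | P i) normc (F i).
Proof.
elim/big_ind2 : _ => [|a b c d ab cd|//]; first by rewrite normc0.
by rewrite (le_trans (normcD_le _ _))// lerD.
Qed.

Lemma normc_prod (I : Type) (r : seq I) (P : pred I) (F : I -> R[i]) :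
  normc (\prod_(i <- r | P i) F i) = \prod_(i <- r | P i) normc (F i).
Proof.
by elim/big_ind2 : _ => [|a b c d <- <-|//]; rewrite ?normc1 ?normcM.
Qed.

Lemma normc_Re z : `|complex.Re z| <= normc z.
Proof.
by case: z => a b; rewrite /normc/= -sqrtr_sqr ler_wsqrtr// lerDl sqr_ge0.
Qed.

Lemma normc_Im z : `|complex.Im z| <= normc z.
Proof.
by case: z => a b; rewrite /normc/= -sqrtr_sqr ler_wsqrtr// lerDr sqr_ge0.
Qed.

Lemma normc_ReIm z : normc z <= `|complex.Re z| + `|complex.Im z|.
Proof.
rewrite -(@ler_pXn2r _ 2)// ?nnegrE ?normc_ge0 ?addr_ge0//.
by rewrite normc_sqr -(real_normK (num_real (complex.Re z)))
  -(real_normK (num_real (complex.Im z))) sqrrD lerD2r lerDl mulrn_wge0 ?mulr_ge0.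
Qed.

Lemma conjc_inv z : normc z = 1 -> conjc z = z^-1.
Proof.
move=> z1; have z0 : z != 0 by rewrite -normc_gt0 z1.
by apply: (mulfI z0); rewrite mulcJ z1 expr1n mulfV.
Qed.

Lemma conjc_conjc z : conjc (conjc z) = z.
Proof. by case: z => a b; rewrite /= opprK. Qed.

Lemma conjcM x y : conjc (x * y) = conjc x * conjc y.
Proof. exact: rmorphM. Qed.

Lemma normc_exprB1_le (y : R[i]) n : normc y = 1 ->
  normc (y ^+ n - 1) <= n%:R * normc (y - 1).
Proof.
move=> y1; rewrite subrX1 normcM mulrC ler_wpM2r ?normc_ge0//.
rewrite (le_trans (normc_sum _ _ _))// (eq_bigr (fun=> 1)) ?sumr_const ?card_ord//.
by move=> i _; rewrite normcX y1 expr1n.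
Qed.

Lemma conjcX z n : conjc (z ^+ n) = conjc z ^+ n.
Proof. by rewrite rmorphXn. Qed.

End complex_modulus.

(** * Minimum modulus for polynomials *)

Section nearby_roots.
Variable R : realType.
Implicit Types (p : {poly R[i]}) (z : R[i]).

(* Multiplying the values of p over the N-th roots w of r^N gives, root by root,
   prod_w (z0 + w - a) = +-((a - z0)^N - r^N), whose modulus is at most
   2 |z0 - a|^N when |z0 - a| >= r; then N > deg p makes 2^(deg p / N) <= 2. *)
Lemma root_free_min_modulus p z (r m : R) : 0 < r -> 0 <= m ->
  (forall a, root p a -> r <= normc (a - z)) ->
  (forall w, normc w = r -> m <= normc p.[z + w]) ->
  m <= 2 * normc p.[z].
Proof.
move=> r0 m0 rootp pm.
have p0 : p != 0.
  apply/eqP => p0; have := rootp z; rewrite p0 root0 subrr normc0 => /(_ isT).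
  by rewrite leNgt r0.
have c0 : lead_coef p != 0 by rewrite lead_coef_eq0.
have [rs prs] := closed_field_poly_normal p.
set c := lead_coef p in prs c0.
have rroot a : a \in rs -> r <= normc (a - z).
  by move=> ars; apply: rootp; rewrite prs rootZ// root_prod_XsubC.
have pE x : p.[x] = c * \prod_(a <- rs) (x - a).
  rewrite {1}prs hornerZ horner_prod; congr (_ * _).
  by apply: eq_bigr => a _; rewrite hornerXsubC.
pose N := (size rs).+1.
pose q : {poly R[i]} := 'X^N - (r%:C ^+ N)%:P.
have [ws qws] := closed_field_poly_normal q.
rewrite /q lead_coefXnsubC// scale1r in qws.
have qE x : \prod_(w <- ws) (x - w) = x ^+ N - r%:C ^+ N.
  transitivity ('X^N - (r%:C ^+ N)%:P).[x]; last by rewrite !hornerE.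
  rewrite qws horner_prod.
  by apply: eq_bigr => a _; rewrite hornerXsubC.
have sws : size ws = N.
  have := size_XnsubC (r%:C ^+ N) (ltn0Sn (size rs)).
  by rewrite -/N qws size_prod_XsubC => -[].
have constE (x : R[i]) : \prod_(w <- ws) x = x ^+ N.
  by rewrite big_const_seq count_predT sws iter_mulr_1.
have wr w : w \in ws -> normc w = r.
  rewrite -root_prod_XsubC -qws rootE !hornerE subr_eq0 => /eqP /(congr1 (@normc R)).
  rewrite !normcX normcR ger0_norm ?(ltW r0)// => /eqP.
  by rewrite eqrXn2 ?normc_ge0 ?(ltW r0)// => /eqP.
have key : m ^+ N <= (2 * normc p.[z]) ^+ N.
  have h1 : m ^+ N <= normc (\prod_(w <- ws) p.[z + w]).
    have <- : \prod_(w <- ws) m = m ^+ N.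
      by rewrite big_const_seq count_predT sws iter_mulr_1.
    rewrite normc_prod big_seq [leRHS]big_seq; apply: ler_prod => w /wr wr'.
    by rewrite m0/= pm.
  apply: (le_trans h1).
  have -> : \prod_(w <- ws) p.[z + w] =
      c ^+ N * \prod_(a <- rs) \prod_(w <- ws) (z + w - a).
    rewrite (eq_bigr (fun w => c * \prod_(a <- rs) (z + w - a))); last by move=> w _; rewrite pE.
    rewrite big_split/= exchange_big/=; congr (_ * _).
    exact: constE.
  rewrite pE !normcM !exprMn normcX mulrCA ler_wpM2l ?exprn_ge0 ?normc_ge0//.
  rewrite !normc_prod -prodrXl.
  have h2 a : a \in rs ->
      normc (\prod_(w <- ws) (z + w - a)) <= 2 * normc (z - a) ^+ N.
    move=> ars.
    have -> : \prod_(w <- ws) (z + w - a) = (- 1) ^+ N * ((a - z) ^+ N - r%:C ^+ N).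
      rewrite -qE -constE -big_split/=.
      by apply: eq_bigr => i _; ring.
    rewrite normcM normcX (normcN (1 : Rcomplex R)) normc1 expr1n mul1r.
    rewrite (le_trans (normcB_le _ _))// mulr_natl mulr2n !normcX normcB_sym lerD2l.
    rewrite normcR (ger0_norm (ltW r0)) lerXn2r ?nnegrE ?normc_ge0 ?(ltW r0)//.
    by rewrite normcB_sym rroot.
  apply: (@le_trans _ _ (\prod_(a <- rs) (2 * normc (z - a) ^+ N))).
    rewrite big_seq [leRHS]big_seq; apply: ler_prod => a ars.
    by rewrite normc_ge0/= h2.
  rewrite big_split/= ler_wpM2r ?prodr_ge0//.
    by move=> a _; rewrite exprn_ge0 ?normc_ge0.
  rewrite big_const_seq count_predT iter_mulr_1.
  by rewrite ler_weXn2l// ?ler1n.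
by rewrite -(@ler_pXn2r _ N)// nnegrE mulr_ge0 ?normc_ge0.
Qed.

End nearby_roots.

(** * Powers and n-th roots of numbers within O(1/n) of 1 *)

Section unimodular_exponential.
Variable R : realType.
Implicit Types (t x : R) (z v c : R[i]) (n : nat).

Definition cis t : R[i] := cos t +i* sin t.

Lemma normc_cis t : normc (cis t) = 1.
Proof. exact: normc_cos_sin. Qed.

Lemma cis0 : cis 0 = 1.
Proof. by rewrite /cis cos0 sin0. Qed.

Lemma cisD t x : cis (t + x) = cis t * cis x.
Proof.
by rewrite /cis; simpc; rewrite cosD sinD [sin t * _ + _]addrC.
Qed.

Lemma cisX t n : cis t ^+ n = cis (n%:R * t).
Proof.
elim: n => [|n IH]; first by rewrite expr0 mul0r cis0.
by rewrite exprS IH -cisD mulrSr mulrDl mul1r addrC.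
Qed.

Lemma sin_lipschitz_pos t : 0 <= t -> `|sin t| <= t.
Proof.
move=> t0; have [s _] := MVT_segment t0 (fun x _ => is_derive_sin x)
  (continuous_subspaceT (@continuous_sin R)).
rewrite sin0 !subr0 => ->.
by rewrite normrM (ger0_norm t0) ler_piMl// cos_max.
Qed.

Lemma cos_lipschitz_pos t : 0 <= t -> `|cos t - 1| <= t.
Proof.
move=> t0; have [s _] := MVT_segment t0 (fun x _ => is_derive_cos x)
  (continuous_subspaceT (@continuous_cos R)).
rewrite cos0 !subr0 => ->.
by rewrite normrM (ger0_norm t0) ler_piMl// normrN sin_max.
Qed.

Lemma cis_sub1_le t : normc (cis t - 1) <= 2 * `|t|.
Proof.
have -> : normc (cis t - 1) = normc (cis `|t| - 1).
  have [t0|t0] := leP 0 t; first by rewrite ?(ger0_norm t0).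
  rewrite ltr0_norm// -normc_conj; congr normc.
  by rewrite rmorphB rmorph1 /cis cosN sinN.
rewrite (le_trans (normc_ReIm _))// mulr_natl mulr2n.
by rewrite /= subr0 lerD ?cos_lipschitz_pos ?sin_lipschitz_pos.
Qed.

Lemma cis_polar z : normc z = 1 -> exists2 t, `|t| <= pi & z = cis t.
Proof.
move=> z1; have := normc_sqr z; rewrite z1 expr1n; case: z z1 => a b z1 /= ab.
have a1 : -1 <= a <= 1.
  by rewrite -ler_norml (le_trans (normc_Re (a +i* b)))// z1.
have c0 : `|acos a| <= pi.
  by rewrite ger0_norm ?acos_ge0// acos_lepi.
have cacos : cos (acos a) = a by apply: acosK; rewrite in_itv.
have sacos : sin (acos a) = `|b|.
  rewrite sin_acos// -sqrtr_sqr; congr Num.sqrt; lra.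
have [b0|b0] := leP 0 b.
  by exists (acos a) => //; rewrite /cis cacos sacos ger0_norm.
exists (- acos a); first by rewrite normrN.
by rewrite /cis cosN sinN cacos sacos ltr0_norm// opprK.
Qed.

Lemma pi_lt4 : pi < 4 :> R.
Proof. by have := @pihalf_lt2 R; lra. Qed.

Lemma expR_inv_le x : x < 1 -> expR x <= (1 - x)^-1.
Proof.
move=> x1; rewrite -[expR x]invrK lef_pV2 ?posrE ?invr_gt0 ?expR_gt0 ?subr_gt0//.
by rewrite -expRN (le_trans _ (expR_ge1Dx _)).
Qed.

Lemma expR_half_le x : x <= 2^-1 -> expR x <= 2.
Proof.
move=> x1; rewrite (le_trans (expR_inv_le _))//; first lra.
by rewrite -[leRHS]invrK lef_pV2 ?posrE//; lra.
Qed.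

Lemma expR_sub1_le x : `|x| <= 2^-1 -> `|expR x - 1| <= 2 * `|x|.
Proof.
rewrite ler_norml => /andP[x1 x2].
have h := expR_ge1Dx x.
have [x0|x0] := leP 0 x.
  rewrite !ger0_norm//; last lra.
  have := expR_inv_le (_ : x < 1) => /(_ ltac:(lra)) h2.
  have : (1 - x)^-1 <= 1 + 2 * x.
    rewrite -[leLHS]mul1r ler_pdivrMr; nra.
  lra.
have e1 : expR x <= 1 by rewrite expR_le1 ltW.
by rewrite ler0_norm ?ltr0_norm; lra.
Qed.

(** Dividing the polar logarithm l + i t of c by n, where |l| <= L and |t| <= pi, gives the root.
    The modulus part costs 2 L / n, since |exp x - 1| <= 2 |x| for |x| <= 1/2, and the argument part
    costs 2 * 8 / n, with 8 bounding 2 pi. *)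
Lemma nth_root_near1 c n (L : R) : (0 < n)%N -> 2 * L <= n%:R ->
  expR (- L) <= normc c -> normc c <= expR L ->
  exists2 v, v ^+ n = c & normc (v - 1) <= (2 * L + 16) / n%:R.
Proof.
move=> n0 Ln cL1 cL2.
have nn0 : 0 < n%:R :> R by rewrite ltr0n.
have c0 : 0 < normc c by rewrite (lt_le_trans _ cL1)// expR_gt0.
have cc0 : c != 0 by rewrite -normc_gt0.
have [t tpi ct] : exists2 t, `|t| <= pi & c / (normc c)%:C = cis t.
  apply: cis_polar; rewrite normcM normcV normcR ger0_norm ?normc_ge0//.
  by rewrite divff ?gt_eqF.
pose l := ln (normc c).
have lL : `|l| <= L.
  rewrite ler_norml -ler_expR -[X in _ && X]ler_expR /l lnK ?posrE//.
  by rewrite cL1.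
exists ((expR (l / n%:R))%:C * cis (t / n%:R)).
  rewrite exprMn cisX -rmorphXn -expRM_natl.
  rewrite ![n%:R * (_ / n%:R)]mulrC !mulfVK ?gt_eqF// -ct /l lnK ?posrE//.
  by rewrite mulrC mulfVK// (inj_eq (@complexI _)) gt_eqF.
have xL : `|l / n%:R| <= L / n%:R by rewrite normrM normfV (gtr0_norm nn0) ler_pM2r ?invr_gt0.
have xh : `|l / n%:R| <= 2^-1.
  by rewrite (le_trans xL)// ler_pdivrMr//; lra.
set e := expR _; set k := cis _.
have -> : e%:C * k - 1 = e%:C * (k - 1) + (e - 1)%:C.
  by rewrite rmorphB rmorph1; ring.
rewrite (le_trans (normcD_le _ _))// normcM !normcR.
have e2 : `|e| <= 2.
  by rewrite ger0_norm ?expR_ge0// expR_half_le// (le_trans (ler_norm _)).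
have e1 : `|e - 1| <= 2 * (L / n%:R).
  by rewrite (le_trans (expR_sub1_le xh))// ler_pM2l.
have k1 : normc (k - 1) <= 8 / n%:R.
  rewrite (le_trans (cis_sub1_le _))// normrM normfV (gtr0_norm nn0) mulrA.
  rewrite ler_pM2r ?invr_gt0//; have := pi_lt4; lra.
rewrite (@le_trans _ _ (2 * (8 / n%:R) + 2 * (L / n%:R)))//.
  by rewrite lerD// ler_pM ?normc_ge0.
by rewrite !mulrA -mulrDl ler_pM2r ?invr_gt0//; lra.
Qed.

Lemma expr_le_exp v n j (K : R) : (0 < n)%N -> (j <= n)%N -> 0 <= K ->
  normc (v - 1) <= K / n%:R -> normc (v ^+ j) <= expR K.
Proof.
move=> n0 jn K0 vK; have nn0 : 0 < n%:R :> R by rewrite ltr0n.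
have v1 : normc v <= 1 + K / n%:R.
  by rewrite -[v](subrK 1) (le_trans (normcD_le _ _))// normc1 addrC lerD2l.
rewrite normcX (@le_trans _ _ ((1 + K / n%:R) ^+ n))//.
  rewrite (@le_trans _ _ ((1 + K / n%:R) ^+ j))//.
    by rewrite lerXn2r// nnegrE ?normc_ge0// addr_ge0// divr_ge0.
  by rewrite ler_weXn2l// lerDl divr_ge0.
rewrite (@le_trans _ _ (expR (K / n%:R) ^+ n))//.
  by rewrite lerXn2r ?nnegrE ?expR_ge0 ?expR_ge1Dx// addr_ge0// divr_ge0.
by rewrite -expRM_natl mulrC mulfVK ?gt_eqF.
Qed.

(** The factor 2 in the exponent comes from 1 - x >= exp(-2x), valid for 0 <= x <= 1/2; here x = K /
    n. *)
Lemma expr_ge_exp v n (K : R) : (0 < n)%N -> 0 <= K -> 2 * K <= n%:R ->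
  normc (v - 1) <= K / n%:R -> expR (- (2 * K)) <= normc (v ^+ n).
Proof.
move=> n0 K0 Kn vK; have nn0 : 0 < n%:R :> R by rewrite ltr0n.
have x2 : K / n%:R <= 2^-1 by rewrite ler_pdivrMr//; lra.
have x0 : 0 <= K / n%:R by rewrite divr_ge0.
have v1 : 1 - K / n%:R <= normc v.
  have := normcB_ge 1 (1 - v).
  by rewrite opprB addrCA subrr addr0 normc1 (normcB_sym 1); lra.
have v2 : expR (- (2 * (K / n%:R))) <= normc v.
  apply: le_trans v1; set x := K / _ in x0 x2 *.
  rewrite expRN -[leRHS]invrK lef_pV2 ?posrE ?invr_gt0 ?expR_gt0//; last lra.
  apply: (@le_trans _ _ (1 + 2 * x)); last exact: expR_ge1Dx.
  by rewrite -[leLHS]mul1r ler_pdivrMr; nra.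
rewrite normcX (@le_trans _ _ (expR (- (2 * (K / n%:R))) ^+ n))//; last first.
  by rewrite lerXn2r ?nnegrE ?expR_ge0 ?normc_ge0.
by rewrite -expRM_natl mulrN mulrCA [n%:R * _]mulrC mulfVK ?gt_eqF.
Qed.

(** Factor v^n - 1 as v - 1 times a geometric sum. Each of its n terms lies within exp(1/3) - 1 <=
    1/2 of 1, so the sum has modulus at least n / 2. *)
Lemma expr_sub1_ge v n : (0 < n)%N -> normc (v - 1) = (3 * n%:R)^-1 ->
  6^-1 <= normc (v ^+ n - 1).
Proof.
move=> n0 v1; have nn0 : 0 < n%:R :> R by rewrite ltr0n.
have vj j : (j <= n)%N -> normc (v ^+ j - 1) <= 2^-1.
  move=> jn; set r := normc (v - 1) in v1.
  have r0 : 0 <= r by rewrite /r normc_ge0.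
  have h1 : normc (v ^+ j - 1) <= (1 + r) ^+ j - 1.
    rewrite !subrX1 normcM addrAC subrr add0r ler_wpM2l//.
    rewrite (le_trans (normc_sum _ _ _))// ler_sum// => i _.
    rewrite normcX lerXn2r ?nnegrE ?normc_ge0 ?addr_ge0//.
    by rewrite -[v](subrK 1) (le_trans (normcD_le _ _))// normc1 addrC.
  apply: (le_trans h1); rewrite lerBlDr.
  apply: (@le_trans _ _ ((1 + r) ^+ n)); first by rewrite ler_weXn2l// lerDl.
  apply: (@le_trans _ _ (expR r ^+ n)).
    by rewrite lerXn2r ?nnegrE ?expR_ge0 ?expR_ge1Dx ?addr_ge0.
  rewrite -expRM_natl v1 invfM mulrCA divff ?gt_eqF// mulr1.
  rewrite (le_trans (expR_inv_le _))//; first lra.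
  by rewrite -[leLHS]mul1r ler_pdivrMr; lra.
rewrite subrX1 normcM v1.
have : n%:R / 2 <= normc (\sum_(i < n) v ^+ i).
  have -> : \sum_(i < n) v ^+ i = n%:R + \sum_(i < n) (v ^+ i - 1).
    by rewrite big_split/= sumrN sumr_const card_ord addrCA subrr addr0.
  rewrite (le_trans _ (normcD_ge _ _))// normc_nat.
  have : normc (\sum_(i < n) (v ^+ i - 1)) <= n%:R / 2; last lra.
  rewrite (le_trans (normc_sum _ _ _))//.
  apply: (@le_trans _ _ (\sum_(i < n) 2^-1)).
    by apply: ler_sum => i _; rewrite vj// ltnW.
  by rewrite sumr_const card_ord -[2^-1 *+ n]mulr_natl.
move=> h; rewrite (@le_trans _ _ ((3 * n%:R)^-1 * (n%:R / 2)))//.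
  by rewrite invfM mulrA -(mulrA 3^-1) mulVf ?gt_eqF//; lra.
by rewrite ler_pM2l// invr_gt0 mulr_gt0.
Qed.

End unimodular_exponential.

(** * Integration against charges and arclength *)

Section bounded_linear_functionals.
Context d (T : measurableType d) (R : realType).
Implicit Types (f g : T -> R) (A : set T) (L : (T -> R) -> R).

Definition bounded_measurable f :=
  measurable_fun setT f /\ exists M : R, forall x, `|f x| <= M.

Lemma bounded_measurable_cst c : bounded_measurable (fun=> c).
Proof. by split; [exact: measurable_cst|exists `|c|]. Qed.

Lemma bounded_measurableD f g : bounded_measurable f ->
  bounded_measurable g -> bounded_measurable (fun x => f x + g x).
Proof.
move=> [mf [M fM]] [mg [N gN]]; split; first exact: measurable_funD.
by exists (M + N) => x; rewrite (le_trans (ler_normD _ _))// lerD.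
Qed.

Lemma bounded_measurableM f g : bounded_measurable f ->
  bounded_measurable g -> bounded_measurable (fun x => f x * g x).
Proof.
move=> [mf [M fM]] [mg [N gN]]; split; first exact: measurable_funM.
by exists (M * N) => x; rewrite normrM ler_pM.
Qed.

Lemma bounded_measurableZ c f : bounded_measurable f ->
  bounded_measurable (fun x => c * f x).
Proof. by move=> bf; apply: bounded_measurableM => //; exact: bounded_measurable_cst. Qed.

Lemma bounded_measurableB f g : bounded_measurable f ->
  bounded_measurable g -> bounded_measurable (fun x => f x - g x).
Proof.
move=> bf bg; have := bounded_measurableD bf (bounded_measurableZ (- 1) bg).
by under [in X in X -> _]eq_fun do rewrite mulN1r.
Qed.

Lemma bounded_measurable_indic A : measurable A -> bounded_measurable (\1_A : T -> R).
Proof.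
move=> mA; split; first exact: measurable_indic.
by exists 1 => x; rewrite indicE; case: (_ \in _); rewrite ?normr1 ?normr0.
Qed.

Lemma bounded_measurable_sum (I : Type) (r : seq I) (F : I -> T -> R) :
  (forall i, bounded_measurable (F i)) ->
  bounded_measurable (fun x => \sum_(i <- r) F i x).
Proof.
move=> bF; elim: r => [|i r IH].
  by under eq_fun do rewrite big_nil; exact: bounded_measurable_cst.
by under eq_fun do rewrite big_cons; exact: bounded_measurableD.
Qed.

Lemma bounded_funP f (M : R) A : (forall x, `|f x| <= M) -> [bounded f x | x in A].
Proof.
move=> fM; exists M; split; first exact: num_real.
by move=> N MN x _ /=; rewrite (le_trans (fM x))// ltW.
Qed.

Lemma bounded_measurable_integrable (m : {measure set T -> \bar R}) f A :
  (m setT < +oo)%E -> measurable A -> bounded_measurable f ->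
  m.-integrable A (EFin \o f).
Proof.
move=> moo mA [mf [M fM]]; apply: measurable_bounded_integrable => //.
- by rewrite (le_lt_trans _ moo)// le_measure// inE.
- exact: measurable_funS mf.
- exact: bounded_funP fM.
Qed.

(** Common interface of integrals against measures and charges: linear on bounded measurable
    functions and continuous for the uniform norm. Such functionals are determined by their values
    on indicators, which is how identities between integrals are proved below. *)
Definition bounded_linear L := [/\
  forall f g, bounded_measurable f -> bounded_measurable g ->
    L (fun x => f x + g x) = L f + L g,
  forall c f, bounded_measurable f -> L (fun x => c * f x) = c * L f &
  exists2 K : R, 0 <= K & forall (M : R) f, bounded_measurable f ->
    (forall x, `|f x| <= M) -> `|L f| <= K * M].

Lemma bounded_linearD L1 L2 : bounded_linear L1 -> bounded_linear L2 ->
  bounded_linear (fun f => L1 f + L2 f).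
Proof.
move=> [A1 Z1 [K1 K10 B1]] [A2 Z2 [K2 K20 B2]]; split.
- by move=> f g bf bg; rewrite A1// A2// addrACA.
- by move=> c f bf; rewrite Z1// Z2// mulrDr.
- exists (K1 + K2); first exact: addr_ge0.
  move=> M f bf fM; rewrite (le_trans (ler_normD _ _))// mulrDl.
  by rewrite lerD ?B1 ?B2.
Qed.

Lemma bounded_linearN L : bounded_linear L -> bounded_linear (fun f => - L f).
Proof.
move=> [A1 Z1 [K1 K10 B1]]; split.
- by move=> f g bf bg; rewrite A1// opprD.
- by move=> c f bf; rewrite Z1// mulrN.
- by exists K1 => // M f bf fM; rewrite normrN B1.
Qed.

Lemma bounded_linear_sum L (I : Type) (r : seq I) (F : I -> T -> R) :
  bounded_linear L -> (forall i, bounded_measurable (F i)) ->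
  L (fun x => \sum_(i <- r) F i x) = \sum_(i <- r) L (F i).
Proof.
move=> [A1 Z1 _] bF; elim: r => [|i r IH].
  under eq_fun do rewrite big_nil; rewrite big_nil.
  have := Z1 0 (fun=> 0) (bounded_measurable_cst 0).
  by under [in X in X -> _]eq_fun do rewrite mulr0; rewrite mul0r.
under eq_fun do rewrite big_cons; rewrite big_cons A1 ?IH//.
exact: bounded_measurable_sum.
Qed.

(** The sum counts the integers from 1 to N that are at most y, so it is the integer part of y. *)
Lemma sum_ge_trunc (y : R) N : 0 <= y <= N%:R ->
  `|y - \sum_(k < N) ((k.+1%:R <= y)%R)%:R| <= 1.
Proof.
move=> /andP[y0 yN]; set t := Num.trunc y.
have /andP[ty yt] := Num.Theory.truncn_itv y0.
have tN : (t <= N)%N by rewrite -(ler_nat R) (le_trans ty).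
have -> : \sum_(k < N) ((k.+1%:R <= y)%R)%:R = t%:R :> R.
  under eq_bigr do rewrite -Num.Theory.truncn_gt_nat.
  rewrite -natr_sum; congr (_%:R).
  rewrite -[RHS]card_ord -sum1_card (big_ord_widen N (fun=> 1%N) tN).
  by rewrite [RHS]big_mkcond/=; apply: eq_bigr => i _; case: ifP.
by rewrite ger0_norm ?subr_ge0//; move: yt; rewrite mulrSr; lra.
Qed.

(* Step functions are uniformly dense in the bounded measurable functions. *)
Lemma bounded_linear_eq0 L : bounded_linear L ->
  (forall A, measurable A -> L \1_A = 0) ->
  forall f, bounded_measurable f -> L f = 0.
Proof.
move=> bL L0; have [A1 Z1 [K K0 B1]] := bL.
have H01 f : bounded_measurable f -> (forall x, 0 <= f x <= 1) -> L f = 0.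
  move=> bf f01; apply/eqP; rewrite -normr_eq0; apply/eqP/le_anti.
  rewrite normr_ge0 andbT; apply/ler_addgt0Pr => e e0; rewrite add0r.
  pose N := (Num.trunc (K / e)).+1.
  have N0 : 0 < N%:R :> R by rewrite ltr0n.
  have KN : K / N%:R <= e.
    rewrite ler_pdivrMr// mulrC -ler_pdivrMr//.
    by have := Num.Theory.truncn_itv (divr_ge0 K0 (ltW e0)) => /andP[_ /ltW].
  apply: le_trans KN.
  (* Layers of f: the number of sets [E k] containing x is the integer part of N f(x), so the
     average of their indicators is within 1/N of f. *)
  pose E (k : 'I_N) := [set x | k.+1%:R <= N%:R * f x].
  have mE k : measurable (E k).
    have -> : E k = (fun x => N%:R * f x) @^-1` `[k.+1%:R, +oo[ by rewrite preimage_itvcy.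
    rewrite -[X in measurable X]setTI.
    by have [mNf _] := bounded_measurableZ N%:R bf; exact: mNf.
  pose g x : R := N%:R^-1 * \sum_(k < N) \1_(E k) x.
  have bs : bounded_measurable (fun x => \sum_(k < N) \1_(E k) x).
    by apply: bounded_measurable_sum => k; exact: bounded_measurable_indic.
  have bg : bounded_measurable g by exact: bounded_measurableZ.
  have Lg : L g = 0.
    rewrite /g Z1// bounded_linear_sum//.
      by rewrite big1 ?mulr0// => k _; rewrite L0.
    by move=> k; exact: bounded_measurable_indic.
  have -> : L f = L (fun x => f x - g x).
    have := A1 (fun x => f x - g x) g (bounded_measurableB bf bg) bg.
    by rewrite Lg addr0 => <-; congr L; apply/funext => x; rewrite subrK.
  apply: B1; first exact: bounded_measurableB.
  move=> x; have /andP[fx0 fx1] := f01 x.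
  have fN : 0 <= N%:R * f x <= N%:R.
    by rewrite mulr_ge0//= ler_piMr.
  have := sum_ge_trunc fN; set S := \sum_(k < N) _.
  have -> : g x = N%:R^-1 * S.
    rewrite /g; congr (_ * _); apply: eq_bigr => k _; rewrite indicE.
    congr (_%:R); congr nat_of_bool.
    by apply/idP/idP; rewrite inE.
  move=> h; have -> : f x - N%:R^-1 * S = N%:R^-1 * (N%:R * f x - S).
    by rewrite mulrBr mulKf// gt_eqF.
  by rewrite normrM gtr0_norm ?invr_gt0// ler_piMr// invr_ge0 ltW.
move=> f bf; have [mf [M fM]] := bf.
pose M' := `|M| + 1; have M0 : 0 < M' by rewrite ltr_wpDl.
have fM' x : `|f x| <= M' by rewrite (le_trans (fM x))// (le_trans (ler_norm _))// lerDl.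
(* An affine change brings f into [0, 1]; both g and the constant 1/2 are then killed by L. *)
pose g x : R := (2 * M')^-1 * f x + 2^-1.
have bg : bounded_measurable g.
  by apply: bounded_measurableD; [exact: bounded_measurableZ|exact: bounded_measurable_cst].
have Lg : L g = 0.
  apply: H01 => // x; rewrite /g.
  have := fM' x; rewrite ler_norml => /andP[h1 h2].
  have e : (2 * M')^-1 * f x = f x / M' / 2 by rewrite invfM mulrC mulrA mulrAC.
  have h3 : f x / M' <= 1 by rewrite ler_pdivrMr// mul1r.
  have h4 : -1 <= f x / M' by rewrite ler_pdivlMr// mulN1r.
  rewrite e; lra.
have := A1 _ _ (bounded_measurableZ (2 * M')^-1 bf) (bounded_measurable_cst 2^-1).
rewrite -/g Lg (H01 (fun=> 2^-1)); [|exact: bounded_measurable_cst|by move=> _; lra].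
rewrite Z1// addr0 => /esym/eqP; rewrite mulf_eq0 => /orP[|/eqP//].
by rewrite invr_eq0 mulf_eq0 !gt_eqF.
Qed.

Lemma Rintegral_bounded_linear (m : {measure set T -> \bar R}) g :
  m.-integrable setT (EFin \o g) ->
  bounded_linear (fun f => \int[m]_x (f x * g x)).
Proof.
move=> ig.
have ifg f : bounded_measurable f -> m.-integrable setT (EFin \o (fun x => f x * g x)).
  move=> [mf [M fM]].
  have := integrableMr measurableT mf (bounded_funP setT fM) ig.
  by apply: eq_integrable => // x _; rewrite /= EFinM.
split.
- move=> f h bf bh; rewrite -RintegralD//; [|exact: ifg|exact: ifg].
  by apply: eq_Rintegral => x _; rewrite mulrDl.
- move=> c f bf; rewrite -RintegralZl//; last exact: ifg.
  by apply: eq_Rintegral => x _; rewrite mulrA.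
- exists (\int[m]_x `|g x|); first by apply: Rintegral_ge0.
  move=> M f bf fM; have ing := integrable_norm ig.
  rewrite (le_trans (le_normr_Rintegral _ (ifg _ bf)))// mulrC -RintegralZl//.
  apply: le_Rintegral => //.
  + exact: (integrable_norm (ifg _ bf)).
  + have := integrableZl measurableT M ing.
    by apply: eq_integrable => // x _; rewrite /= EFinM.
  + by move=> x _; rewrite normrM ler_wpM2r.
Qed.

Lemma Rintegral_finite_bounded_linear (m : {measure set T -> \bar R}) :
  (m setT < +oo)%E -> bounded_linear (fun f => \int[m]_x f x).
Proof.
move=> moo.
have := @Rintegral_bounded_linear m (fun=> 1)
  (bounded_measurable_integrable moo measurableT (bounded_measurable_cst 1)).
by congr bounded_linear; apply/funext => f; apply: eq_Rintegral => x _; rewrite mulr1.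
Qed.

Lemma Rintegral_indic_fine (m : {measure set T -> \bar R}) A : measurable A ->
  \int[m]_x \1_A x = fine (m A).
Proof.
by move=> mA; rewrite /Rintegral integral_indic ?setIT.
Qed.

End bounded_linear_functionals.

Section charge_functional.
Context d (T : measurableType d) (R : realType).
Implicit Types (nu sg : {charge set T -> \bar R}) (A : set T) (f g : T -> R).

Lemma charge_integral_bounded_linear nu : bounded_linear (charge_integral nu).
Proof.
apply: bounded_linearD; first exact: Rintegral_finite_bounded_linear (fin_num_fun_lty _).
by apply: bounded_linearN; exact: Rintegral_finite_bounded_linear (fin_num_fun_lty _).
Qed.

Lemma charge_integral_indic nu A : measurable A ->
  charge_integral nu \1_A = fine (nu A).
Proof.
move=> mA; rewrite /charge_integral !Rintegral_indic_fine//.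
set PN := svalP _.
have -> : nu A = (jordan_pos PN A - jordan_neg PN A)%E.
  by rewrite (jordan_decomp PN mA) /cadd/= cscaleN1.
by rewrite fineB// fin_num_measure.
Qed.

(** The hypothesis concerns sets only; both sides are bounded linear in f, so agreement on
    indicators suffices. *)
Lemma charge_integral_density nu sg (m : {measure set T -> \bar R}) g :
  m.-integrable setT (EFin \o g) ->
  (forall A, measurable A -> fine (nu A) = \int[m]_(x in A) g x + fine (sg A)) ->
  forall f, bounded_measurable f ->
    charge_integral nu f = \int[m]_x (f x * g x) + charge_integral sg f.
Proof.
move=> ig nuE f bf; apply/eqP; rewrite -subr_eq0; apply/eqP.
apply: (@bounded_linear_eq0 _ _ _
  (fun f => charge_integral nu f - (\int[m]_x (f x * g x) + charge_integral sg f))) => //.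
  apply: bounded_linearD; first exact: charge_integral_bounded_linear.
  apply: bounded_linearN; apply: bounded_linearD; first exact: Rintegral_bounded_linear.
  exact: charge_integral_bounded_linear.
move=> A mA; rewrite !charge_integral_indic// nuE//.
rewrite [X in _ - (X + _)](_ : _ = \int[m]_(x in A) g x) ?subrr//.
rewrite [RHS]Rintegral_mkcond; apply: eq_Rintegral => x _.
by rewrite indicE patchE; case: ifP; rewrite ?mul1r ?mul0r.
Qed.

(** Integration of f times the indicator of U vanishes on indicators, hence identically. What
    remains is f cut off to the complement of U, which is bounded by M everywhere. *)
Lemma charge_integral_null_on sg (U : set T) : measurable U ->
  (forall A, measurable A -> A `<=` U -> sg A = 0%E) ->
  exists2 K : R, 0 <= K & forall (M : R) f, 0 <= M -> bounded_measurable f ->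
    (forall x, ~ U x -> `|f x| <= M) -> `|charge_integral sg f| <= K * M.
Proof.
move=> mU sg0; have [A1 Z1 [K K0 B1]] := charge_integral_bounded_linear sg.
exists K => // M f M0 bf fM.
have bU := bounded_measurable_indic R mU.
have bV := bounded_measurable_indic R (measurableC mU).
have h0 : charge_integral sg (fun x => f x * \1_U x) = 0.
  apply: (@bounded_linear_eq0 _ _ _
    (fun f => charge_integral sg (fun x => f x * \1_U x))) => //.
    split.
    - move=> g h bg bh; rewrite -A1; [|exact: bounded_measurableM..].
      by congr charge_integral; apply/funext => x; rewrite mulrDl.
    - move=> c g bg; rewrite -Z1; last exact: bounded_measurableM.
      by congr charge_integral; apply/funext => x; rewrite mulrA.
    - exists K => // N g bg gN; apply: B1; first exact: bounded_measurableM.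
      move=> x; rewrite normrM indicE (le_trans _ (gN x))// ler_piMr//.
      by case: (_ \in _); rewrite ?normr1 ?normr0.
  move=> A mA; have -> : (fun x => \1_A x * \1_U x) = \1_(A `&` U) :> (T -> R).
    by apply/funext => x; rewrite indicI.
  rewrite charge_integral_indic ?sg0//; first exact: measurableI.
  exact: measurableI.
have -> : charge_integral sg f = charge_integral sg (fun x => f x * \1_(~` U) x).
  rewrite -[LHS]addr0 -h0 -[RHS]add0r -h0.
  have : charge_integral sg f = charge_integral sg (fun x => f x * \1_U x + f x * \1_(~` U) x).
    congr charge_integral; apply/funext => x; rewrite !indicE in_setC.
    by case: (_ \in U); rewrite /= ?mulr1 ?mulr0 ?addr0 ?add0r.
  rewrite A1 => [->||]; [|exact: bounded_measurableM..].
  by rewrite h0 addr0.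
apply: B1; first exact: bounded_measurableM.
move=> x; rewrite normrM indicE in_setC; have [Ux|] := boolP (x \in U).
  by rewrite normr0 mulr0.
by rewrite notin_setE => /fM h; rewrite /= normr1 mulr1.
Qed.

End charge_functional.

(** * Bounded measurable complex functions on the circle *)

Section complex_bounded_functions.
Variable R : realType.
Local Notation T := (circle R).
Implicit Types (f g : T -> R[i]) (p q : {poly R[i]}).

Definition cbounded f :=
  bounded_measurable (fun u => complex.Re (f u)) /\
  bounded_measurable (fun u => complex.Im (f u)).

Lemma cbounded_cst c : cbounded (fun=> c).
Proof. by split; exact: bounded_measurable_cst. Qed.

Lemma cboundedD f g : cbounded f -> cbounded g -> cbounded (fun u => f u + g u).
Proof.
move=> [f1 f2] [g1 g2]; split.
  rewrite [X in bounded_measurable X](_ : _ = fun u => complex.Re (f u) + complex.Re (g u)).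
    exact: bounded_measurableD.
  by apply/funext => u; rewrite raddfD.
rewrite [X in bounded_measurable X](_ : _ = fun u => complex.Im (f u) + complex.Im (g u)).
  exact: bounded_measurableD.
by apply/funext => u; rewrite raddfD.
Qed.

Lemma cboundedM f g : cbounded f -> cbounded g -> cbounded (fun u => f u * g u).
Proof.
move=> [f1 f2] [g1 g2]; split.
  rewrite [X in bounded_measurable X](_ : _ = fun u => complex.Re (f u) * complex.Re (g u)
      - complex.Im (f u) * complex.Im (g u)).
    by apply: bounded_measurableB; exact: bounded_measurableM.
  by apply/funext => u; case: (f u) => a b; case: (g u).
rewrite [X in bounded_measurable X](_ : _ = fun u => complex.Re (f u) * complex.Im (g u)
    + complex.Im (f u) * complex.Re (g u)).
  by apply: bounded_measurableD; exact: bounded_measurableM.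
by apply/funext => u; case: (f u) => a b; case: (g u).
Qed.

Lemma cbounded_conj f : cbounded f -> cbounded (fun u => conjc (f u)).
Proof.
move=> [f1 f2]; split.
  rewrite [X in bounded_measurable X](_ : _ = fun u => complex.Re (f u))//.
  by apply/funext => u; case: (f u).
rewrite [X in bounded_measurable X](_ : _ = fun u => -1 * complex.Im (f u)).
  exact: bounded_measurableZ.
by apply/funext => u; rewrite mulN1r; case: (f u).
Qed.

Lemma cbounded_sum (I : Type) (r : seq I) (F : I -> T -> R[i]) :
  (forall i, cbounded (F i)) -> cbounded (fun u => \sum_(i <- r) F i u).
Proof.
move=> bF; elim: r => [|i r IH].
  by under eq_fun do rewrite big_nil; exact: cbounded_cst.
by under eq_fun do rewrite big_cons; exact: cboundedD.
Qed.

Lemma cboundedX f n : cbounded f -> cbounded (fun u => f u ^+ n).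
Proof.
move=> bf; elim: n => [|n IH]; first exact: cbounded_cst.
by under eq_fun do rewrite exprS; exact: cboundedM.
Qed.

Lemma open_measurable_circle (U : set T) : open U -> measurable U.
Proof. exact: sub_sigma_algebra. Qed.

Lemma continuous_measurable_circle (f : T -> R) : continuous f -> measurable_fun setT f.
Proof.
move=> /continuousP cf; apply: (measurability _ (RGenOpens.measurableE R)).
move=> _ [_ [a [b ->] <-]]; rewrite setTI; apply: open_measurable_circle.
exact/cf/interval_open.
Qed.

Lemma normc_cval (u : T) : normc (cval u) = 1.
Proof. by rewrite /cval; have := set_valP u. Qed.

Lemma cval_continuous : continuous (fun u : T => cval u : R[i]^o).
Proof. exact: (@initial_continuous _ _ (fun u : T => cval u : R[i]^o)). Qed.

Lemma near_normc (z : R[i]^o) (e : R) : 0 < e -> \forall t \near z, normc (z - t) < e.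
Proof.
move=> e0; have /cvgrPdist_lt/(_ e%:C) : id t @[t --> z] --> z by exact: cvg_id.
rewrite ltcR => /(_ e0); apply: (@filterS _ _ (nbhs_filter z)) => t /=.
by rewrite -ltcR.
Qed.

Lemma Re_continuous : continuous (fun z : R[i]^o => complex.Re z).
Proof.
move=> z; apply/(@cvgrPdist_lt _ _ _ _ (nbhs_filter (z : R[i]^o))) => e e0; move: (near_normc z e0).
apply: (@filterS _ _ (nbhs_filter (z : R[i]^o))) => t; apply: le_lt_trans.
by rewrite -raddfB normc_Re.
Qed.

Lemma Im_continuous : continuous (fun z : R[i]^o => complex.Im z).
Proof.
move=> z; apply/(@cvgrPdist_lt _ _ _ _ (nbhs_filter (z : R[i]^o))) => e e0; move: (near_normc z e0).
apply: (@filterS _ _ (nbhs_filter (z : R[i]^o))) => t; apply: le_lt_trans.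
by rewrite -raddfB normc_Im.
Qed.

Lemma cbounded_cval : cbounded (@cval R).
Proof.
split; split.
- apply: continuous_measurable_circle => u.
  apply: (@continuous_comp _ _ _ (fun u : T => cval u : R[i]^o) (fun z => complex.Re z)).
    exact: cval_continuous.
  exact: Re_continuous.
- by exists 1 => u; rewrite (le_trans (normc_Re _))// normc_cval.
- apply: continuous_measurable_circle => u.
  apply: (@continuous_comp _ _ _ (fun u : T => cval u : R[i]^o) (fun z => complex.Im z)).
    exact: cval_continuous.
  exact: Im_continuous.
- by exists 1 => u; rewrite (le_trans (normc_Im _))// normc_cval.
Qed.

Lemma cbounded_horner p : cbounded (fun u => p.[cval u]).
Proof.
under eq_fun do rewrite horner_coef.
apply: cbounded_sum => i; apply: cboundedM; first exact: cbounded_cst.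
exact/cboundedX/cbounded_cval.
Qed.

Lemma bounded_measurable_normc_sqr f : cbounded f ->
  bounded_measurable (fun u => normc (f u) ^+ 2).
Proof.
move=> [f1 f2]; under eq_fun do rewrite normc_sqr !expr2.
by apply: bounded_measurableD; exact: bounded_measurableM.
Qed.

Lemma measurable_normc (f : T -> R[i]) :
  measurable_fun setT (fun u => complex.Re (f u)) ->
  measurable_fun setT (fun u => complex.Im (f u)) ->
  measurable_fun setT (fun u => normc (f u)).
Proof.
move=> f1 f2.
rewrite [X in measurable_fun _ X](_ : _ = fun u => Num.sqrt (complex.Re (f u) * complex.Re (f u) +
  complex.Im (f u) * complex.Im (f u))).
  apply: (measurableT_comp (continuous_measurable_fun (@sqrt_continuous R))).
  by apply: measurable_funD; exact: measurable_funM.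
by apply/funext => u; rewrite -!expr2 -normc_sqr sqrtr_sqr ger0_norm ?normc_ge0.
Qed.

Lemma measurable_circle_ball (s : T) (r : R) : measurable (circle_ball s r).
Proof.
have [m1 m2] := cboundedD cbounded_cval (cbounded_cst (- cval s)).
have := measurable_normc m1.1 m2.1.
move=> /(_ measurableT `]-oo, r[%classic (measurable_itv _)).
rewrite setTI; congr measurable; apply/seteqP; split => u /=; rewrite in_itv//.
Qed.

Lemma circle_ball_sub_open (s : T) (U : set T) : open U -> U s ->
  exists2 r : R, 0 < r & circle_ball s r `<=` U.
Proof.
move=> [V oV <-] Vs.
have := open_nbhs_nbhs (conj oV Vs).
rewrite -nbhs_ballE => -[e e0 eV].
(* Radii of balls in [R[i]] are positive complex numbers: the imaginary part is zero and the real
   part is the radius sought. *)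
move: e e0 eV => [a b]; rewrite /= ltcE/= => /andP[/eqP b0 a0] eV.
exists a => // u /= ua; apply: eV => /=.
rewrite -ball_normE /ball_/= distrC b0.
change ((normc (cval u - cval s))%:C < a%:C).
by rewrite ltcR.
Qed.

End complex_bounded_functions.

Section complexified_functionals.
Variable R : realType.
Local Notation T := (circle R).
Implicit Types (f g : T -> R[i]) (L : (T -> R) -> R) (mu : complex_measure (circle R) R).

(** The complex linear extension of L1 + i L2. It covers [cm_integral], and [arc_integral] with L2 =
    0, so linearity is proved once. *)
Definition complexify L1 L2 f : R[i] :=
  (L1 (fun u => complex.Re (f u)) - L2 (fun u => complex.Im (f u)))
  +i* (L1 (fun u => complex.Im (f u)) + L2 (fun u => complex.Re (f u))).

Lemma complexifyD L1 L2 f g : bounded_linear L1 -> bounded_linear L2 ->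
  cbounded f -> cbounded g ->
  complexify L1 L2 (fun u => f u + g u) = complexify L1 L2 f + complexify L1 L2 g.
Proof.
move=> [A1 _ _] [A2 _ _] [f1 f2] [g1 g2]; rewrite /complexify; simpc.
under [in X in L1 X - _]eq_fun do rewrite raddfD.
under [in X in _ - L2 X]eq_fun do rewrite raddfD.
under [in X in L1 X + _]eq_fun do rewrite raddfD.
under [in X in _ + L2 X]eq_fun do rewrite raddfD.
by rewrite !(A1, A2)//; congr (_ +i* _); ring.
Qed.

Lemma complexifyZ L1 L2 c f : bounded_linear L1 -> bounded_linear L2 ->
  cbounded f -> complexify L1 L2 (fun u => c * f u) = c * complexify L1 L2 f.
Proof.
move=> [A1 Z1 _] [A2 Z2 _] [f1 f2]; case: c => a b; rewrite /complexify.
have ReE u : complex.Re ((a +i* b) * f u) =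
    a * complex.Re (f u) + (- b) * complex.Im (f u).
  by case: (f u) => x y /=; rewrite mulNr.
have ImE u : complex.Im ((a +i* b) * f u) =
    a * complex.Im (f u) + b * complex.Re (f u).
  by case: (f u).
under [in X in L1 X - _]eq_fun do rewrite ReE.
under [in X in _ - L2 X]eq_fun do rewrite ImE.
under [in X in L1 X + _]eq_fun do rewrite ImE.
under [in X in _ + L2 X]eq_fun do rewrite ReE.
rewrite !(A1, A2); try exact: bounded_measurableZ.
rewrite !(Z1, Z2)//; simpc; congr (_ +i* _); ring.
Qed.

Lemma complexify_sum L1 L2 (I : Type) (r : seq I) (F : I -> T -> R[i]) :
  bounded_linear L1 -> bounded_linear L2 -> (forall i, cbounded (F i)) ->
  complexify L1 L2 (fun u => \sum_(i <- r) F i u) =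
  \sum_(i <- r) complexify L1 L2 (F i).
Proof.
move=> b1 b2 bF; elim: r => [|i r IH].
  under eq_fun do rewrite big_nil; rewrite big_nil.
  have := complexifyZ 0 b1 b2 (cbounded_cst 0).
  by under [in X in X -> _]eq_fun do rewrite mul0r; rewrite mul0r.
under eq_fun do rewrite big_cons; rewrite big_cons complexifyD ?IH//.
exact: cbounded_sum.
Qed.

Lemma cm_integralD mu f g : cbounded f -> cbounded g ->
  cm_integral mu (fun u => f u + g u) = cm_integral mu f + cm_integral mu g.
Proof. by apply: complexifyD; exact: charge_integral_bounded_linear. Qed.

Lemma cm_integralZ mu c f : cbounded f ->
  cm_integral mu (fun u => c * f u) = c * cm_integral mu f.
Proof. by apply: complexifyZ; exact: charge_integral_bounded_linear. Qed.

Lemma bounded_linear0 : @bounded_linear _ T R (fun=> 0).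
Proof.
split=> [f g _ _|c f _|]; first by rewrite addr0.
- by rewrite mulr0.
- by exists 0 => // M f _ _; rewrite normr0 mul0r.
Qed.

Lemma arclength_lty : (arclength R setT < +oo)%E.
Proof.
rewrite /arclength /pushforward preimage_setT /mrestr setTI.
rewrite /=; rewrite lebesgue_measure_itv/=.
by case: ifPn => // _; rewrite -EFinB ltry.
Qed.

Definition arc_integral f : R[i] := cintegral (arclength R) setT f.

Lemma arc_integralE f :
  arc_integral f = complexify (fun h => \int[arclength R]_u h u) (fun=> 0) f.
Proof. by rewrite /arc_integral /cintegral /complexify subr0 addr0. Qed.

Lemma arclength_bounded_linear : bounded_linear (fun h : T -> R => \int[arclength R]_u h u).
Proof. exact/Rintegral_finite_bounded_linear/arclength_lty. Qed.

Lemma arc_integralZ c f : cbounded f ->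
  arc_integral (fun u => c * f u) = c * arc_integral f.
Proof.
rewrite !arc_integralE; apply: complexifyZ; first exact: arclength_bounded_linear.
exact: bounded_linear0.
Qed.

Lemma arc_integral_sum (I : Type) (r : seq I) (F : I -> T -> R[i]) :
  (forall i, cbounded (F i)) ->
  arc_integral (fun u => \sum_(i <- r) F i u) = \sum_(i <- r) arc_integral (F i).
Proof.
move=> bF; rewrite arc_integralE complexify_sum//.
- by apply: eq_bigr => i _; rewrite arc_integralE.
- exact: arclength_bounded_linear.
- exact: bounded_linear0.
Qed.

Local Notation D := (`[0, 2 * pi[%classic : set (measurableTypeR R)).

(** Change of variables for the pushforward: both sides are bounded linear functionals that agree on
    indicators by definition of [arclength]. *)
Lemma Rintegral_arclength (f : T -> R) : bounded_measurable f ->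
  \int[arclength R]_u f u = \int[lebesgue_measure]_(t in D) f (expi t).
Proof.
have mD : measurable D by exact: measurable_itv.
have Doo : (lebesgue_measure D < +oo)%E.
  by rewrite /= lebesgue_measure_itv/=; case: ifPn => // _; rewrite -EFinB ltry.
have iD (h : T -> R) : bounded_measurable h ->
    lebesgue_measure.-integrable D (EFin \o (fun t => h (expi t))).
  move=> [mh [M hM]]; apply: measurable_bounded_integrable => //.
    by apply: measurable_funTS; apply: (measurableT_comp mh); exact: measurable_expi.
  exact: (bounded_funP _ (fun t => hM (expi t))).
have bl : bounded_linear (fun h : T -> R => \int[lebesgue_measure]_(t in D) h (expi t)).
  split.
  - by move=> g h bg bh; rewrite RintegralD//; exact: iD.
  - by move=> c h bh; rewrite RintegralZl//; exact: iD.
  - exists (fine (lebesgue_measure D)); first exact: fine_ge0.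
    move=> M h bh hM; rewrite (le_trans (le_normr_Rintegral _ (iD _ bh)))// [leRHS]mulrC.
    rewrite -Rintegral_cst//; apply: le_Rintegral => //.
    + exact: (integrable_norm (iD _ bh)).
    + exact: (iD _ (bounded_measurable_cst _ M)).
move=> bf; apply/eqP; rewrite -subr_eq0; apply/eqP.
apply: (bounded_linear_eq0 (bounded_linearD arclength_bounded_linear (bounded_linearN bl))) bf.
move=> A mA; rewrite Rintegral_indic_fine//; apply/eqP; rewrite subr_eq0; apply/eqP.
rewrite /arclength /pushforward /mrestr /Rintegral.
rewrite -[RHS]/(fine (\int[lebesgue_measure]_(t in D) (\1_(@expi R @^-1` A) t)%:E)).
rewrite integral_indic//.
by rewrite -[X in measurable X]setTI; exact: measurable_expi.
Qed.

Lemma Rintegral_itv_FTC (f F : R -> R) (a b : R) : a < b -> continuous f ->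
  (forall x : R, is_derive x 1 F (f x)) ->
  \int[lebesgue_measure]_(t in `[a, b[) f t = F b - F a.
Proof.
move=> ab cf dF.
have cF : continuous F.
  by move=> x; apply/differentiable_continuous/derivable1_diffP; have [] := dF x.
rewrite Rintegral_itv_bndo_bndc; last first.
  have ii : lebesgue_measure.-integrable `[a, b]%classic (EFin \o f).
    apply: continuous_compact_integrable; first exact: segment_compact.
    exact: continuous_subspaceT.
  apply: integrableS ii; [exact: measurable_itv|exact: measurable_itv|].
  exact: subset_itv_co_cc.
rewrite /Rintegral (@continuous_FTC2 _ f F)//.
- exact: continuous_subspaceT.
- split.
  + by move=> x _; have [] := dF x.
  + exact/cvg_at_right_filter/cF.
  + exact/cvg_at_left_filter/cF.
- by move=> x _; rewrite derive1E; have [_] := dF x.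
Qed.

Lemma is_derive_dilation (f f' : R -> R) (c x : R) : c != 0 ->
  (forall y : R, is_derive y 1 f (f' y)) ->
  is_derive x 1 (fun t : R => f (c * t) / c) (f' (c * x)).
Proof.
move=> c0 df.
have dl : is_derive x 1 (fun t : R => c * t) c.
  by have := @is_deriveZ R R R id c x 1 1 (is_derive_id x 1); rewrite /GRing.scale/= mulr1.
have h := @is_derive1_comp R f (fun t => c * t) x _ _ (df (c * x)) dl.
have := @is_deriveZ R R R (f \o (fun t => c * t)) c^-1 x 1 _ h.
rewrite /GRing.scale/=.
have -> : c^-1 * (f' (c * x) * c) = f' (c * x) by rewrite mulrCA mulVf// mulr1.
by congr (is_derive _ _ _ _); apply/funext => t /=; rewrite /GRing.scale/= mulrC.
Qed.

Lemma cval_expiX (t : R) n : cval (expi t) ^+ n = cis (n%:R * t).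
Proof. by rewrite -cisX. Qed.

Lemma arc_integral_expr n : (0 < n)%N -> arc_integral (fun u => cval u ^+ n) = 0.
Proof.
move=> n0; have nn0 : n%:R != 0 :> R by rewrite pnatr_eq0 -lt0n.
have pi20 : 0 < 2 * pi :> R by rewrite mulr_gt0// pi_gt0.
have [b1 b2] := cboundedX n (@cbounded_cval R).
have per (k : nat) : sin (k%:R * (2 * pi)) = 0 :> R /\ cos (k%:R * (2 * pi)) = 1 :> R.
  have : cis (k%:R * (2 * pi)) = 1 :> R[i].
    rewrite -cisX (_ : cis (2 * pi) = 1) ?expr1n//.
    by rewrite /cis mulrC mulr_natr cos2pi sin2pi.
  by case=> -> ->.
rewrite /arc_integral /cintegral !Rintegral_arclength//.
have -> : (fun t : R => complex.Re (cval (expi t) ^+ n)) = fun t => cos (n%:R * t).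
  by apply/funext => t; rewrite cval_expiX.
have -> : (fun t : R => complex.Im (cval (expi t) ^+ n)) = fun t => sin (n%:R * t).
  by apply/funext => t; rewrite cval_expiX.
have cn : continuous (fun t : R => n%:R * t) by exact: mulrl_continuous.
have dsin (x : R) : is_derive x 1 (fun t : R => sin (n%:R * t) / n%:R) (cos (n%:R * x)).
  by apply: is_derive_dilation.
have dcos (x : R) : is_derive x 1 (fun t : R => - cos (n%:R * t) / n%:R) (sin (n%:R * x)).
  apply: (@is_derive_dilation (fun y => - cos y)) => // y.
  by have := is_deriveN (is_derive_cos y); rewrite opprK.
have ccos : continuous (fun t : R => cos (n%:R * t)).
  by move=> x; apply: continuous_comp; [exact: cn|exact: continuous_cos].
have csin : continuous (fun t : R => sin (n%:R * t)).
  by move=> x; apply: continuous_comp; [exact: cn|exact: continuous_sin].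
rewrite (Rintegral_itv_FTC pi20 ccos dsin) (Rintegral_itv_FTC pi20 csin dcos).
by have [-> ->] := per n; rewrite !mulr0 cos0 sin0 !subrr.
Qed.

Lemma arc_integral_conj f : cbounded f ->
  arc_integral (fun u => conjc (f u)) = conjc (arc_integral f).
Proof.
move=> [_ f2]; rewrite /arc_integral /cintegral /=; congr (_ +i* _).
  by apply: eq_Rintegral => u _; case: (f u).
have [_ Z1 _] := arclength_bounded_linear.
rewrite -mulN1r -Z1//; apply: eq_Rintegral => u _; rewrite mulN1r.
by case: (f u).
Qed.

Lemma arc_integral1 : arc_integral (fun=> 1) = (2 * pi)%:C.
Proof.
rewrite /arc_integral /cintegral /=; congr (_ +i* _).
  rewrite Rintegral_arclength; last exact: bounded_measurable_cst.
  rewrite Rintegral_cst// ?mul1r /= lebesgue_measure_itv/=.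
  by rewrite lte_fin mulr_gt0 ?pi_gt0//= subr0.
by have [_ + _] := arclength_bounded_linear => /(_ 0 (fun=> 0) (bounded_measurable_cst _ 0));
  under [in X in X -> _]eq_Rintegral do rewrite mul0r; rewrite mul0r.
Qed.

Lemma cval_exprB (u : T) j k : (k <= j)%N ->
  cval u ^+ j * conjc (cval u ^+ k) = cval u ^+ (j - k).
Proof.
by move=> kj; rewrite -{1}(subnK kj) exprD -mulrA mulcJ normcX normc_cval !expr1n mulr1.
Qed.

Lemma arc_integral_orthogonal j k :
  arc_integral (fun u => cval u ^+ j * conjc (cval u ^+ k)) = ((j == k)%:R * (2 * pi))%:C.
Proof.
case: (ltngtP j k) => jk.
- rewrite mul0r.
  have -> : (fun u : T => cval u ^+ j * conjc (cval u ^+ k)) =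
      (fun u => conjc (cval u ^+ (k - j))).
    by apply/funext => u; rewrite -(cval_exprB u (ltnW jk)) conjcM conjc_conjc mulrC.
  rewrite arc_integral_conj; last exact/cboundedX/cbounded_cval.
  by rewrite arc_integral_expr ?subn_gt0// rmorph0.
- rewrite mul0r.
  under [X in arc_integral X]eq_fun do rewrite (cval_exprB _ (ltnW jk)).
  by rewrite arc_integral_expr// subn_gt0.
- rewrite jk mul1r -arc_integral1; congr arc_integral; apply/funext => u.
  by rewrite cval_exprB// subnn.
Qed.

End complexified_functionals.

(** * Parseval's identity and Dirichlet kernels *)

Section arc_polynomials.
Variable R : realType.
Local Notation T := (circle R).
Implicit Types (p q : {poly R[i]}) (s u : T) (h : T -> R[i]).

(** Parseval: the monomials are orthogonal on the circle, with squared norm 2 pi. *)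
Lemma arc_integral_poly p q n : (size p <= n)%N -> (size q <= n)%N ->
  arc_integral (fun u : T => p.[cval u] * conjc q.[cval u]) =
  (2 * pi)%:C * \sum_(i < n) p`_i * conjc q`_i.
Proof.
move=> pn qn.
have -> : (fun u : T => p.[cval u] * conjc q.[cval u]) = (fun u =>
    \sum_(i < n) \sum_(j < n) (p`_i * conjc q`_j) * (cval u ^+ i * conjc (cval u ^+ j))).
  apply/funext => u; rewrite (horner_coef_wide _ pn) (horner_coef_wide _ qn).
  rewrite rmorph_sum big_distrl/=; apply: eq_bigr => i _.
  rewrite big_distrr/=; apply: eq_bigr => j _.
  by rewrite conjcM; ring.
have bij i j : cbounded (fun u : T => cval u ^+ i * conjc (cval u ^+ j)).
  apply: cboundedM; first exact/cboundedX/cbounded_cval.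
  exact/cbounded_conj/cboundedX/cbounded_cval.
rewrite arc_integral_sum; last first.
  move=> i; apply: cbounded_sum => j; apply: cboundedM => //; exact: cbounded_cst.
rewrite big_distrr/=; apply: eq_bigr => i _.
rewrite arc_integral_sum; last first.
  by move=> j; apply: cboundedM => //; exact: cbounded_cst.
rewrite (bigD1 i)//= arc_integralZ// arc_integral_orthogonal eqxx mul1r big1 ?addr0.
  by rewrite mulrC.
move=> j ji; rewrite arc_integralZ// arc_integral_orthogonal.
by rewrite -val_eqE/= eq_sym in ji; rewrite (negbTE ji) mul0r rmorph0 mulr0.
Qed.

(** The Dirichlet kernel centred at s, normalized to take the value 1 there. *)
Definition dirichlet (N : nat) s : {poly R[i]} :=
  \poly_(j < N) (N%:R^-1 * conjc (cval s) ^+ j).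

Lemma dirichletE N s z :
  (dirichlet N s).[z] = N%:R^-1 * \sum_(j < N) (z * conjc (cval s)) ^+ j.
Proof.
rewrite horner_poly big_distrr/=; apply: eq_bigr => j _.
by rewrite exprMn mulrAC mulrA.
Qed.

Lemma size_dirichlet N s : (size (dirichlet N s) <= N)%N.
Proof. exact: size_poly. Qed.

Lemma normc_rotate s u : normc (cval u * conjc (cval s)) = 1.
Proof. by rewrite normcM normc_conj !normc_cval mulr1. Qed.

Lemma normc_rotate_sub1 s u :
  normc (cval u * conjc (cval s) - 1) = normc (cval u - cval s).
Proof.
rewrite -[RHS]mulr1 -(normc_cval s) -(normc_conj (cval s)) -normcM; congr normc.
by rewrite mulrBl mulcJ normc_cval expr1n.
Qed.

Lemma dirichlet_center N s : (0 < N)%N -> (dirichlet N s).[cval s] = 1.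
Proof.
move=> N0; rewrite dirichletE mulcJ normc_cval expr1n.
rewrite (eq_bigr (fun=> 1)) ?sumr_const ?card_ord ?mulVf ?pnatr_eq0 -?lt0n//.
by move=> i _; rewrite expr1n.
Qed.

Lemma normc_dirichlet_le1 N s u : normc (dirichlet N s).[cval u] <= 1.
Proof.
have [->|N0] := posnP N; first by rewrite dirichletE big_ord0 mulr0 normc0.
have NR : 0 < N%:R :> R by rewrite ltr0n.
rewrite dirichletE normcM normcV normc_nat mulrC ler_pdivrMr// mul1r.
rewrite (le_trans (normc_sum _ _ _))// (eq_bigr (fun=> 1)) ?sumr_const ?card_ord//.
by move=> j _; rewrite normcX normc_rotate expr1n.
Qed.

Lemma normc_dirichlet_decay N s u :
  N%:R * normc (cval u - cval s) * normc (dirichlet N s).[cval u] <= 2.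
Proof.
have [->|N0] := posnP N; first by rewrite !mul0r.
rewrite -normc_rotate_sub1 dirichletE normcM normcV normc_nat mulrACA mulfV ?pnatr_eq0 -?lt0n//.
rewrite mul1r -normcM -subrX1 (le_trans (normcB_le _ _))//.
by rewrite normcX normc_rotate normc1 expr1n.
Qed.

Lemma normc_dirichlet_ge N s u : (0 < N)%N ->
  N%:R * normc (cval u - cval s) <= 2^-1 -> 2^-1 <= normc (dirichlet N s).[cval u].
Proof.
move=> N0 Nd; have NR : 0 < N%:R :> R by rewrite ltr0n.
rewrite dirichletE normcM normcV normc_nat mulrC ler_pdivlMr//.
set y := cval u * _.
have -> : \sum_(j < N) y ^+ j = N%:R + \sum_(j < N) (y ^+ j - 1).
  by rewrite big_split/= sumrN sumr_const card_ord addrCA subrr addr0.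
rewrite (le_trans _ (normcD_ge _ _))// normc_nat lerBrDl -lerBrDr.
rewrite (le_trans (normc_sum _ _ _))//.
apply: (@le_trans _ _ (\sum_(j < N) 2^-1)).
  apply: ler_sum => j _; apply: le_trans Nd.
  rewrite (le_trans (normc_exprB1_le _ (normc_rotate s u)))//.
  by rewrite normc_rotate_sub1 ler_wpM2r ?normc_ge0// ler_nat ltnW.
by rewrite sumr_const card_ord -[2^-1 *+ N]mulr_natl; lra.
Qed.

Lemma Rintegral_dirichlet N s : (0 < N)%N ->
  \int[arclength R]_u normc (dirichlet N s).[cval u] ^+ 2 = 2 * pi / N%:R.
Proof.
move=> N0; have NR : 0 < N%:R :> R by rewrite ltr0n.
have := arc_integral_poly (size_dirichlet N s) (size_dirichlet N s).
have -> : \sum_(i < N) (dirichlet N s)`_i * conjc (dirichlet N s)`_i = (N%:R^-1)%:C.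
  rewrite (eq_bigr (fun=> (N%:R^-2)%:C)) => [|i _].
    rewrite sumr_const card_ord -rmorphMn; congr (_%:C).
    by rewrite -(mulr_natl (N%:R ^- 2) N) expr2 invfM mulVKf// gt_eqF.
  rewrite !coef_poly ltn_ord mulcJ normcM normcV normc_nat normcX normc_conj.
  by rewrite normc_cval expr1n mulr1 exprVn.
rewrite -rmorphM => /(congr1 (@complex.Re R)).
rewrite /arc_integral /cintegral/= => <-.
by apply: eq_Rintegral => u _; rewrite mulcJ.
Qed.

(** This avoids parametrizing the arc. With N the integer part of 1 / (2r), the Dirichlet kernel is
    at least 1/2 on the ball, so 4 |D_N|^2 majorizes the indicator; its integral is 8 pi / N, where
    1 / N <= 4 r and pi < 4. When r >= 1/2 the total length is already below the bound. *)
Lemma Rintegral_ball_le s (r : R) : 0 < r ->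
  \int[arclength R]_u \1_(circle_ball s r) u <= 128 * r.
Proof.
move=> r0.
have iB f : bounded_measurable f -> (arclength R).-integrable setT (EFin \o f).
  by apply: bounded_measurable_integrable => //; exact: arclength_lty.
have mB := bounded_measurable_indic R (measurable_circle_ball s r).
have [r2|r2] := leP 2^-1 r.
  apply: (@le_trans _ _ (\int[arclength R]_u 1)).
    apply: le_Rintegral => //; first exact: iB.
      exact: iB (bounded_measurable_cst _ _).
  have -> : \int[arclength R]_u 1 = 2 * pi := congr1 (@complex.Re R) (arc_integral1 R).
  have := pi_lt4 R; lra.
pose N := Num.trunc (2 * r)^-1.
have r20 : 0 < (2 * r)^-1 by rewrite invr_gt0; lra.
have /andP[N1 N2] := Num.Theory.truncn_itv (ltW r20).
rewrite -/N in N1 N2.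
have N0 : (0 < N)%N.
  rewrite /N Num.Theory.truncn_gt_nat -(@ler_pM2l _ (2 * r)); last lra.
  rewrite mulfV; lra.
have NR : 0 < N%:R :> R by rewrite ltr0n.
have Nr : N%:R * r <= 2^-1.
  have := ler_wpM2r (ltW r0) N1.
  by rewrite invfM -mulrA mulVf ?gt_eqF// mulr1.
have Nr2 : 1 <= 4 * r * N%:R.
  have : (2 * r) * (2 * r)^-1 <= (2 * r) * N.+1%:R by rewrite ler_pM2l ?ltW//; lra.
  rewrite mulfV; last lra.
  have : 1 <= N%:R :> R by rewrite ler1n.
  rewrite mulrSr; nra.
have bD := bounded_measurable_normc_sqr (cbounded_horner (dirichlet N s)).
apply: (@le_trans _ _ (\int[arclength R]_u (4 * normc (dirichlet N s).[cval u] ^+ 2))).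
  apply: le_Rintegral => //; first exact: iB.
    exact: iB (bounded_measurableZ _ bD).
  move=> u _; rewrite indicE; case: (boolP (u \in _)) => [|_]; last first.
    by rewrite mulr_ge0// sqr_ge0.
  rewrite inE => /= ur.
  have : 2^-1 <= normc (dirichlet N s).[cval u].
    apply: normc_dirichlet_ge => //; apply: le_trans Nr.
    by rewrite ler_pM2l// ltW.
  rewrite /=; nra.
rewrite RintegralZl//; last exact: iB.
rewrite Rintegral_dirichlet// mulrA ler_pdivrMr//.
have := pi_lt4 R; have := @pi_gt0 R; nra.
Qed.

End arc_polynomials.

(** * Localization at a Lebesgue point *)

Section localization.
Variable R : realType.
Local Notation T := (circle R).
Implicit Types (s u : T) (h w : T -> R[i]) (mu sigma : complex_measure (circle R) R).

(** Replaces a kernel k of size min(n, 1 / (n d^2)) by multiples of indicators of balls, the sets on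
    which a Lebesgue point gives information. On the shell 2^(m-1) / n <= d < 2^m / n one has k <= 4
    n / 4^m; the last term covers d >= 2^M / n. *)
Lemma dyadic_majorant (n k d : R) (M : nat) : 0 < n -> 0 <= d -> 0 <= k ->
  k <= n -> k * d ^+ 2 <= n^-1 ->
  k <= \sum_(m < M.+1) 4 * n / 4 ^+ m * (d < 2 ^+ m / n)%R%:R + n / 4 ^+ M.
Proof.
move=> n0 d0 k0 kn kd.
have far m : 2 ^+ m / n <= d -> k <= n / 4 ^+ m.
  move=> md; rewrite ler_pdivlMr ?exprn_gt0//.
  have m0 : 0 <= 2 ^+ m / n :> R by rewrite divr_ge0 ?exprn_ge0// ltW.
  have : k * (2 ^+ m / n) ^+ 2 <= n^-1.
    by apply: le_trans kd; rewrite ler_wpM2l// lerXn2r.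
  rewrite expr_div_n -exprM mulnC exprM (_ : 2 ^+ 2 = 4); last by rewrite expr2; lra.
  rewrite mulrA ler_pdivrMr ?exprn_gt0// expr2 mulKf//.
  by rewrite gt_eqF.
have term0 (m : nat) : 0 <= 4 * n / 4 ^+ m * (d < 2 ^+ m / n)%R%:R.
  by rewrite mulr_ge0// divr_ge0 ?exprn_ge0// mulr_ge0// ltW.
have [dM|dM] := ltP d (2 ^+ M / n); last first.
  rewrite (le_trans (far _ dM))// lerDr.
  by apply: sumr_ge0.
rewrite -[leLHS]addr0 lerD//; last by rewrite divr_ge0 ?exprn_ge0// ltW.
elim: M dM => [|M IH] dM.
  rewrite big_ord1 dM !expr0 divr1 mulr1; nra.
rewrite big_ord_recr/=.
have [dM'|dM'] := ltP d (2 ^+ M / n); first by rewrite -[leLHS]addr0 lerD// IH.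
rewrite -[leLHS]add0r lerD//; first exact: sumr_ge0.
rewrite dM mulr1 (le_trans (far _ dM'))// exprS invfM mulrACA mulfV ?mul1r//.
Qed.

Lemma lebesgue_pt_ball (f : T -> R[i]) s : cintegrable (arclength R) f ->
  circle_lebesgue_pt f s -> forall eta : R, 0 < eta -> exists2 r0 : R, 0 < r0 &
  forall r : R, 0 < r -> r < r0 ->
    \int[arclength R]_u (\1_(circle_ball s r) u * normc (f u - f s)) <= eta * (128 * r).
Proof.
move=> [f1 f2] /fine_cvgP[finV cvV] eta eta0.
have [r0 r00 Hr0] : exists2 r0 : R, 0 < r0 & forall r, 0 < r -> r < r0 ->
    let v := ((arclength R (circle_ball s r))^-1
    * \int[arclength R]_(t in circle_ball s r) (normc (f t - f s))%:E)%E in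
    v \is a fin_num /\ fine v < eta.
  move/cvgrPdist_lt : cvV => /(_ _ eta0) cvV.
  have := filterI finV cvV => -[r0 /= r00 H].
  exists r0 => // r r1 r2; have := H r; rewrite /= sub0r normrN gtr0_norm// => /(_ r2 r1).
  move=> [h1 h2]; split => //; move: h2; rewrite sub0r normrN.
  exact: le_lt_trans (ler_norm _).
exists r0 => // r r1 r2.
set B := circle_ball s r.
have mB : measurable B := measurable_circle_ball s r.
have [] := Hr0 r r1 r2; rewrite -/B.
set A := arclength R B; set I := (\int[_]_(t in B) _)%E.
have A0 : (0 <= A)%E by exact: measure_ge0.
have I0 : (0 <= I)%E by apply: integral_ge0 => u _; rewrite lee_fin normc_ge0.
have Afin : A \is a fin_num.
  rewrite ge0_fin_numE// (le_lt_trans _ (arclength_lty R))// le_measure// inE//.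
have -> : \int[arclength R]_u (\1_B u * normc (f u - f s)) = fine I.
  rewrite -[fine I]/(Rintegral _ _ _) [RHS]Rintegral_mkcond; apply: eq_Rintegral => u _.
  by rewrite indicE patchE; case: ifP; rewrite ?mul1r ?mul0r.
have Ale : fine A <= 128 * r.
  by rewrite -Rintegral_indic_fine// Rintegral_ball_le.
(* In the extended reals the inverse of 0 is +oo, so a ball of length 0 has a finite average only if
   its integral I is 0. *)
have [A00|A00] := eqVneq A 0%E.
  rewrite A00 inve0 => yI _.
  have -> : I = 0%E.
    apply/eqP; rewrite eq_le I0 andbT leNgt; apply/negP => Igt.
    by move: yI; rewrite gt0_mulye.
  by rewrite /= mulr_ge0 ?(ltW eta0)// mulr_ge0 ?(ltW r1).
move=> vfin vlt.
have -> : fine I = fine A * fine (A^-1 * I)%E.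
  by rewrite -fineM// muleA (muleC A) mulVe// mul1e.
have fA0 : 0 <= fine A by exact: fine_ge0.
rewrite mulrC ler_pM//.
- by rewrite fine_ge0// mule_ge0// inve_ge0.
- exact: ltW.
Qed.

Lemma sum_half_le M : \sum_(m < M) (2^-1) ^+ m <= 2 :> R.
Proof.
have -> : \sum_(m < M) (2^-1) ^+ m = 2 - 2 * (2^-1) ^+ M :> R.
  by elim: M => [|M IH]; rewrite ?big_ord0 ?expr0 ?big_ord_recr/= ?IH ?exprS; lra.
by rewrite gerBl mulr_ge0// exprn_ge0.
Qed.

(** Integrating the dyadic majorant against F, the ball of radius 2^m / n contributes at most 4 n /
    4^m * 128 eta 2^m / n = 512 eta / 2^m, and the geometric series gives 1024 eta. The tail n / 4^M
    is O(1/n) and multiplies the full integral of F. The function y is only dominated by F so that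
    real and imaginary parts can be treated separately. *)
Lemma integrable_localized (F : T -> R) s (r0 eta : R) :
  0 < r0 -> 0 < eta -> (arclength R).-integrable setT (EFin \o F) ->
  (forall u, 0 <= F u) ->
  (forall r : R, 0 < r -> r < r0 ->
    \int[arclength R]_u (\1_(circle_ball s r) u * F u) <= eta * (128 * r)) ->
  exists2 K : R, 0 <= K & exists n0 : nat, forall n, (n0 <= n)%N ->
  forall x y : T -> R,
    bounded_measurable x -> measurable_fun setT y ->
    (forall u, `|y u| <= F u) ->
    (forall u, `|x u| <= n%:R) ->
    (forall u, `|x u| * normc (cval u - cval s) ^+ 2 <= n%:R^-1) ->
    `|\int[arclength R]_u (x u * y u)| <= 1024 * eta + K / n%:R.
Proof.
move=> r00 eta0 iF F0 ballF.
pose p0 := (Num.trunc r0^-1).+1.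
have p0r : p0%:R^-1 < r0.
  rewrite -[ltRHS]invrK ltf_pV2 ?posrE ?invr_gt0//.
  by have := Num.Theory.truncn_itv (_ : 0 <= r0^-1) => /(_ ltac:(by rewrite invr_ge0 ltW)) /andP[].
pose NF := \int[arclength R]_u F u.
have NF0 : 0 <= NF by apply: Rintegral_ge0.
exists (4 * p0%:R ^+ 2 * NF); first by rewrite mulr_ge0// mulr_ge0// exprn_ge0.
exists p0 => n p0n x y bx my yF xn xd.
have nN0 : (0 < n)%N by exact: leq_trans p0n.
have n0 : 0 < n%:R :> R by rewrite ltr0n.
(* The largest M with 2^M p0 <= n: all balls used have radius at most 1 / p0 < r0, and n < 2^(M+1)
   p0 makes the tail n / 4^M at most 4 p0^2 / n. *)
pose M := trunc_log 2 (n %/ p0).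
have np0 : (0 < n %/ p0)%N by rewrite divn_gt0.
have M1 : (2 ^ M * p0 <= n)%N.
  by rewrite (leq_trans _ (leq_trunc_div n p0))// leq_mul2r trunc_logP ?orbT.
have M2 : (n < 2 ^ M.+1 * p0)%N.
  by rewrite -ltn_divLR// trunc_log_ltn.
have smallball (m : nat) : (m <= M)%N -> 2 ^+ m / n%:R < r0 :> R.
  move=> mM; apply: le_lt_trans p0r.
  rewrite ler_pdivrMr// -ler_pdivrMl ?invr_gt0// invrK mulrC -natrX -natrM ler_nat.
  by rewrite (leq_trans _ M1)// leq_mul2r leq_exp2l// mM orbT.
have ball0 (m : nat) : 0 < 2 ^+ m / n%:R :> R by rewrite divr_gt0 ?exprn_gt0.
have bB m := bounded_measurable_indic R (measurable_circle_ball s (2 ^+ m / n%:R)).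
pose bump (m : 'I_M.+1) u : R := (4 * n%:R / 4 ^+ m) * \1_(circle_ball s (2 ^+ m / n%:R)) u.
pose maj u := \sum_(m < M.+1) bump m u + n%:R / 4 ^+ M.
have xmaj u : `|x u| <= maj u.
  have := @dyadic_majorant n%:R `|x u| (normc (cval u - cval s)) M n0.
  rewrite normc_ge0 => /(_ isT (normr_ge0 _) (xn u) (xd u)) /le_trans; apply.
  rewrite lerD2r; apply: ler_sum => m _.
  rewrite /bump indicE.
  have -> // : (u \in circle_ball s (2 ^+ m / n%:R)) = (normc (cval u - cval s) < 2 ^+ m / n%:R).
  by apply/idP/idP; rewrite inE.
have bb m : bounded_measurable (bump m) by exact: bounded_measurableZ.
have bS : bounded_measurable (fun u => \sum_(m < M.+1) bump m u).
  exact: bounded_measurable_sum.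
have bmaj : bounded_measurable maj.
  by apply: bounded_measurableD => //; exact: bounded_measurable_cst.
have iMF f : bounded_measurable f -> (arclength R).-integrable setT (EFin \o (fun u => f u * F u)).
  move=> [mf [C fC]].
  have := integrableMr measurableT mf (bounded_funP setT fC) iF.
  by apply: eq_integrable => // u _; rewrite /= EFinM.
have iy : (arclength R).-integrable setT (EFin \o y).
  apply: le_integrable iF => //; first exact/measurable_EFinP.
  by move=> u _; rewrite lee_fin (ger0_norm (F0 u)).
have ixy : (arclength R).-integrable setT (EFin \o (fun u => x u * y u)).
  have [mx [C xC]] := bx.
  have := integrableMr measurableT mx (bounded_funP setT xC) iy.
  by apply: eq_integrable => // u _; rewrite /= EFinM.
rewrite (le_trans (le_normr_Rintegral _ ixy))//.
apply: (@le_trans _ _ (\int[arclength R]_u (maj u * F u))).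
  apply: le_Rintegral => //; [exact: (integrable_norm ixy)|exact: iMF|].
  by move=> u _; rewrite normrM ler_pM.
have bl := Rintegral_bounded_linear iF.
have [A1 Z1 _] := bl.
rewrite A1//; last exact: bounded_measurable_cst.
rewrite (bounded_linear_sum _ bl); last exact: bb.
apply: lerD.
  apply: (@le_trans _ _ (\sum_(m < M.+1) 512 * eta * (2^-1) ^+ m)).
    apply: ler_sum => m _; rewrite Z1//.
    have c0 : 0 <= 4 * n%:R / 4 ^+ m :> R by rewrite divr_ge0 ?exprn_ge0// mulr_ge0.
    apply: (@le_trans _ _ (4 * n%:R / 4 ^+ m * (eta * (128 * (2 ^+ m / n%:R))))).
      by rewrite ler_wpM2l// ballF// smallball// -ltnS.
    have e4 : 4 ^+ m = 2 ^+ m * 2 ^+ m :> R by rewrite -exprMn; congr (_ ^+ _); lra.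
    have t0 : 2 ^+ m != 0 :> R by rewrite gt_eqF ?exprn_gt0.
    rewrite e4 exprVn le_eqVlt; apply/orP; left; apply/eqP; field.
    by rewrite t0 gt_eqF.
  rewrite -big_distrr/=; have := sum_half_le M.+1; set S := \sum_(_ < _) _ => S2.
  nra.
have -> : \int[arclength R]_u (n%:R / 4 ^+ M * F u) = n%:R / 4 ^+ M * NF.
  by rewrite RintegralZl.
rewrite [leRHS]mulrAC ler_wpM2r// ler_pdivlMr// mulrAC ler_pdivrMr ?exprn_gt0//.
have : n%:R <= 2 ^+ M.+1 * p0%:R :> R by rewrite -natrX -natrM ler_nat ltnW.
have -> : 4 ^+ M = 2 ^+ M * 2 ^+ M :> R by rewrite -exprMn; congr (_ ^+ _); lra.
rewrite exprS => h.
have t0 : 0 < 2 ^+ M :> R by rewrite exprn_gt0.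
have := @ler_pM _ n%:R (2 * 2 ^+ M * p0%:R) n%:R (2 * 2 ^+ M * p0%:R) (ltW n0) (ltW n0) h h.
by move/le_trans; apply; rewrite le_eqVlt; apply/orP; left; apply/eqP; ring.
Qed.

Lemma Re_divR (z : R[i]) (x : R) : complex.Re (z / x%:C) = complex.Re z / x.
Proof. by rewrite -fmorphV mulrC; case: z => a b; rewrite /= mul0r subr0 mulrC. Qed.

Lemma Im_divR (z : R[i]) (x : R) : complex.Im (z / x%:C) = complex.Im z / x.
Proof. by rewrite -fmorphV mulrC; case: z => a b; rewrite /= mul0r addr0 mulrC. Qed.

Lemma cintegrable_divR w (x : R) : cintegrable (arclength R) w ->
  cintegrable (arclength R) (fun u => w u / x%:C).
Proof.
move=> [w1 w2]; split.
  have := integrableZl measurableT x^-1 w1.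
  by apply: eq_integrable => // u _; rewrite /= Re_divR mulrC EFinM.
have := integrableZl measurableT x^-1 w2.
by apply: eq_integrable => // u _; rewrite /= Im_divR mulrC EFinM.
Qed.

(** The arclength integral of h g, expanded so that only real integrals of a bounded factor against
    an integrable one occur. *)
Definition density_integral (g h : T -> R[i]) : R[i] :=
  (\int[arclength R]_u (complex.Re (h u) * complex.Re (g u)) -
   \int[arclength R]_u (complex.Im (h u) * complex.Im (g u))) +i*
  (\int[arclength R]_u (complex.Im (h u) * complex.Re (g u)) +
   \int[arclength R]_u (complex.Re (h u) * complex.Im (g u))).

Lemma cm_integral_decomposition mu w sigma h : lebesgue_decomposition mu w sigma ->
  cbounded h ->
  cm_integral mu h =
    density_integral (fun u => w u / (2 * pi)%:C) h + cm_integral sigma h.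
Proof.
move=> [iw _ muE] [h1 h2].
have [f1 f2] := cintegrable_divR (2 * pi) iw.
have EA A : measurable A ->
    fine (cm_Re mu A) = \int[arclength R]_(u in A) complex.Re (w u / (2 * pi)%:C)
      + fine (cm_Re sigma A) /\
    fine (cm_Im mu A) = \int[arclength R]_(u in A) complex.Im (w u / (2 * pi)%:C)
      + fine (cm_Im sigma A).
  by move=> /muE; rewrite /cintegral /cm_val; simpc => -[-> ->].
have dRe := charge_integral_density f1 (fun A mA => (EA A mA).1).
have dIm := charge_integral_density f2 (fun A mA => (EA A mA).2).
rewrite /cm_integral !dRe// !dIm// /density_integral; simpc.
by congr (_ +i* _); ring.
Qed.

(** Outside the support there is an open U around s all of whose measurable subsets are null for
    [sigma]. A ball around s lies in U, so only the values of h off that ball matter. *)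
Lemma cm_integral_off_support sigma s : ~ cm_support sigma s ->
  exists2 r : R, 0 < r & exists2 K : R, 0 <= K & forall (M : R) h, 0 <= M -> cbounded h ->
    (forall u, r <= normc (cval u - cval s) -> normc (h u) <= M) ->
    normc (cm_integral sigma h) <= K * M.
Proof.
move=> /existsNP[U /not_implyP[oU /not_implyP[Us noA]]].
have [r r0 rU] := circle_ball_sub_open oU Us.
have mU := open_measurable_circle oU.
have s0 A : measurable A -> A `<=` U -> fine (cm_Re sigma A) = 0 /\ fine (cm_Im sigma A) = 0.
  move=> mA AU; have [[]//|s0] := pselect (cm_val sigma A = 0).
  by exfalso; apply: noA; exists A.
have sRe A : measurable A -> A `<=` U -> cm_Re sigma A = 0%E.
  by move=> mA /(s0 _ mA)[+ _] => /eqP; rewrite fine_eq0 ?fin_num_measure// => /eqP.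
have sIm A : measurable A -> A `<=` U -> cm_Im sigma A = 0%E.
  by move=> mA /(s0 _ mA)[_ +] => /eqP; rewrite fine_eq0 ?fin_num_measure// => /eqP.
have [K1 K10 H1] := charge_integral_null_on mU sRe.
have [K2 K20 H2] := charge_integral_null_on mU sIm.
exists r => //; exists (2 * (K1 + K2)); first by rewrite mulr_ge0// addr_ge0.
move=> M h M0 [h1 h2] hM.
have offU u : ~ U u -> normc (h u) <= M.
  by move=> nU; apply: hM; rewrite leNgt; apply/negP => ur; apply/nU/rU.
have a1 : `|charge_integral (cm_Re sigma) (fun u => complex.Re (h u))| <= K1 * M.
  by apply: H1 => // u /offU; apply: le_trans; exact: normc_Re.
have a2 : `|charge_integral (cm_Re sigma) (fun u => complex.Im (h u))| <= K1 * M.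
  by apply: H1 => // u /offU; apply: le_trans; exact: normc_Im.
have a3 : `|charge_integral (cm_Im sigma) (fun u => complex.Re (h u))| <= K2 * M.
  by apply: H2 => // u /offU; apply: le_trans; exact: normc_Re.
have a4 : `|charge_integral (cm_Im sigma) (fun u => complex.Im (h u))| <= K2 * M.
  by apply: H2 => // u /offU; apply: le_trans; exact: normc_Im.
rewrite (le_trans (normc_ReIm _))//= (le_trans (lerD (ler_normB _ _) (ler_normD _ _)))//.
by rewrite (le_trans (lerD (lerD a1 a4) (lerD a2 a3)))//; lra.
Qed.

(* Near [s] the measure mu acts on kernels of size min(n, 1 / (n |u - s|^2)) as
   w s / (2 pi) times arclength. *)
Lemma local_integral mu sigma w s : lebesgue_decomposition mu w sigma ->
  E_set w sigma s -> forall eta : R, 0 < eta ->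
  exists n0 : nat, forall n, (n0 <= n)%N -> forall h, cbounded h ->
    (forall u, normc (h u) <= n%:R) ->
    (forall u, normc (h u) * normc (cval u - cval s) ^+ 2 <= n%:R^-1) ->
    normc (cm_integral mu h - w s / (2 * pi)%:C * arc_integral h) <= eta.
Proof.
move=> dec [nsupp lpt] eta eta0.
have [iw _ _] := dec.
set f := (fun t => w t / (2 * pi)%:C) in lpt *.
have cif := cintegrable_divR (2 * pi) iw; rewrite -/f in cif.
(* Four real integrals, each at most 1024 eta1 + K / n, add up to eta / 2 + 4 K / n. *)
pose eta1 := eta / 8192.
have eta10 : 0 < eta1 by apply: divr_gt0 eta0 _; rewrite ltr0n.
have [r0 r00 ballF] := lebesgue_pt_ball cif lpt eta10.
have bcst (c : R) : (arclength R).-integrable setT (EFin \o (fun=> c)).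
  apply: bounded_measurable_integrable => //; first exact: arclength_lty.
  exact: bounded_measurable_cst.
have [if1 if2] := cif.
pose a u := complex.Re (f u - f s).
pose b u := complex.Im (f u - f s).
have aE : a = fun u => complex.Re (f u) - complex.Re (f s) by apply/funext => u; rewrite /a raddfB.
have bE : b = fun u => complex.Im (f u) - complex.Im (f s) by apply/funext => u; rewrite /b raddfB.
have ia : (arclength R).-integrable setT (EFin \o a).
  rewrite aE; have := integrableB measurableT if1 (bcst (complex.Re (f s))).
  by apply: eq_integrable => // u _; rewrite /= EFinB.
have ib : (arclength R).-integrable setT (EFin \o b).
  rewrite bE; have := integrableB measurableT if2 (bcst (complex.Im (f s))).
  by apply: eq_integrable => // u _; rewrite /= EFinB.
have ma : measurable_fun setT a by apply/measurable_EFinP; have /integrableP[] := ia.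
have mb : measurable_fun setT b by apply/measurable_EFinP; have /integrableP[] := ib.
pose F u : R := normc (f u - f s).
have mF : measurable_fun setT F by exact: measurable_normc.
have iF : (arclength R).-integrable setT (EFin \o F).
  have := integrableD measurableT (integrable_norm ia) (integrable_norm ib).
  apply: le_integrable => //; first exact/measurable_EFinP.
  move=> u _; rewrite lee_fin ger0_norm ?normc_ge0//.
  rewrite (ger0_norm (addr_ge0 (normr_ge0 (a u)) (normr_ge0 (b u)))).
  exact: normc_ReIm.
have [K K0 [n1 Hn1]] := integrable_localized r00 eta10 iF (fun u => normc_ge0 _) ballF.
have [r1 r10 [K1 K10 Hsig]] := cm_integral_off_support nsupp.
(* Collects the errors of order 1/n: the tails of the four integrals, and the singular part, on
   which |h| <= 1 / (n r1^2). *)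
pose C := 4 * K + K1 / r1 ^+ 2.
have C0 : 0 <= C.
  by apply: addr_ge0; [exact: mulr_ge0|apply: divr_ge0 => //; apply: exprn_ge0; exact: ltW].
exists (maxn n1.+1 (Num.trunc (2 * C / eta)).+1) => n.
rewrite geq_max => /andP[n1n Cn] h bh hn hd.
have n0 : 0 < n%:R :> R by rewrite ltr0n (leq_trans _ n1n).
have Cn2 : C / n%:R <= eta / 2.
  have C20 : 0 <= 2 * C / eta by rewrite divr_ge0 ?mulr_ge0// ltW.
  have /andP[_ /ltW C2] := Num.Theory.truncn_itv C20.
  have := le_trans C2 (_ : _ <= n%:R) => /(_ ltac:(by rewrite ler_nat)).
  rewrite ler_pdivrMr// => h2; rewrite ler_pdivrMr//.
  by clear -h2; lra.
have [h1 h2] := bh.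
have xb (x y : T -> R) : bounded_measurable x -> measurable_fun setT y ->
    (forall u, `|x u| <= normc (h u)) -> (forall u, `|y u| <= F u) ->
    `|\int[arclength R]_u (x u * y u)| <= 1024 * eta1 + K / n%:R.
  move=> bx my xh yF; apply: Hn1 => //; first exact: ltnW.
  - by move=> u; rewrite (le_trans (xh u)).
  - by move=> u; rewrite (le_trans _ (hd u))// ler_wpM2r ?exprn_ge0 ?normc_ge0.
have dE : density_integral f h = density_integral (fun u => f u - f s) h + f s * arc_integral h.
  have sub (x y z : T -> R) (c : R) : bounded_measurable x ->
      (arclength R).-integrable setT (EFin \o z) -> y = (fun u => z u + c) ->
      \int[arclength R]_u (x u * y u) =
      \int[arclength R]_u (x u * z u) + c * \int[arclength R]_u x u.
    move=> bx iz ->.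
    have [mx [N xN]] := bx.
    have ixz : (arclength R).-integrable setT (EFin \o (fun u => x u * z u)).
      have := integrableMr measurableT mx (bounded_funP setT xN) iz.
      by apply: eq_integrable => // u _; rewrite /= EFinM.
    have ix1 : (arclength R).-integrable setT (EFin \o x).
      by apply: bounded_measurable_integrable => //; exact: arclength_lty.
    have ic1 : (arclength R).-integrable setT (EFin \o (fun u => c * x u)).
      have := integrableZl measurableT c ix1.
      by apply: eq_integrable => // u _; rewrite /= EFinM.
    rewrite -RintegralZl// -RintegralD//.
    by apply: eq_Rintegral => u _; rewrite mulrDr [x u * c]mulrC.
  have fa : (fun u => complex.Re (f u)) = fun u => a u + complex.Re (f s).
    by apply/funext => u; rewrite aE subrK.
  have fb : (fun u => complex.Im (f u)) = fun u => b u + complex.Im (f s).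
    by apply/funext => u; rewrite bE subrK.
  rewrite /density_integral (sub _ _ _ _ h1 ia fa) (sub _ _ _ _ h2 ia fa).
  rewrite (sub _ _ _ _ h1 ib fb) (sub _ _ _ _ h2 ib fb).
  have mulE (x : R[i]) (c d : R) : x * (c +i* d) =
      (complex.Re x * c - complex.Im x * d) +i* (complex.Re x * d + complex.Im x * c).
    by case: x.
  rewrite /arc_integral /cintegral mulE /a /b; simpc.
  by congr (_ +i* _); ring.
rewrite (cm_integral_decomposition dec bh) -/f dE.
rewrite [X in normc X](_ : _ =
    density_integral (fun u => f u - f s) h + cm_integral sigma h); last first.
  by rewrite /f; ring.
rewrite (le_trans (normcD_le _ _))//.
have sig : normc (cm_integral sigma h) <= K1 * (n%:R * r1 ^+ 2)^-1.
  apply: Hsig => //; first by rewrite invr_ge0 mulr_ge0 ?exprn_ge0// ltW.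
  move=> u ur; rewrite invfM ler_pdivlMr ?exprn_gt0//.
  by rewrite (le_trans _ (hd u))// ler_wpM2l ?normc_ge0// lerXn2r// nnegrE ?normc_ge0 ?ltW.
have den : normc (density_integral (fun u => f u - f s) h) <= 4 * (1024 * eta1 + K / n%:R).
  have Reh u : `|complex.Re (h u)| <= normc (h u) by exact: normc_Re.
  have Imh u : `|complex.Im (h u)| <= normc (h u) by exact: normc_Im.
  have aF u : `|a u| <= F u by exact: normc_Re.
  have bF u : `|b u| <= F u by exact: normc_Im.
  rewrite (le_trans (normc_ReIm _))//= (le_trans (lerD (ler_normB _ _) (ler_normD _ _)))//.
  rewrite (le_trans (lerD (lerD (xb _ _ h1 ma Reh aF) (xb _ _ h2 mb Imh bF))
    (lerD (xb _ _ h2 ma Imh aF) (xb _ _ h1 mb Reh bF))))//.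
  by clear; lra.
rewrite (le_trans (lerD den sig))//.
have -> : 4 * (1024 * eta1 + K / n%:R) + K1 * (n%:R * r1 ^+ 2)^-1 = eta / 2 + C / n%:R.
  by rewrite /C /eta1; field; rewrite !gt_eqF.
by clear -Cn2; lra.
Qed.

End localization.

(** * Orthogonal polynomials *)

Section reversed_polynomials.
Variable R : realType.
Implicit Types (p q : {poly R[i]}) (z : R[i]).

(** For deg p <= n this is z^n times the star of p, turned into a polynomial and hence defined at 0
    too. *)
Definition revpoly n p : {poly R[i]} := \poly_(i < n.+1) conjc p`_(n - i).

Lemma size_revpoly n p : (size (revpoly n p) <= n.+1)%N.
Proof. exact: size_poly. Qed.

Lemma coef_revpoly n p i : (i <= n)%N -> (revpoly n p)`_i = conjc p`_(n - i).
Proof. by move=> ni; rewrite coef_poly ltnS ni. Qed.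

Lemma revpolyK n p : (size p <= n.+1)%N -> revpoly n (revpoly n p) = p.
Proof.
move=> pn; apply/polyP => i; rewrite coef_poly; case: ltnP => ni.
  by rewrite coef_revpoly ?leq_subr// subKn// conjc_conjc.
by rewrite nth_default// (leq_trans pn).
Qed.

Lemma revpolyZ n c p : revpoly n (c *: p) = conjc c *: revpoly n p.
Proof.
apply/polyP => i; rewrite coefZ !coef_poly; case: ifP; rewrite ?mulr0//.
by rewrite coefZ conjcM.
Qed.

Lemma horner_revpoly n p z : (size p <= n.+1)%N -> z != 0 ->
  (revpoly n p).[z] = z ^+ n * star (horner p) z.
Proof.
move=> pn z0; rewrite /star horner_poly (horner_coef_wide _ pn) rmorph_sum big_distrr/=.
rewrite (reindex_inj rev_ord_inj)/=; apply: eq_bigr => i _.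
rewrite subSS subKn; last by rewrite -ltnS.
rewrite conjcM conjcX fmorphV/= conjc_conjc mulrCA; congr (_ * _).
apply: (mulIf (expf_neq0 i z0)); rewrite -exprD subnK -1?ltnS//.
by rewrite exprVn mulfVK// expf_neq0.
Qed.

Lemma star_circle p (u : circle R) : star (horner p) (cval u) = conjc p.[cval u].
Proof.
rewrite /star; congr (conjc p.[_]).
by rewrite -[X in X^-1]/(conjc (cval u)) (conjc_inv (normc_cval u)) invrK.
Qed.

Lemma horner_revpoly_circle n p (u : circle R) : (size p <= n.+1)%N ->
  (revpoly n p).[cval u] = cval u ^+ n * conjc p.[cval u].
Proof.
move=> pn; rewrite horner_revpoly// ?star_circle//.
by rewrite -normc_gt0 normc_cval.
Qed.

End reversed_polynomials.

Section toeplitz_forms.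
Variable R : realType.
Implicit Types (p q r P Q : {poly R[i]}) (B : {poly R[i]} -> {poly R[i]} -> R[i]).

(** The properties of [pairing mu] that the recurrences rest on: sesquilinearity, invariance under
    multiplication by z, and compatibility with reversal. Isolating them allows the roles of left
    and right to be exchanged. *)
Record toeplitz_form B := ToeplitzForm {
  formDl : forall p q r, B (p + q) r = B p r + B q r ;
  formZl : forall c p q, B (c *: p) q = c * B p q ;
  formDr : forall p q r, B p (q + r) = B p q + B p r ;
  formZr : forall c p q, B p (c *: q) = conjc c * B p q ;
  formXX : forall p q, B ('X * p) ('X * q) = B p q ;
  form_rev : forall n p q, (size p <= n.+1)%N -> (size q <= n.+1)%N ->
    B p (revpoly n q) = B q (revpoly n p) }.

(** Right orthogonality for B is left orthogonality for this form, so the recurrence of the right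
    polynomials is an instance of that of the left ones. *)
Definition swap_form B p q := conjc (B q p).

Lemma swap_toeplitz B : toeplitz_form B -> toeplitz_form (swap_form B).
Proof.
move=> tB; split; rewrite /swap_form.
- by move=> p q r; rewrite (formDr tB) rmorphD.
- by move=> c p q; rewrite (formZr tB) conjcM conjc_conjc.
- by move=> p q r; rewrite (formDl tB) rmorphD.
- by move=> c p q; rewrite (formZl tB) conjcM.
- by move=> p q; rewrite (formXX tB).
- move=> n p q pn qn; rewrite -{1}(revpolyK pn) (form_rev tB) ?size_revpoly//.
  by rewrite revpolyK.
Qed.

Section one_form.
Variable B : {poly R[i]} -> {poly R[i]} -> R[i].
Hypothesis tB : toeplitz_form B.

Lemma form0l p : B 0 p = 0.
Proof. by rewrite -(scale0r (0 : {poly R[i]})) (formZl tB) mul0r. Qed.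

Lemma form0r p : B p 0 = 0.
Proof. by rewrite -(scale0r (0 : {poly R[i]})) (formZr tB) rmorph0 mul0r. Qed.

Lemma formBl p q r : B (p - q) r = B p r - B q r.
Proof. by rewrite (formDl tB) -scaleN1r (formZl tB) mulN1r. Qed.

Lemma formBr p q r : B p (q - r) = B p q - B p r.
Proof. by rewrite (formDr tB) -scaleN1r (formZr tB) rmorphN rmorph1 mulN1r. Qed.

Lemma form_revrev n p q : (size p <= n.+1)%N -> (size q <= n.+1)%N ->
  B (revpoly n q) (revpoly n p) = B p q.
Proof.
by move=> pn qn; rewrite (form_rev tB)// ?size_revpoly// revpolyK.
Qed.

Definition left_monic n P := [/\ P \is monic, size P = n.+1 &
  forall p, (size p <= n)%N -> B P p = 0].

Definition right_monic n P := [/\ P \is monic, size P = n.+1 &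
  forall p, (size p <= n)%N -> B p P = 0].

(** Otherwise Q + E would be a second right orthogonal monic polynomial. Uniqueness thus plays the
    part of nondegeneracy of the form. *)
Lemma right_monic_unique0 n Q (E : {poly R[i]}) : right_monic n Q ->
  (forall P, right_monic n P -> P = Q) -> (size E <= n)%N ->
  (forall p, (size p <= n)%N -> B p E = 0) -> E = 0.
Proof.
move=> [mQ sQ oQ] uQ sE oE; apply: (@addrI _ Q); rewrite addr0; apply: uQ.
split.
- by rewrite monicE lead_coefDl ?sQ ?ltnS// -monicE.
- by rewrite size_polyDl sQ.
- by move=> p pn; rewrite (formDr tB) oQ// oE// addr0.
Qed.

(** The difference P1 - z P has degree at most n and is left orthogonal to z p for deg p < n.
    Reversal turns this into right orthogonality to all polynomials of degree less than n, which
    forces a multiple of Q. *)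
Lemma szego_recurrence n P P1 Q : left_monic n P -> left_monic n.+1 P1 ->
  right_monic n Q -> (forall P, right_monic n P -> P = Q) ->
  exists c, P1 = 'X * P + conjc c *: revpoly n Q.
Proof.
move=> [mP sP oP] [mP1 sP1 oP1] rQ uQ; have [mQ sQ oQ] := rQ.
pose D := P1 - 'X * P.
have P0 : P != 0 by rewrite -size_poly_gt0 sP.
have sXP : size ('X * P) = n.+2 by rewrite mulrC size_mulX// sP.
have sD : (size D <= n.+1)%N.
  apply/leq_sizeP => i ni; rewrite coefB; move: ni; rewrite leq_eqVlt => /predU1P[<-|ni].
    have /monicP := mP1; have /monicP : 'X * P \is monic by rewrite monicMl// monicX.
    by rewrite /lead_coef sXP sP1 /= => -> ->; rewrite subrr.
  by rewrite !nth_default ?subr0// ?sXP ?sP1.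
have oD p : (size p <= n)%N -> B D ('X * p) = 0.
  move=> pn; rewrite formBl (formXX tB) oP// oP1 ?subr0//.
  have [->|p0] := eqVneq p 0; first by rewrite mulr0 size_poly0.
  by rewrite mulrC size_mulX.
pose E := revpoly n D.
(* As Q is monic, subtracting c Q brings the degree of E below n. *)
pose c := E`_n.
have E0 : E - c *: Q = 0.
  apply: (right_monic_unique0 rQ uQ).
    apply/leq_sizeP => i; rewrite coefB coefZ leq_eqVlt => /predU1P[<-|ni].
      by have /monicP := mQ; rewrite /lead_coef sQ /= => ->; rewrite mulr1 subrr.
    by rewrite !nth_default ?mulr0 ?subrr// ?sQ// (leq_trans (size_revpoly _ _)).
  move=> p pn; rewrite formBr (formZr tB) oQ// mulr0 subr0.
  rewrite (form_rev tB)//; last exact: leqW.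
  have -> : revpoly n p = 'X * (\poly_(i < n) conjc p`_(n.-1 - i)).
    apply/polyP => i; rewrite coefXM coef_poly; case: i => [|i] /=.
      by rewrite subn0 nth_default ?rmorph0.
    by rewrite coef_poly ltnS; case: ltnP => // ni; rewrite -subn1 -subnDA add1n.
  by apply: oD; exact: size_poly.
exists c; rewrite addrC; apply/eqP; rewrite -subr_eq -/D -revpolyZ; apply/eqP.
by move/eqP: E0; rewrite subr_eq0 => /eqP <-; rewrite revpolyK.
Qed.

(** Orthogonality of P1 and of Q1 to reversed polynomials removes the cross terms. The opposite
    signs of the two recurrences produce 1 + |c|^2, hence positivity of the norms for every c. *)
Lemma szego_norm_step n P P1 Q Q1 (c : R[i]) : left_monic n P -> left_monic n.+1 P1 ->
  right_monic n Q -> right_monic n.+1 Q1 ->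
  P1 = 'X * P + conjc c *: revpoly n Q -> Q1 = 'X * Q - conjc c *: revpoly n P ->
  B P1 Q1 = B P Q * (1 + (normc c ^+ 2)%:C).
Proof.
move=> [mP sP oP] [mP1 sP1 oP1] [mQ sQ oQ] [mQ1 sQ1 oQ1] eP1 eQ1.
have -> : B P1 Q1 = B P1 ('X * Q).
  by rewrite {1}eQ1 formBr (formZr tB) (oP1 _ (size_revpoly n P)) mulr0 subr0.
rewrite eP1 (formDl tB) (formXX tB) (formZl tB).
have -> : B (revpoly n Q) ('X * Q) = c * B P Q.
  have -> : 'X * Q = Q1 + conjc c *: revpoly n P by rewrite eQ1 subrK.
  rewrite (formDr tB) (oQ1 _ (size_revpoly n Q)) add0r (formZr tB) conjc_conjc.
  by rewrite form_revrev// ?sP ?sQ.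
by rewrite -mulcJ; ring.
Qed.

End one_form.
End toeplitz_forms.

(** * Recurrences, pointwise bounds and Christoffel-Darboux for a fixed measure *)

Section szego_class.
Variable R : realType.
Local Notation T := (circle R).
Implicit Types (p q : {poly R[i]}) (s u : T).

Section fixed_measure.
Variable mu : complex_measure T R.

Lemma pairingE p q :
  pairing mu p q = cm_integral mu (fun u => p.[cval u] * conjc q.[cval u]).
Proof.
by rewrite /pairing; congr cm_integral; apply/funext => u; rewrite star_circle.
Qed.

Lemma cbounded_pairing p q : cbounded (fun u : T => p.[cval u] * conjc q.[cval u]).
Proof.
by apply: cboundedM; [exact: cbounded_horner|exact/cbounded_conj/cbounded_horner].
Qed.

Lemma pairing_toeplitz : toeplitz_form (pairing mu).
Proof.
split.
- move=> p q r; rewrite !pairingE -cm_integralD; [|exact: cbounded_pairing..].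
  by congr cm_integral; apply/funext => u; rewrite hornerD mulrDl.
- move=> c p q; rewrite !pairingE -cm_integralZ; last exact: cbounded_pairing.
  by congr cm_integral; apply/funext => u; rewrite hornerZ mulrA.
- move=> p q r; rewrite !pairingE -cm_integralD; [|exact: cbounded_pairing..].
  by congr cm_integral; apply/funext => u; rewrite hornerD rmorphD mulrDr.
- move=> c p q; rewrite !pairingE -cm_integralZ; last exact: cbounded_pairing.
  by congr cm_integral; apply/funext => u; rewrite hornerZ conjcM mulrCA.
- move=> p q; rewrite !pairingE; congr cm_integral; apply/funext => u.
  rewrite !hornerM !hornerX conjcM mulrACA mulcJ normc_cval expr1n mul1r//.
- move=> n p q pn qn; rewrite !pairingE; congr cm_integral; apply/funext => u.
  by rewrite !horner_revpoly_circle// !conjcM !conjc_conjc; ring.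
Qed.

(** The recurrences defining [vF] and [vFt] are given only at z != 0; the points 1, ..., size p are
    enough roots. *)
Lemma horner_eq0 p : (forall z, z != 0 -> p.[z] = 0) -> p = 0.
Proof.
move=> p0; pose rs : seq R[i] := [seq i.+1%:R | i <- iota 0 (size p)].
apply: (@roots_geq_poly_eq0 _ p rs).
- by apply/allP => _ /mapP[i _ ->]; rewrite rootE p0// pnatr_eq0.
- rewrite map_inj_uniq ?iota_uniq// => i j /eqP.
  by rewrite eqr_nat eqSS => /eqP.
- by rewrite size_map size_iota.
Qed.

Hypothesis muT : class_Tminus mu.

Lemma Phi_left_monic n : left_monic (pairing mu) n (Phi mu n).
Proof.
have [[_ /(_ n)[[P [PP _]] _]] _] := muT.
have /= := xgetPex 0 (ex_intro (monic_left mu n) P PP); rewrite -/(Phi mu n) => -[m sz o].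
by split => // p pn; apply: o; rewrite sz ltnS.
Qed.

Lemma Phit_right_monic n : right_monic (pairing mu) n (Phit mu n).
Proof.
have [[_ /(_ n)[_ [P [PP _]]]] _] := muT.
have /= := xgetPex 0 (ex_intro (monic_right mu n) P PP); rewrite -/(Phit mu n) => -[m sz o].
by split => // p pn; apply: o; rewrite sz ltnS.
Qed.

Lemma Phit_unique n Q : right_monic (pairing mu) n Q -> Q = Phit mu n.
Proof.
have H P : right_monic (pairing mu) n P -> monic_right mu n P.
  by move=> [m sz o]; split => // p; rewrite sz ltnS; exact: o.
have [[_ /(_ n)[_ [P0 [PP uP]]]] _] := muT.
by move=> /H /uP <-; apply/uP/H/Phit_right_monic.
Qed.

Lemma Phi_unique n Q : left_monic (pairing mu) n Q -> Q = Phi mu n.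
Proof.
have H P : left_monic (pairing mu) n P -> monic_left mu n P.
  by move=> [m sz o]; split => // p; rewrite sz ltnS; exact: o.
have [[_ /(_ n)[[P0 [PP uP]] _]] _] := muT.
by move=> /H /uP <-; apply/uP/H/Phi_left_monic.
Qed.

Lemma size_Phi n : size (Phi mu n) = n.+1. Proof. by have [] := Phi_left_monic n. Qed.

Lemma size_Phit n : size (Phit mu n) = n.+1. Proof. by have [] := Phit_right_monic n. Qed.

Lemma recurrence_coefficient n p q r c :
  size p = n.+1 -> size q = n.+1 ->
  (forall z, z != 0 -> r.[z] - z * p.[z] = conjc c * z ^+ n * star (horner q) z) ->
  r = 'X * p + conjc c *: revpoly n q.
Proof.
move=> sp sq H; apply/eqP; rewrite -subr_eq0; apply/eqP; apply: horner_eq0 => z z0.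
rewrite !hornerE horner_revpoly ?sq// opprD addrA H// mulrA subrr//.
Qed.

Lemma Phi_recurrence n :
  Phi mu n.+1 = 'X * Phi mu n + conjc (vF mu n) *: revpoly n (Phit mu n).
Proof.
have [c Hc] := szego_recurrence pairing_toeplitz (Phi_left_monic n) (Phi_left_monic n.+1)
  (Phit_right_monic n) (@Phit_unique n).
apply: (recurrence_coefficient (size_Phi n) (size_Phit n)).
apply: (@xgetPex _ 0 [set c | forall z, z != 0 -> (Phi mu n.+1).[z] - z * (Phi mu n).[z]
    = c^* * z ^+ n * star (horner (Phit mu n)) z]).
exists c => z z0; rewrite Hc !hornerE horner_revpoly ?size_Phit//.
by rewrite addrAC subrr add0r mulrA.
Qed.

Lemma Phit_recurrence n :
  Phit mu n.+1 = 'X * Phit mu n - conjc (vF mu n) *: revpoly n (Phi mu n).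
Proof.
have swl k P : right_monic (pairing mu) k P -> left_monic (swap_form (pairing mu)) k P.
  by move=> [m sz o]; split => // p pk; rewrite /swap_form o// rmorph0.
have swr k P : left_monic (pairing mu) k P -> right_monic (swap_form (pairing mu)) k P.
  by move=> [m sz o]; split => // p pk; rewrite /swap_form o// rmorph0.
have uswr P : right_monic (swap_form (pairing mu)) n P -> P = Phi mu n.
  move=> [m sz o]; apply: Phi_unique; split => // p pk.
  by rewrite -[LHS]conjc_conjc -/(swap_form (pairing mu) p P) o// rmorph0.
have [c Hc] := szego_recurrence (swap_toeplitz pairing_toeplitz)
  (swl _ _ (Phit_right_monic n)) (swl _ _ (Phit_right_monic n.+1))
  (swr _ _ (Phi_left_monic n)) uswr.
have -> : - (conjc (vF mu n) *: revpoly n (Phi mu n)) = conjc (vFt mu n) *: revpoly n (Phi mu n).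
  by have [_ ->] := muT; rewrite rmorphN scaleNr opprK.
apply: (recurrence_coefficient (size_Phit n) (size_Phi n)).
apply: (@xgetPex _ 0 [set c | forall z, z != 0 -> (Phit mu n.+1).[z] - z * (Phit mu n).[z]
    = c^* * z ^+ n * star (horner (Phi mu n)) z]).
exists c => z z0; rewrite Hc !hornerE horner_revpoly ?size_Phi//.
by rewrite addrAC subrr add0r mulrA.
Qed.

Definition szego_norm n : R := \prod_(j < n) (1 + normc (vF mu j) ^+ 2).

Lemma szego_norm_gt0 n : 0 < szego_norm n.
Proof. by apply: prodr_gt0 => j _; rewrite ltr_pwDl// exprn_ge0// normc_ge0. Qed.

Lemma monic_size1 p : p \is monic -> size p = 1%N -> p = 1.
Proof.
move=> /monicP m s1; have /size_poly1P[c c0 pc] : size p == 1%N by rewrite s1.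
by move: m; rewrite pc lead_coefC => ->.
Qed.

Lemma Phi0 : Phi mu 0 = 1.
Proof. by have [m sz _] := Phi_left_monic 0; exact: monic_size1. Qed.

Lemma Phit0 : Phit mu 0 = 1.
Proof. by have [m sz _] := Phit_right_monic 0; exact: monic_size1. Qed.

Lemma pairing11 : pairing mu 1 1 = 1.
Proof.
have [[mu1 _] _] := muT.
rewrite -mu1 pairingE /cm_val /cm_integral.
have -> : (fun u : T => complex.Re
    ((1 : {poly R[i]}).[cval u] * conjc (1 : {poly R[i]}).[cval u])) = \1_setT.
  by apply/funext => u; rewrite hornerC indicT /= mulr1 oppr0 mulr0 subr0.
have -> : (fun u : T => complex.Im
    ((1 : {poly R[i]}).[cval u] * conjc (1 : {poly R[i]}).[cval u])) = \1_set0.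
  by apply/funext => u; rewrite hornerC indic0 /= mulr1 oppr0 mulr0 addr0.
by rewrite !charge_integral_indic// !charge0/= subr0 add0r.
Qed.

Lemma pairing_Phi_Phit n : pairing mu (Phi mu n) (Phit mu n) = (szego_norm n)%:C.
Proof.
elim: n => [|n IH]; first by rewrite Phi0 Phit0 pairing11 /szego_norm big_ord0.
rewrite (szego_norm_step pairing_toeplitz (Phi_left_monic n) (Phi_left_monic n.+1)
  (Phit_right_monic n) (Phit_right_monic n.+1) (Phi_recurrence n) (Phit_recurrence n)).
by rewrite IH /szego_norm big_ord_recr/= [in RHS]rmorphM rmorphD.
Qed.

Lemma phiE n : phi mu n = ((Num.sqrt (szego_norm n))^-1)%:C *: Phi mu n.
Proof.
rewrite /phi pairing_Phi_Phit; congr (_ *: _); rewrite fmorphV; congr (_^-1).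
rewrite -{1}(sqr_sqrtr (ltW (szego_norm_gt0 n))) rmorphXn sqrCK//.
have := sqrtr_ge0 (szego_norm n); rewrite -lecR; exact.
Qed.

Lemma Phi_circle_rec n u : (Phi mu n.+1).[cval u] = cval u * (Phi mu n).[cval u]
  + conjc (vF mu n) * (cval u ^+ n * conjc (Phit mu n).[cval u]).
Proof.
by rewrite Phi_recurrence hornerD hornerM hornerX hornerZ horner_revpoly_circle ?size_Phit.
Qed.

Lemma Phit_circle_rec n u : (Phit mu n.+1).[cval u] = cval u * (Phit mu n).[cval u]
  - conjc (vF mu n) * (cval u ^+ n * conjc (Phi mu n).[cval u]).
Proof.
by rewrite Phit_recurrence hornerD hornerN hornerM hornerX hornerZ horner_revpoly_circle ?size_Phi.
Qed.

(** The cross terms Re (x a F conj(y) b) occur with opposite signs and cancel: one step of the two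
    recurrences multiplies the Euclidean norm of (a, b) by sqrt (1 + |F|^2). *)
Lemma unitary_step (x y a b F : R[i]) : normc x = 1 -> normc y = 1 ->
  normc (x * a + conjc F * (y * conjc b)) ^+ 2 +
  normc (x * b - conjc F * (y * conjc a)) ^+ 2 =
  (normc a ^+ 2 + normc b ^+ 2) * (1 + normc F ^+ 2).
Proof.
move=> x1 y1.
have -> : (normc a ^+ 2 + normc b ^+ 2) * (1 + normc F ^+ 2) =
    normc x ^+ 2 * (normc a ^+ 2 + normc b ^+ 2) +
    normc F ^+ 2 * normc y ^+ 2 * (normc a ^+ 2 + normc b ^+ 2).
  by rewrite x1 y1 expr1n; ring.
rewrite !normc_sqr; case: x y a b F {x1 y1} => [x1 x2] [y1 y2] [a1 a2] [b1 b2] [F1 F2] /=.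
by ring.
Qed.

Lemma Phi_Phit_circle n u :
  normc (Phi mu n).[cval u] ^+ 2 + normc (Phit mu n).[cval u] ^+ 2 = 2 * szego_norm n.
Proof.
elim: n => [|n IH].
  by rewrite Phi0 Phit0 !hornerC /szego_norm big_ord0 normc1 !expr1n mulr1.
rewrite (Phi_circle_rec n u) (Phit_circle_rec n u) unitary_step; last 2 first.
- exact: normc_cval.
- by rewrite normcX normc_cval expr1n.
by rewrite IH /szego_norm big_ord_recr/= mulrA.
Qed.

Lemma normc_Phi_sqr_le n u : normc (Phi mu n).[cval u] ^+ 2 <= 2 * szego_norm n.
Proof. by rewrite -(Phi_Phit_circle n u) lerDl exprn_ge0 ?normc_ge0. Qed.

Lemma normc_Phit_sqr_le n u : normc (Phit mu n).[cval u] ^+ 2 <= 2 * szego_norm n.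
Proof. by rewrite -(Phi_Phit_circle n u) lerDr exprn_ge0 ?normc_ge0. Qed.

Lemma normc_phi n u :
  normc (phi mu n).[cval u] = normc (Phi mu n).[cval u] / Num.sqrt (szego_norm n).
Proof.
by rewrite phiE hornerZ normcM normcR ger0_norm ?invr_ge0 ?sqrtr_ge0// mulrC.
Qed.

Lemma normc_phi_le2 n u : normc (phi mu n).[cval u] ^+ 2 <= 2.
Proof.
rewrite normc_phi expr_div_n (sqr_sqrtr (ltW (szego_norm_gt0 n))).
by rewrite ler_pdivrMr ?szego_norm_gt0// normc_Phi_sqr_le.
Qed.

(** The Christoffel-Darboux kernel of the biorthogonal families, conjugated in z because it is
    placed in the second, conjugate-linear slot of the pairing. *)
Definition kernel n (z : R[i]) : {poly R[i]} :=
  \sum_(j < n) (conjc (Phi mu j).[z] / (szego_norm j)%:C) *: Phit mu j.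

(** Induction: subtracting its top coefficient times Phi_n lowers the degree of p. The new kernel
    term is orthogonal to the remainder, and Phi_n is orthogonal to the earlier terms. *)
Lemma kernel_reproducing n z p : (size p <= n)%N -> pairing mu p (kernel n z) = p.[z].
Proof.
have tB := pairing_toeplitz.
have szN k : (szego_norm k)%:C != 0 :> R[i].
  by rewrite (inj_eq (@complexI _)) gt_eqF ?szego_norm_gt0.
elim: n p => [|n IH] p pn.
  have -> : p = 0 by apply/eqP; rewrite -size_poly_leq0.
  by rewrite (form0l tB) horner0.
pose r := p - p`_n *: Phi mu n.
have [/monicP mPhi sPhi oPhi] := Phi_left_monic n.
have [mPhit sPhit oPhit] := Phit_right_monic n.
have sr : (size r <= n)%N.
  apply/leq_sizeP => i; rewrite coefB coefZ leq_eqVlt => /predU1P[<-|ni].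
    by move: mPhi; rewrite /lead_coef sPhi /= => ->; rewrite mulr1 subrr.
  have pi : p`_i = 0 by rewrite nth_default// (leq_trans pn).
  have qi : (Phi mu n)`_i = 0 by rewrite nth_default// sPhi.
  by rewrite pi qi mulr0 subrr.
have -> : p = r + p`_n *: Phi mu n by rewrite subrK.
rewrite (formDl tB) hornerD /kernel big_ord_recr/= -/(kernel n z) !(formDr tB).
rewrite IH// (formZr tB) oPhit// mulr0 addr0; congr (_ + _).
rewrite (formZl tB) (oPhi (kernel n z)); last first.
  rewrite (leq_trans (size_sum _ _ _))//; apply/bigmax_leqP => j _.
  by rewrite (leq_trans (size_scale_leq _ _))// size_Phit.
rewrite mulr0 add0r (formZl tB) (formZr tB) pairing_Phi_Phit conjcM conjc_conjc.
rewrite hornerZ -fmorphV conjc_real fmorphV; congr (_ * _).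
exact: (mulfVK (szN n)) _.
Qed.

Lemma horner_kernel n z u : conjc (kernel n z).[cval u] =
  \sum_(j < n) (Phi mu j).[z] * conjc (Phit mu j).[cval u] / (szego_norm j)%:C.
Proof.
rewrite /kernel horner_sum rmorph_sum; apply: eq_bigr => j _ /=.
rewrite hornerZ !conjcM conjc_conjc -fmorphV conjc_real; ring.
Qed.

Lemma normc_kernel_le n s u : normc (kernel n (cval s)).[cval u] <= 2 * n%:R.
Proof.
rewrite -normc_conj horner_kernel (le_trans (normc_sum _ _ _))//.
apply: (@le_trans _ _ (\sum_(j < n) 2)); last first.
  by rewrite sumr_const card_ord -[2 *+ n]mulr_natr.
apply: ler_sum => j _; have h0 := szego_norm_gt0 j.
rewrite normcM normcV normcR (gtr0_norm h0) ler_pdivrMr// normcM normc_conj.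
have := normc_Phi_sqr_le j s; have := normc_Phit_sqr_le j u.
have := sqr_ge0 (normc (Phi mu j).[cval s] - normc (Phit mu j).[cval u]).
nra.
Qed.

(** Induction on n. Since conjugation is inversion on the circle, the step becomes a rational
    identity in s, u, their n-th powers, F and the values of [Phi], [Phit] with their conjugates. *)
Lemma christoffel_darboux n s u :
  (1 - cval s * conjc (cval u)) * conjc (kernel n (cval s)).[cval u] =
  (cval s ^+ n * conjc (cval u ^+ n) * conjc (Phit mu n).[cval s] * (Phi mu n).[cval u]
   - (Phi mu n).[cval s] * conjc (Phit mu n).[cval u]) / (szego_norm n)%:C.
Proof.
have szN k : (szego_norm k)%:C != 0 :> R[i].
  by rewrite (inj_eq (@complexI _)) gt_eqF ?szego_norm_gt0.
rewrite horner_kernel; elim: n => [|n IH].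
  rewrite big_ord0 mulr0 Phi0 Phit0 !hornerC /szego_norm big_ord0 !expr0.
  by rewrite -[conjc 1]/(1 -i* 0)%C oppr0 -[1 +i* 0]/(1 : R[i]) !mulr1 subrr mul0r.
rewrite big_ord_recr mulrDr IH (Phi_circle_rec n u) (Phi_circle_rec n s).
rewrite (Phit_circle_rec n u) (Phit_circle_rec n s).
have -> : (szego_norm n.+1)%:C = (szego_norm n)%:C * (1 + vF mu n * conjc (vF mu n)) :> R[i].
  by rewrite /szego_norm big_ord_recr/= [LHS]rmorphM rmorphD rmorph1 mulcJ.
have F0 : 1 + vF mu n * conjc (vF mu n) != 0.
  have := szN n.+1; rewrite /szego_norm big_ord_recr/= rmorphM rmorphD rmorph1 mulcJ.
  by rewrite mulf_eq0 negb_or => /andP[].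
have unit_inv (v : T) : conjc (cval v) = (cval v)^-1 /\ cval v != 0.
  by split; [rewrite conjc_inv ?normc_cval|rewrite -normc_gt0 normc_cval].
have unitX_inv (v : T) : conjc (cval v ^+ n) = (cval v ^+ n)^-1 /\ cval v ^+ n != 0.
  by have [vi v0] := unit_inv v; rewrite conjcX vi exprVn expf_neq0.
have [[si s0] [ui u0]] := (unit_inv s, unit_inv u).
have [[sni sn0] [uni un0]] := (unitX_inv s, unitX_inv u).
rewrite !exprS !rmorphB/= !conjcM !conjc_conjc sni uni si ui.
set h := (szego_norm n)%:C; set F := vF mu n in F0 *; set F' := conjc F in F0 *.
set sn := cval s ^+ n in sn0 *; set un := cval u ^+ n in un0 *.
by field; rewrite F0 s0 u0 sn0 un0 (szN n).
Qed.

End fixed_measure.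
End szego_class.

(** * The local model A z^n + B *)

Section local_model.
Variable R : realType.
Local Notation T := (circle R).
Implicit Types (p q : {poly R[i]}) (s u : T) (z : R[i]).

Lemma abel_step (g : nat -> R[i]) (y : R[i]) n :
  (1 - y) * (\sum_(j < n) g j * y ^+ j) =
  g 0%N - g n * y ^+ n + \sum_(j < n) (g j.+1 - g j) * y ^+ j.+1.
Proof.
elim: n => [|n IH]; first by rewrite !big_ord0 expr0 mulr0 mulr1 subrr addr0.
by rewrite !big_ord_recr/= mulrDr IH !exprS; ring.
Qed.

(* Two summations by parts turn coefficients with bounded second differences into
   the decay 1 / (n |y - 1|^2). *)
Lemma abel_twice (g : nat -> R[i]) (y : R[i]) n (a b : R) : normc y = 1 ->
  g 0%N = 0 -> g n = 0 ->
  (forall j, (j <= n)%N -> normc (g j.+1 - g j) <= a) ->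
  (forall j, (j < n)%N -> normc ((g j.+2 - g j.+1) - (g j.+1 - g j)) <= b) ->
  normc (y - 1) ^+ 2 * normc (\sum_(j < n) g j * y ^+ j) <= 2 * a + n%:R * b.
Proof.
move=> y1 g0 gn ga gb.
have yX j : normc (y ^+ j) = 1 by rewrite normcX y1 expr1n.
rewrite normcB_sym -normcX -normcM expr2 -mulrA abel_step g0 gn mul0r subr0 add0r.
pose D j := g j.+1 - g j.
have -> : \sum_(j < n) (g j.+1 - g j) * y ^+ j.+1 = y * \sum_(j < n) D j * y ^+ j.
  by rewrite big_distrr/=; apply: eq_bigr => j _; rewrite exprS /D; ring.
rewrite mulrCA normcM y1 mul1r abel_step.
rewrite (le_trans (normcD_le _ _))// lerD//.
  rewrite (le_trans (normcB_le _ _))// normcM yX mulr1 mulr_natl mulr2n.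
  by rewrite lerD// ga.
rewrite (le_trans (normc_sum _ _ _))//.
apply: (@le_trans _ _ (\sum_(j < n) b)).
  by apply: ler_sum => j _; rewrite normcM yX mulr1 gb.
by rewrite sumr_const card_ord -[b *+ n]mulr_natl.
Qed.

Lemma rotn_cis n : rotn R n = cis (pi / n%:R).
Proof. by []. Qed.

Lemma rotnX n : (0 < n)%N -> rotn R n ^+ n = -1.
Proof.
move=> n0; rewrite rotn_cis cisX mulrCA mulfV ?mulr1; last by rewrite pnatr_eq0 -lt0n.
by rewrite /cis cospi sinpi; apply/eqP; rewrite eq_complex/= oppr0 !eqxx.
Qed.

Lemma rotn_sub1_le n : normc (rotn R n - 1) <= 8 / n%:R.
Proof.
rewrite rotn_cis (le_trans (cis_sub1_le _))// normrM normfV !ger0_norm ?pi_ge0//.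
by rewrite mulrA ler_wpM2r ?invr_ge0//; have := pi_lt4 R; lra.
Qed.

Section interpolation_weights.
Variables (n : nat) (v : R[i]) (K : R).
Hypotheses (n0 : (0 < n)%N) (K0 : 0 <= K) (vK : normc (v - 1) <= K / n%:R).
Let E := expR K.
Let alpha := (1 + v ^+ n) / 2.
Let beta := (1 - v ^+ n) / 2.
Let gam := rotn R n.

(* With v = z / s, these are the coefficients of p(z) - A z^n - B for a
   polynomial p of degree at most n, see [local_modelE]; they vanish at j = 0 and
   j = n because A z^n + B agrees with 1 and with z^n. *)
Definition interp_weight j : R[i] := v ^+ j - (1 + v ^+ n) / 2 - (1 - v ^+ n) / 2 * rotn R n ^+ j.
Let g := interp_weight.

Lemma interp_weight0 : interp_weight 0 = 0.
Proof. by rewrite /interp_weight !expr0; field. Qed.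

Lemma interp_weightn : interp_weight n = 0.
Proof. by rewrite /interp_weight rotnX//; field. Qed.

Let E1 : 1 <= E. Proof. by rewrite /E -expR0 ler_expR. Qed.

Let vE j : (j <= n)%N -> normc (v ^+ j) <= E.
Proof. by move=> jn; exact: (expr_le_exp n0). Qed.

Let halfE (x : R[i]) : normc x <= 1 + E -> normc (x / 2) <= E.
Proof.
move=> xE; rewrite normcM normcV normc_nat ler_pdivrMr//; move: E1 xE; lra.
Qed.

Let alphaE : normc alpha <= E.
Proof. by apply: halfE; rewrite (le_trans (normcD_le _ _))// normc1 lerD2l vE. Qed.

Let betaE : normc beta <= E.
Proof. by apply: halfE; rewrite (le_trans (normcB_le _ _))// normc1 lerD2l vE. Qed.

Let gamX j : normc (gam ^+ j) = 1.
Proof. by rewrite normcX /gam rotn_cis normc_cis expr1n. Qed.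

Let gam1 : normc (gam - 1) <= 8 / n%:R.
Proof. exact: rotn_sub1_le. Qed.

Lemma interp_weight_le j : (j <= n)%N -> normc (interp_weight j) <= 3 * expR K.
Proof.
move=> jn; rewrite /interp_weight -/alpha -/beta -/gam -/E.
rewrite (le_trans (normcB_le _ _))// normcM gamX mulr1.
rewrite (le_trans (lerD (normcB_le _ _) (lexx _)))//.
by have := vE jn; have := alphaE; have := betaE; lra.
Qed.

(** A difference in j removes the constant part and multiplies the two geometric parts by v - 1 and
    gam - 1, both O(1/n). A second difference gains another factor 1/n. *)
Lemma interp_weight_diff_le j : (j <= n)%N ->
  normc (interp_weight j.+1 - interp_weight j) <= expR K * (K + 8) / n%:R.
Proof.
move=> jn; rewrite /interp_weight -/alpha -/beta -/gam -/E.
have -> : v ^+ j.+1 - alpha - beta * gam ^+ j.+1 - (v ^+ j - alpha - beta * gam ^+ j) =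
    v ^+ j * (v - 1) - beta * (gam - 1) * gam ^+ j by rewrite !exprS; ring.
rewrite (le_trans (normcB_le _ _))// (normcM (v ^+ j)) (normcM (beta * _)) (normcM beta).
rewrite gamX mulr1 mulrDr mulrDl -!mulrA.
by apply: lerD; apply: ler_pM; rewrite ?normc_ge0// vE.
Qed.

Lemma interp_weight_diff2_le j : (j < n)%N ->
  normc ((interp_weight j.+2 - interp_weight j.+1) - (interp_weight j.+1 - interp_weight j))
  <= expR K * (K ^+ 2 + 64) / n%:R ^+ 2.
Proof.
move=> jn; rewrite /interp_weight -/alpha -/beta -/gam -/E.
have -> : (v ^+ j.+2 - alpha - beta * gam ^+ j.+2 - (v ^+ j.+1 - alpha - beta * gam ^+ j.+1)) -
    (v ^+ j.+1 - alpha - beta * gam ^+ j.+1 - (v ^+ j - alpha - beta * gam ^+ j)) =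
    v ^+ j * (v - 1) ^+ 2 - beta * (gam - 1) ^+ 2 * gam ^+ j by rewrite !exprS; ring.
rewrite (le_trans (normcB_le _ _))// (normcM (v ^+ j)) (normcM (beta * _)) (normcM beta).
rewrite gamX mulr1 mulrDr mulrDl -!(mulrA E) (normcX (v - 1)) (normcX (gam - 1)).
have e64 : 64 / n%:R ^+ 2 = (8 / n%:R) ^+ 2 :> R.
  by rewrite expr_div_n (_ : 8 ^+ 2 = 64)//; lra.
have v2 : normc (v - 1) ^+ 2 <= K ^+ 2 / n%:R ^+ 2.
  by rewrite -expr_div_n lerXn2r ?nnegrE ?normc_ge0// divr_ge0.
have gam2 : normc (gam - 1) ^+ 2 <= 64 / n%:R ^+ 2.
  by rewrite e64 lerXn2r ?nnegrE ?normc_ge0 ?gam1// divr_ge0.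
by apply: lerD; apply: ler_pM; rewrite ?exprn_ge0 ?normc_ge0// vE// ltnW.
Qed.

End interpolation_weights.

Section fixed_measure.
Variables (mu sigma : complex_measure T R) (w : T -> R[i]) (s : T).
Hypotheses (muT : class_Tminus mu) (dec : lebesgue_decomposition mu w sigma)
  (Es : E_set w sigma s).

Lemma phi_left_orthogonal n p : (size p <= n)%N -> pairing mu (phi mu n) p = 0.
Proof.
move=> pn; have [_ _ o] := Phi_left_monic muT n.
by rewrite phiE// (formZl (pairing_toeplitz mu)) o// mulr0.
Qed.

(** Since gam^n = -1, A z^n + B is the combination of 1 and z^n interpolating phi_n at s and s gam.
    In terms of v = z / s the two values get the weights (1 + v^n) / 2 and (1 - v^n) / 2, and
    coefficients are compared. *)
Lemma local_modelE n z : (0 < n)%N ->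
  (phi mu n).[z] - (localA mu n s * z ^+ n + localB mu n s) =
  \sum_(j < n.+1) (phi mu n)`_j *
    (cval s ^+ j * interp_weight n (z / cval s) j).
Proof.
move=> n0; have s0 : cval s != 0 by rewrite -normc_gt0 normc_cval.
have sz : (size (phi mu n) <= n.+1)%N.
  by rewrite phiE// (leq_trans (size_scale_leq _ _))// size_Phi.
have -> : localA mu n s * z ^+ n + localB mu n s =
    (1 + (z / cval s) ^+ n) / 2 * (phi mu n).[cval s] +
    (1 - (z / cval s) ^+ n) / 2 * (phi mu n).[cval s * rotn R n].
  have sn0 : cval s ^+ n != 0 by rewrite expf_neq0.
  rewrite /localA /localB expr_div_n; field.
  by rewrite sn0.
rewrite !(horner_coef_wide _ sz) !big_distrr/= -big_split/= -sumrB.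
apply: eq_bigr => j _; rewrite /interp_weight.
have sj0 : cval s ^+ j != 0 by rewrite expf_neq0.
rewrite (expr_div_n z (cval s) j) (exprMn j (cval s)).
set X := (z / cval s) ^+ n; set sj := cval s ^+ j in sj0 *.
by field.
Qed.

Lemma arc_integral_le (h : T -> R[i]) (G : T -> R) : cbounded h ->
  bounded_measurable G -> (forall u, normc (h u) <= G u) ->
  normc (arc_integral h) <= 2 * \int[arclength R]_u G u.
Proof.
move=> [h1 h2] bG hG.
have iB f : bounded_measurable f -> (arclength R).-integrable setT (EFin \o f).
  by apply: bounded_measurable_integrable => //; exact: arclength_lty.
have le f : bounded_measurable f -> (forall u, `|f u| <= G u) ->
    `|\int[arclength R]_u f u| <= \int[arclength R]_u G u.
  move=> bf fG; rewrite (le_trans (le_normr_Rintegral _ (iB _ bf)))//.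
  by apply: le_Rintegral => //; [exact: integrable_norm (iB _ bf)|exact: iB].
rewrite (le_trans (normc_ReIm _))// mulr_natl mulr2n /arc_integral /cintegral/=.
by apply: lerD; apply: le => // u; rewrite (le_trans _ (hG u)) ?normc_Re ?normc_Im.
Qed.

(** The ceiling of n / 4: the fourth power of this Dirichlet kernel has degree less than n, while
    its width is still of order 1/n. *)
Let scale n := ((n + 3) %/ 4)%N.

Let scale_gt0 n : (0 < n)%N -> (0 < scale n)%N.
Proof. by move=> n0; rewrite divn_gt0// -[4%N]/(1 + 3)%N leq_add2r. Qed.

Let scale_ge n : n%:R <= 4 * (scale n)%:R :> R.
Proof.
rewrite -natrM ler_nat mulnC /scale.
by have := ltn_ceil (n + 3) (isT : (0 < 4)%N); rewrite mulSn mulnC; lia.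
Qed.

Let scale_le n : (0 < n)%N -> ((scale n).-1 * 4 < n)%N.
Proof.
move=> n0; have := leq_trunc_div (n + 3) 4; have := scale_gt0 n0.
by rewrite /scale; lia.
Qed.

(* Degree less than n, value 1 at [s], and fourth-power decay away from [s]: one
   square makes it integrable, the other one gains at distance K / n. *)
Definition test_poly n : {poly R[i]} := dirichlet (scale n) s ^+ 4.

Lemma size_test_poly n : (0 < n)%N -> (size (test_poly n) <= n)%N.
Proof.
move=> n0; rewrite (leq_trans (size_exp_leq _ _))// (leq_trans _ (scale_le n0))// ltnS.
by rewrite leq_mul2r/= -!subn1 leq_sub2r// size_dirichlet.
Qed.

Lemma test_poly_center n : (0 < n)%N -> (test_poly n).[cval s] = 1.
Proof. by move=> n0; rewrite horner_exp dirichlet_center ?expr1n ?scale_gt0. Qed.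

Let D n u := normc (dirichlet (scale n) s).[cval u].
Let d u := normc (cval u - cval s).

Let D0 n u : 0 <= D n u. Proof. exact: normc_ge0. Qed.
Let d0 u : 0 <= d u. Proof. exact: normc_ge0. Qed.
Let D1 n u : D n u <= 1. Proof. exact: normc_dirichlet_le1. Qed.

Let Dd n u : n%:R * d u * D n u <= 8.
Proof.
have := normc_dirichlet_decay (scale n) s u; rewrite -/(D n u) -/(d u) => h.
apply: (@le_trans _ _ (4 * ((scale n)%:R * d u * D n u))); last by lra.
by rewrite !mulrA !ler_wpM2r// -/(scale n) scale_ge.
Qed.

Definition test_integrand n u := (test_poly n).[cval u] * conjc (kernel mu n (cval s)).[cval u].

Let btest n : cbounded (test_integrand n). Proof. exact: cbounded_pairing. Qed.

Let testE n u : normc (test_integrand n u) =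
  D n u ^+ 2 * D n u ^+ 2 * normc (kernel mu n (cval s)).[cval u].
Proof. by rewrite /test_integrand normcM normc_conj horner_exp normcX -exprD. Qed.

Let h_le n u : normc (test_integrand n u) <= 2 * n%:R * (D n u ^+ 2 * D n u ^+ 2).
Proof.
rewrite testE mulrC ler_wpM2r ?mulr_ge0 ?exprn_ge0//.
exact: normc_kernel_le.
Qed.

Lemma kernel_test (eta : R) : 0 < eta -> exists n0 : nat, forall n, (n0 <= n)%N ->
  normc (1 - w s / (2 * pi)%:C * arc_integral (test_integrand n)) <= eta.
Proof.
move=> eta0; have eta10 : 0 < eta / 128 by apply: divr_gt0 eta0 _; rewrite ltr0n.
have c128 : 0 < 128 :> R by rewrite ltr0n.
have [n1 Hn1] := local_integral dec Es eta10.
exists n1.+1 => n n1n.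
have n0 : (0 < n)%N by exact: leq_ltn_trans n1n.
have nR : 0 < n%:R :> R by rewrite ltr0n.
(* Rescales the integrand to fit [local_integral]: it is at most 2 n, and times |u - s|^2 at most 2
   * 8^2 / n = 128 / n. *)
pose c : R[i] := (128^-1)%:C.
have cn : normc c = 128^-1 by rewrite normcR gtr0_norm// invr_gt0.
have D2 u : D n u ^+ 2 <= 1 by rewrite expr_le1.
have bch : cbounded (fun u => c * test_integrand n u).
  by apply: cboundedM => //; exact: cbounded_cst.
have h1 u : normc (c * test_integrand n u) <= n%:R.
  rewrite normcM cn ler_pdivrMl// (le_trans (h_le _ _))//.
  have : D n u ^+ 2 * D n u ^+ 2 <= 1 by rewrite mulr_ile1 ?exprn_ge0.
  move=> x1; apply: (@le_trans _ _ (2 * n%:R * 1)); last by lra.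
  by rewrite ler_wpM2l// mulr_ge0.
have h2 u : normc (c * test_integrand n u) * d u ^+ 2 <= n%:R^-1.
  rewrite normcM cn -mulrA ler_pdivrMl//.
  have a1 : normc (test_integrand n u) * d u ^+ 2 <= 2 * n%:R * D n u ^+ 2 * d u ^+ 2.
    rewrite ler_wpM2r ?exprn_ge0// (le_trans (h_le _ _))// ler_wpM2l ?mulr_ge0//.
    by rewrite ler_piMr ?exprn_ge0.
  rewrite (le_trans a1)// ler_pdivlMr//.
  have : (n%:R * d u * D n u) ^+ 2 <= 8 ^+ 2 by rewrite lerXn2r ?nnegrE ?mulr_ge0.
  rewrite !exprMn; nra.
have := Hn1 n (ltnW n1n) _ bch h1 h2.
rewrite cm_integralZ// arc_integralZ// -pairingE (kernel_reproducing muT _ (size_test_poly n0)).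
rewrite test_poly_center// mulrCA -mulrBr normcM cn ler_pdivrMl//.
by rewrite [leRHS]mulrC mulfVK ?gt_eqF.
Qed.

(* Were w s = 0, the kernel could not reproduce the value 1 of the test
   polynomial at s. *)
Lemma density_neq0 : w s != 0.
Proof.
apply/eqP => ws0; have h0 : 0 < 2^-1 :> R by rewrite invr_gt0.
have [n0 /(_ n0 (leqnn _))] := kernel_test h0.
by rewrite ws0 !mul0r subr0 normc1; lra.
Qed.

(** In Christoffel-Darboux |1 - s conj(u)| = |u - s|, and the right polynomials are at most 2
    sqrt(h_n) with h_n = [szego_norm mu n]. Only values of phi_n remain, so smallness of phi_n
    passes to the kernel. *)
Lemma kernel_offdiagonal n u :
  d u * normc (kernel mu n (cval s)).[cval u] <=
  2 * (normc (phi mu n).[cval u] + normc (phi mu n).[cval s]).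
Proof.
have H0 := szego_norm_gt0 mu n; have sH0 : 0 < Num.sqrt (szego_norm mu n) by rewrite sqrtr_gt0.
have := congr1 (@normc R) (christoffel_darboux muT n s u).
rewrite !normcM normc_conj -opprB (normcN (_ : Rcomplex R)).
rewrite normc_rotate_sub1 normcB_sym -/(d u) => ->.
rewrite normcV normcR gtr0_norm// ler_pdivrMr// (le_trans (normcB_le _ _))//.
rewrite !normcM !normc_conj !normcX !normc_cval !expr1n !mul1r !normc_phi//.
have b2 v : normc (Phit mu n).[cval v] <= 2 * Num.sqrt (szego_norm mu n).
  rewrite -(@ler_pXn2r _ 2) ?nnegrE ?normc_ge0 ?mulr_ge0 ?(ltW sH0)//.
  rewrite exprMn (sqr_sqrtr (ltW H0)) (le_trans (normc_Phit_sqr_le muT n v))//.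
  by rewrite ler_pM2r// expr2; lra.
set r := Num.sqrt _ in sH0 b2 *.
have hr : szego_norm mu n = r * r by rewrite -expr2 sqr_sqrtr// ltW.
have -> : 2 * (normc (Phi mu n).[cval u] / r + normc (Phi mu n).[cval s] / r) * szego_norm mu n =
    2 * r * normc (Phi mu n).[cval u] + normc (Phi mu n).[cval s] * (2 * r).
  by rewrite hr; field; rewrite gt_eqF.
by apply: lerD; [rewrite ler_wpM2r ?normc_ge0|rewrite ler_wpM2l ?normc_ge0].
Qed.

(* If phi_n is at most e near s, then so is the numerator of Christoffel-Darboux:
   the kernel is large only on the arc of radius c1 / n around s, and still has to
   reproduce the value 1. *)
Lemma kernel_lower : exists n0 : nat, forall n, (n0 <= n)%N -> forall c1 K e : R,
  0 < c1 -> 0 < K -> 0 <= e ->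
  (forall u, d u <= K / n%:R -> normc (phi mu n).[cval u] <= e) ->
  1 <= normc (w s) * (256 * c1 + 128 * (e / c1) + 64 * (64 / K ^+ 2)).
Proof.
have h0 : 0 < 2^-1 :> R by rewrite invr_gt0.
have [n1 Hn1] := kernel_test h0.
exists n1.+1 => n n1n c1 K e c10 K0 e0 phie.
have n0 : (0 < n)%N by exact: leq_ltn_trans n1n.
have nR : 0 < n%:R :> R by rewrite ltr0n.
(* For c1 / n <= |u - s| <= K / n the kernel is at most 4 n e / c1; beyond, one square of the
   Dirichlet kernel is at most 64 / K^2. The other square is kept in [G], where its integral is at
   most 32 / n. *)
pose M := 4 * (e / c1) + 2 * (64 / K ^+ 2).
have M10 : 0 <= e / c1 by rewrite divr_ge0// ltW.
have M20 : 0 <= 64 / K ^+ 2 by rewrite divr_ge0// exprn_ge0// ltW.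
pose G u := 2 * n%:R * \1_(circle_ball s (c1 / n%:R)) u + n%:R * M * D n u ^+ 2.
have bB := bounded_measurable_indic R (measurable_circle_ball s (c1 / n%:R)).
have bD : bounded_measurable (fun u => D n u ^+ 2).
  exact: bounded_measurable_normc_sqr (cbounded_horner _).
have bG : bounded_measurable G.
  by apply: bounded_measurableD; exact: bounded_measurableZ.
have hG u : normc (test_integrand n u) <= G u.
  have D2 : D n u ^+ 2 <= 1 by rewrite expr_le1.
  have D20 : 0 <= D n u ^+ 2 by rewrite exprn_ge0.
  rewrite /G indicE; have [ud|] := boolP (u \in _).
    rewrite mulr1 -[leLHS]addr0 lerD//.
      rewrite (le_trans (h_le n u))// ler_piMr ?mulr_ge0//.
      by rewrite mulr_ile1.
    by rewrite mulr_ge0// mulr_ge0// addr_ge0// mulr_ge0.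
  rewrite notin_setE/= => /negP; rewrite -leNgt -/(d u) => du.
  rewrite mulr0 add0r.
  have [dK|dK] := leP (d u) (K / n%:R).
    have s_e : normc (phi mu n).[cval s] <= e.
      by apply: phie; rewrite /d subrr normc0 divr_ge0// ltW.
    have od := kernel_offdiagonal n u; have u_e := phie _ dK.
    have Q : normc (kernel mu n (cval s)).[cval u] <= n%:R * (4 * (e / c1)).
      have q0 := normc_ge0 (kernel mu n (cval s)).[cval u].
      have : c1 / n%:R * normc (kernel mu n (cval s)).[cval u] <= 4 * e.
        apply: (@le_trans _ _ (d u * normc (kernel mu n (cval s)).[cval u])).
          by rewrite ler_wpM2r.
        by apply: le_trans od _; lra.
      rewrite -ler_pdivlMl; last by rewrite divr_gt0.
      move/le_trans; apply; rewrite le_eqVlt; apply/orP; left; apply/eqP.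
      by field; rewrite !gt_eqF.
    rewrite testE; apply: (@le_trans _ _ (D n u ^+ 2 * (n%:R * (4 * (e / c1))))).
      apply: ler_pM => //; first by rewrite mulr_ge0.
        by rewrite normc_ge0.
      by rewrite ler_piMr.
    rewrite mulrC ler_wpM2r// ler_wpM2l// /M lerDl mulr_ge0//.
  have DK : D n u ^+ 2 <= 64 / K ^+ 2.
    rewrite ler_pdivlMr ?exprn_gt0// -exprMn.
    have : D n u * K <= 8.
      apply: le_trans (Dd n u); rewrite mulrC ler_wpM2r// mulrC.
      by rewrite -ler_pdivrMr// ltW.
    have := mulr_ge0 (D0 n u) (ltW K0) => a0 a8.
    by rewrite expr2; nra.
  apply: (le_trans (h_le n u)).
  apply: (@le_trans _ _ (n%:R * (2 * (64 / K ^+ 2)) * D n u ^+ 2)).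
    rewrite [leLHS](_ : _ = n%:R * (2 * D n u ^+ 2) * D n u ^+ 2); last by ring.
    by rewrite ler_wpM2r// ler_wpM2l// ler_wpM2l.
  by rewrite ler_wpM2r// ler_wpM2l// /M lerDr mulr_ge0.
have := arc_integral_le (btest n) bG hG.
have -> : \int[arclength R]_u G u = 2 * n%:R * \int[arclength R]_u \1_(circle_ball s (c1 / n%:R)) u
    + n%:R * M * (2 * pi / (scale n)%:R).
  have [A1 Z1 _] := arclength_bounded_linear R.
  by rewrite A1 ?Z1// ?Rintegral_dirichlet ?scale_gt0//; exact: bounded_measurableZ.
set I := \int[arclength R]_u _.
have I1 : n%:R * I <= 128 * c1.
  have r0 : 0 < c1 / n%:R by rewrite divr_gt0.
  have := Rintegral_ball_le s r0; rewrite -/I => I1.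
  have := ler_wpM2l (ltW nR) I1; rewrite [n%:R * (128 * _)](_ : _ = 128 * c1)//.
  by field; rewrite gt_eqF.
have sc0 : 0 < (scale n)%:R :> R by rewrite ltr0n scale_gt0.
have I2 : n%:R * (2 * pi / (scale n)%:R) <= 32 :> R.
  rewrite mulrA ler_pdivrMr//; have := scale_ge n; have := pi_lt4 R; have := @pi_ge2 R; nra.
have M0 : 0 <= M by apply: addr_ge0; apply: mulr_ge0.
have GI : 2 * n%:R * I + n%:R * M * (2 * pi / (scale n)%:R) <= 256 * c1 + 32 * M.
  apply: lerD; first by lra.
  by rewrite mulrAC ler_wpM2r.
move=> arc_le.
(* Tolerance 1/2 gives 1/2 <= |w(s)| |a| / (2 pi). Doubling this, with 1 / (2 pi) <= 1/4, yields the
   constants 256, 128 and 64. *)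
have := Hn1 n (ltnW n1n); set a := arc_integral _ in arc_le *.
move/(le_trans (normcB_ge _ _)); rewrite normc1 normcM normcM normcV normcR.
have pi20 : 0 < 2 * pi :> R by rewrite mulr_gt0 ?pi_gt0.
rewrite gtr0_norm//.
have a1 : normc a <= 2 * (256 * c1 + 32 * M) by apply: le_trans arc_le _; rewrite ler_pM2l.
have p4 : (2 * pi)^-1 <= 4^-1 :> R.
  by rewrite lef_pV2 ?posrE//; have := @pi_ge2 R; lra.
have w0 := normc_ge0 (w s).
have : normc (w s) / (2 * pi) * normc a <= normc (w s) / 4 * (2 * (256 * c1 + 32 * M)).
  by rewrite ler_pM ?normc_ge0// ?ler_wpM2l// divr_ge0// ltW.
have -> : normc (w s) / 4 * (2 * (256 * c1 + 32 * M)) = 2^-1 *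
    (normc (w s) * (256 * c1 + 128 * (e / c1) + 64 * (64 / K ^+ 2))).
  by rewrite /M; field; rewrite !gt_eqF.
set X := normc (w s) * (_ + _); set Y := normc (w s) / _ * _; lra.
Qed.

Lemma local_model_cvg (K eta : R) : 0 <= K -> 0 < eta ->
  exists n0 : nat, forall n, (n0 <= n)%N -> forall z,
    normc (z - cval s) <= K / n%:R ->
    normc ((phi mu n).[z] - (localA mu n s * z ^+ n + localB mu n s)) <= eta.
Proof.
move=> K0 eta0.
(* Dominates both normalizations: 2 * 3 exp(K) for the size and 2 exp(K) (K^2 + 2K + 80) for the
   decay, where |phi_n| <= 2 and 80 = 2 * 8 + 64 comes from the differences of the weights. *)
pose C := expR K * (2 * K ^+ 2 + 4 * K + 200).
have C0 : 0 < C.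
  apply: mulr_gt0; first exact: expR_gt0.
  apply: ltr_wpDl; last by rewrite ltr0n.
  by apply: addr_ge0; rewrite mulr_ge0// exprn_ge0.
have ws : 0 < normc (w s) by rewrite normc_gt0 density_neq0.
have eta'0 : 0 < eta * normc (w s) / C by rewrite divr_gt0// mulr_gt0.
have [n1 Hn1] := local_integral dec Es eta'0.
exists n1.+1 => n n1n z zK.
have n0 : (0 < n)%N by exact: leq_ltn_trans n1n.
have nR : 0 < n%:R :> R by rewrite ltr0n.
have s0 : cval s != 0 by rewrite -normc_gt0 normc_cval.
pose v := z / cval s.
have vK : normc (v - 1) <= K / n%:R.
  have -> : v - 1 = (z - cval s) / cval s by rewrite mulrBl mulfV.
  by rewrite normcM normcV normc_cval invr1 mulr1.
(* The index n may be left out because the weight vanishes there; this is what puts q in the range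
   of left orthogonality of phi_n. *)
pose q : {poly R[i]} := \poly_(j < n) (conjc (interp_weight n v j) * conjc (cval s) ^+ j).
have sq : (size q <= n)%N by exact: size_poly.
have sphi : (size (phi mu n) <= n.+1)%N.
  by rewrite phiE// (leq_trans (size_scale_leq _ _))// size_Phi.
pose h u := (C^-1)%:C * ((phi mu n).[cval u] * conjc q.[cval u]).
have qE u : conjc q.[cval u] = \sum_(j < n) interp_weight n v j * (cval s * conjc (cval u)) ^+ j.
  rewrite horner_poly rmorph_sum; apply: eq_bigr => j _ /=.
  by rewrite !conjcM !conjcX !conjc_conjc exprMn mulrA.
have arcE : arc_integral (fun u => (phi mu n).[cval u] * conjc q.[cval u]) =
    (2 * pi)%:C * ((phi mu n).[z] - (localA mu n s * z ^+ n + localB mu n s)).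
  rewrite local_modelE// (arc_integral_poly sphi (leqW sq)); congr (_ * _).
  rewrite !big_ord_recr/= (interp_weightn v n0) !mulr0 addr0.
  rewrite (nth_default _ sq) rmorph0 mulr0 addr0; apply: eq_bigr => j _.
  by rewrite coef_poly ltn_ord conjcM conjcX !conjc_conjc [cval s ^+ j * _]mulrC.
have phi2 u : normc (phi mu n).[cval u] <= 2.
  have := normc_phi_le2 muT n u; have := normc_ge0 (phi mu n).[cval u]; nra.
have yE u : normc (cval s * conjc (cval u) - 1) = normc (cval u - cval s).
  by rewrite normc_rotate_sub1 normcB_sym.
have bh0 := cbounded_pairing (phi mu n) q.
have bh : cbounded h by apply: cboundedM => //; exact: cbounded_cst.
have E0 : 0 < expR K by exact: expR_gt0.
have hnorm u : normc (h u) = C^-1 * (normc (phi mu n).[cval u] * normc (conjc q.[cval u])).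
  by rewrite /h !normcM normcR gtr0_norm ?invr_gt0.
have hn u : normc (h u) <= n%:R.
  rewrite hnorm ler_pdivrMl// (le_trans (ler_pM (normc_ge0 _) (normc_ge0 _) (phi2 u) (lexx _)))//.
  have : normc (conjc q.[cval u]) <= n%:R * (3 * expR K).
    rewrite qE (le_trans (normc_sum _ _ _))//.
    apply: (@le_trans _ _ (\sum_(j < n) (3 * expR K))); last first.
      by rewrite sumr_const card_ord -[(3 * expR K) *+ n]mulr_natl.
    apply: ler_sum => j _; rewrite normcM normcX normc_rotate expr1n mulr1.
    by apply: interp_weight_le => //; exact: ltnW.
  move=> h1; apply: (@le_trans _ _ (2 * (n%:R * (3 * expR K)))); first by rewrite ler_pM2l.
  have -> : 2 * (n%:R * (3 * expR K)) = 6 * expR K * n%:R by ring.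
  rewrite ler_pM2r// /C mulrC ler_pM2l//.
  have := sqr_ge0 K; lra.
have hd u : normc (h u) * normc (cval u - cval s) ^+ 2 <= n%:R^-1.
  rewrite hnorm -mulrA ler_pdivrMl// -mulrA.
  have : normc (conjc q.[cval u]) * normc (cval u - cval s) ^+ 2 <=
      expR K * (K ^+ 2 + 2 * K + 80) / n%:R.
    rewrite -yE mulrC qE.
    apply: le_trans (abel_twice (normc_rotate u s) (interp_weight0 n v) (interp_weightn v n0)
      (interp_weight_diff_le n0 K0 vK) (interp_weight_diff2_le n0 K0 vK)) _.
    rewrite le_eqVlt; apply/orP; left; apply/eqP; field.
    by rewrite gt_eqF.
  move=> h1; apply: (@le_trans _ _ (2 * (expR K * (K ^+ 2 + 2 * K + 80) / n%:R))).
    by apply: ler_pM; rewrite ?normc_ge0// mulr_ge0 ?exprn_ge0 ?normc_ge0.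
  rewrite mulrA ler_pM2r ?invr_gt0// /C mulrCA ler_pM2l//; lra.
have := Hn1 n (ltnW n1n) h bh hn hd.
rewrite /h cm_integralZ// arc_integralZ// -pairingE phi_left_orthogonal// mulr0 sub0r.
rewrite (normcN (_ : Rcomplex R)) arcE.
set Delta := (phi mu n).[z] - _.
have -> : w s / (2 * pi)%:C * (C^-1%:C * ((2 * pi)%:C * Delta)) = C^-1%:C * (w s * Delta).
  have pi0 : (2 * pi)%:C != 0 :> R[i].
    by rewrite (inj_eq (@complexI _)) gt_eqF// mulr_gt0 ?pi_gt0.
  by move: pi0; set P := (2 * pi)%:C; move: P (C^-1)%:C => P c P0; field.
rewrite !normcM normcR gtr0_norm ?invr_gt0// mulrC ler_pM2r ?invr_gt0//.
by rewrite mulrC ler_pM2r.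
Qed.

End fixed_measure.
End local_model.

(** * From the local model to zeros, and back *)

Section zeros_near_the_point.
Variable R : realType.
Local Notation T := (circle R).

Lemma circle_point (z : R[i]) : normc z = 1 -> exists u : T, cval u = z.
Proof. by move=> /cis_polar[t _ ->]; exists (expi t). Qed.

Lemma zero_dist_le (p : {poly R[i]}) (s : T) (a : R[i]) :
  root p a -> zero_dist p s <= normc (a - cval s).
Proof.
move=> pa; apply: ge_inf; last by exists a.
by exists 0 => _ [z _ <-]; exact: normc_ge0.
Qed.

(** The slack x < y makes attainment of the infimum unnecessary; size p > 1 makes the set of roots
    nonempty. *)
Lemma zero_dist_root (p : {poly R[i]}) (s : T) (x y : R) : (1 < size p)%N ->
  zero_dist p s <= x -> x < y -> exists2 a, root p a & normc (a - cval s) <= y.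
Proof.
move=> p1 dx xy; apply: contrapT => noroot.
have : y <= zero_dist p s.
  apply: lb_le_inf; last first.
    move=> _ [a pa <-]; rewrite leNgt; apply/negP => ay; apply: noroot.
    by exists a => //; exact: ltW.
  have /closed_rootP[a pa] : size p != 1%N by rewrite gtn_eqF.
  by exists (normc (a - cval s)); exists a.
by rewrite leNgt (le_lt_trans dx).
Qed.

(* The zero of [a z^n + b] nearest to [s] is a zero of p up to a small
   displacement, by the minimum modulus principle on a circle of radius ~ 1/n
   around it. *)
Lemma root_near_model (p : {poly R[i]}) (n : nat) (s : T) (a b : R[i]) (L delta : R) :
  (0 < n)%N -> 0 <= L -> 2 * L + 16 <= n%:R -> a != 0 -> b != 0 ->
  expR (- L) <= normc (b / a) -> normc (b / a) <= expR L ->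
  36 * delta < normc b -> 0 <= delta ->
  (forall z, normc (z - cval s) <= (2 * L + 17) / n%:R ->
    normc (p.[z] - (a * z ^+ n + b)) <= delta) ->
  exists2 x, root p x & normc (x - cval s) <= (2 * L + 17) / n%:R.
Proof.
move=> n0 L0 Ln a0 b0 L1 L2 db d0 model.
have nR : 0 < n%:R :> R by rewrite ltr0n.
have s0 : cval s != 0 by rewrite -normc_gt0 normc_cval.
have sn0 : cval s ^+ n != 0 by rewrite expf_neq0.
(* A zero s v of a z^n + b requires v^n = c; the n-th root nearest to 1 in argument is taken. *)
pose c := - (b / a) / cval s ^+ n.
have cE : normc c = normc (b / a).
  by rewrite /c normcM normcV normcX normc_cval expr1n invr1 mulr1 (normcN (b / a : Rcomplex R)).
have [v vn v1] : exists2 v, v ^+ n = c & normc (v - 1) <= (2 * L + 16) / n%:R.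
  by apply: nth_root_near1; rewrite ?cE//; lra.
have v2 : normc v <= 2.
  rewrite -[v](subrK 1) (le_trans (normcD_le _ _))// normc1.
  have : (2 * L + 16) / n%:R <= 1 by rewrite ler_pdivrMr// mul1r.
  by move: v1; lra.
have v0 : v != 0.
  apply/eqP => v0; move: vn; rewrite v0 expr0n gtn_eqF// => /esym/eqP.
  by rewrite /c mulf_eq0 oppr_eq0 mulf_eq0 (negbTE b0) !invr_eq0 (negbTE a0) (negbTE sn0).
pose z0 := cval s * v.
have z00 : z0 != 0 by rewrite mulf_neq0.
have az0 : a * z0 ^+ n = - b.
  by rewrite /z0 exprMn vn /c; move: (cval s ^+ n) sn0 => S S0; field; rewrite S0 a0.
have z0n : normc z0 = normc v by rewrite normcM normc_cval mul1r.
have z0s : normc (z0 - cval s) <= (2 * L + 16) / n%:R.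
  by rewrite /z0 -{2}[cval s]mulr1 -mulrBr normcM normc_cval mul1r.
(* On this circle |x / z0| = 1 / (3n), the case of [expr_sub1_ge]: the model is at least |b| / 6
   there. Without a root, |b| / 6 - delta <= 2 delta would follow, against 36 delta < |b|. *)
pose r := normc z0 / (3 * n%:R).
have r0 : 0 < r by rewrite divr_gt0 ?normc_gt0// mulr_gt0.
have r1 : r <= n%:R^-1.
  rewrite /r invfM mulrA ler_piMl ?invr_ge0// ler_pdivrMr// mul1r z0n.
  by apply: le_trans v2 _; lra.
have near x : normc (x - z0) <= r -> normc (x - cval s) <= (2 * L + 17) / n%:R.
  move=> xr; have -> : x - cval s = (x - z0) + (z0 - cval s) by ring.
  rewrite (le_trans (normcD_le _ _))// (le_trans (lerD xr z0s))//.
  by rewrite (le_trans (lerD r1 (lexx _)))// -[X in X + _]mul1r -mulrDl ler_pM2r ?invr_gt0//; lra.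
apply: contrapT => noroot.
have pz0 : normc p.[z0] <= delta.
  have := model z0 (near _ _); rewrite subrr normc0 az0 addNr subr0; apply; exact: ltW.
have : normc b / 6 - delta <= 2 * normc p.[z0].
  apply: (root_free_min_modulus r0).
  - by move: db d0; lra.
  - move=> x px; rewrite leNgt; apply/negP => xr; apply: noroot.
    by exists x => //; exact/near/ltW.
  - move=> x xr.
    have xz : normc (z0 + x - z0) <= r by rewrite addrAC subrr add0r xr.
    have := model _ (near _ xz).
    have -> : a * (z0 + x) ^+ n + b = - b * ((1 + x / z0) ^+ n - 1).
      have -> : z0 + x = z0 * (1 + x / z0) by field.
      by rewrite exprMn mulrA az0; ring.
    have : 6^-1 <= normc ((1 + x / z0) ^+ n - 1).
      apply: expr_sub1_ge => //; rewrite addrAC subrr add0r normcM normcV xr /r.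
      by rewrite mulrAC mulfV ?mul1r// gt_eqF// normc_gt0.
    set X := (1 + x / z0) ^+ n - 1 => X6 PX.
    have bX : normc b / 6 <= normc (- b * X).
      by rewrite normcM (normcN (b : Rcomplex R)) ler_wpM2l// normc_ge0.
    have := normcB_ge (- b * X) p.[z0 + x]; move: PX; rewrite normcB_sym.
    by move: bX; lra.
by move: pz0 db d0; have := normc_ge0 b; lra.
Qed.

Lemma localA_localB_le (mu : complex_measure T R) n (s : T) : class_Tminus mu ->
  normc (localA mu n s) <= 2 /\ normc (localB mu n s) <= 2.
Proof.
move=> muT.
have phi2 z : normc z = 1 -> normc (phi mu n).[z] <= 2.
  move=> /circle_point[u <-].
  by have := normc_phi_le2 muT n u; have := normc_ge0 (phi mu n).[cval u]; nra.
have p1 : normc (phi mu n).[cval s] <= 2 by rewrite phi2// normc_cval.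
have p2 : normc (phi mu n).[cval s * rotn R n] <= 2.
  by rewrite phi2// normcM normc_cval rotn_cis normc_cis mulr1.
split.
  rewrite /localA normcM normcV normcM normc_nat normcX normc_cval expr1n mulr1.
  by rewrite ler_pdivrMr// (le_trans (normcB_le _ _))//; lra.
rewrite /localB normcM normcV normc_nat.
by rewrite ler_pdivrMr// (le_trans (normcD_le _ _))//; lra.
Qed.

Lemma size_phi (mu : complex_measure T R) n : class_Tminus mu -> size (phi mu n) = n.+1.
Proof.
move=> muT; rewrite phiE// size_scale ?size_Phi//.
by rewrite (inj_eq (@complexI _)) invr_eq0 gt_eqF// sqrtr_gt0 szego_norm_gt0.
Qed.

(** Places a zero at distance (5/4) E / n within the range exp(E) / n of the local model. *)
Lemma ler_expR_linear (x : R) : 0 <= x -> 5 / 4 * x <= expR x.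
Proof.
move=> x0; have -> : expR x = expR (x / 2) * expR (x / 2) by rewrite -expRD -splitr.
have h := expR_ge1Dx (x / 2); have x1 : 0 <= 1 + x / 2 by lra.
by apply: le_trans (ler_pM x1 x1 h h); have := sqr_ge0 (x - 2^-1); nra.
Qed.


(** Used with a = |A|, b = |B|, x = |z|^n at a zero z. As a b < exp(-10E), one factor is at most
    exp(-5E). The near equality of b and a x transfers smallness to the other, at the cost of a
    factor x or 1 / x. *)
Lemma small_factors (a b x E : R) : 0 <= a -> 0 <= b -> 0 <= E ->
  expR (- (5 / 2 * E)) <= x -> x <= expR (5 / 4 * E) ->
  b - a * x <= expR (- (5 * E)) -> a * x - b <= expR (- (5 * E)) ->
  a * b < expR (- 10 * E) ->
  a <= 2 * expR (- (5 / 2 * E)) /\ b <= 2 * expR (- (5 / 2 * E)).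
Proof.
move=> a0 b0 E0 xlo xup ba ab abE.
have e0 : 0 < expR (- (5 / 2 * E)) by exact: expR_gt0.
have e1 : expR (- (5 * E)) * expR (5 / 2 * E) = expR (- (5 / 2 * E)).
  by rewrite -expRD; congr expR; lra.
have e2 : expR (- (5 * E)) * expR (5 / 4 * E) <= expR (- (5 / 2 * E)).
  by rewrite -expRD ler_expR; lra.
have e3 : expR (- (5 * E)) <= expR (- (5 / 2 * E)) by rewrite ler_expR; lra.
have [a5|a5] := leP a (expR (- (5 * E))).
  have ax : a * x <= expR (- (5 * E)) * expR (5 / 4 * E).
    by apply: ler_pM => //; exact: le_trans (ltW (expR_gt0 _)) xlo.
  by split; lra.
have b5 : b <= expR (- (5 * E)).
  rewrite leNgt; apply/negP => b5.
  have : expR (- (5 * E)) * expR (- (5 * E)) <= a * b.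
    by rewrite ler_pM ?expR_ge0// ltW.
  rewrite -expRD leNgt; have -> : - (5 * E) + - (5 * E) = - 10 * E by lra.
  by rewrite abE.
split; last by lra.
have ax : a * expR (- (5 / 2 * E)) <= 2 * expR (- (5 * E)).
  by apply: (@le_trans _ _ (a * x)); [rewrite ler_wpM2l|lra].
by rewrite -e1 mulrA -ler_pdivrMr ?expR_gt0// -expRN.
Qed.

(** The arc radius exp(-tE) needs t > 1 for the first term and t < 3/2 for the second; t = 6/5 makes
    every term at most a multiple of q = exp(-E/5). The multiples add up to 256 + 640 + 4096 <
    20000, while 20000 q <= 1. *)
Lemma exponential_budget (E : R) : 100 * 1000 < E ->
  expR E * (256 * expR (- (6 / 5 * E)) +
    128 * (5 * expR (- (5 / 2 * E)) / expR (- (6 / 5 * E))) +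
    64 * (64 / expR E ^+ 2)) < 1.
Proof.
move=> E5; pose q := expR (- (E / 5)).
have q0 : 0 < q by exact: expR_gt0.
have x1 : expR E * expR (- (6 / 5 * E)) = q by rewrite -expRD; congr expR; lra.
have x2 : expR E * (expR (- (5 / 2 * E)) / expR (- (6 / 5 * E))) <= q.
  by rewrite -expRN -!expRD ler_expR; lra.
have x3 : expR E * (expR E ^+ 2)^-1 <= q.
  by rewrite expr2 -expRD -expRN -expRD ler_expR; lra.
have q1 : q * (1 + E / 5) <= 1.
  by rewrite /q expRN mulrC ler_pdivrMr ?expR_gt0// mul1r expR_ge1Dx.
have q2 : q * (20 * 1000) <= q * (1 + E / 5) by rewrite ler_pM2l//; lra.
set e := expR E in x1 x2 x3 *; set c := expR (- (6 / 5 * E)) in x1 x2 *.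
set b := expR (- (5 / 2 * E)) in x2 *.
have -> : e * (256 * c + 128 * (5 * b / c) + 64 * (64 / e ^+ 2)) =
    256 * (e * c) + 640 * (e * (b / c)) + 64 * 64 * (e * (e ^+ 2)^-1) by ring.
clearbody e c b q; clear E5; lra.
Qed.

Section fixed_degree.
Variables (mu : complex_measure T R) (w : T -> R[i]) (s : T) (E : R) (n : nat).
Local Notation A := (localA mu n s).
Local Notation B := (localB mu n s).

(** From |A|, |B| <= 2 and |A B| >= 1/E both moduli are at least 1 / (2E), so |B / A| lies between 1
    / (4E) and 4E, hence between exp(-4E) and exp(4E). The error 1 / (100 E) meets the factor 36 of
    [root_near_model]. *)
Lemma zero_dist_upper : class_Tminus mu -> 100 * 1000 < E -> (0 < n)%N ->
  2 * (4 * E) + 16 <= n%:R ->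
  (forall z, normc (z - cval s) <= (2 * (4 * E) + 17) / n%:R ->
    normc ((phi mu n).[z] - (A * z ^+ n + B)) <= E^-1 / 100) ->
  E^-1 <= normc (A * B) -> zero_dist (phi mu n) s <= 10 ^+ 4 * E / n%:R.
Proof.
move=> muT E5 n0 nE model; rewrite normcM.
have [A2 B2] := localA_localB_le n s muT.
have nR : 0 < n%:R :> R by rewrite ltr0n.
have E0 : 0 < E by apply: lt_trans E5; rewrite mulr_gt0 ?ltr0n.
have Ei0 : 0 < E^-1 by rewrite invr_gt0.
have a0 := normc_ge0 A; have b0 := normc_ge0 B.
move=> AB.
have [x px xs] : exists2 x, root (phi mu n) x &
    normc (x - cval s) <= (2 * (4 * E) + 17) / n%:R.
  have A1 : E^-1 / 2 <= normc A by nra.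
  have B1 : E^-1 / 2 <= normc B by nra.
  have eL : 4 * E <= expR (4 * E) by have := expR_ge1Dx (4 * E); lra.
  have Ap : 0 < normc A by apply: lt_le_trans A1; rewrite divr_gt0.
  have Bp : 0 < normc B by apply: lt_le_trans B1; rewrite divr_gt0.
  have h (y y' : R) : y <= 2 -> E^-1 / 2 <= y' -> y <= y' * (4 * E).
    move=> y2 y1; apply: (le_trans y2).
    have : E^-1 / 2 * (4 * E) <= y' * (4 * E) by rewrite ler_wpM2r//; lra.
    by have -> : E^-1 / 2 * (4 * E) = 2 by field; rewrite gt_eqF.
  apply: (@root_near_model _ n s A B (4 * E) (E^-1 / 100)) => //.
  - by lra.
  - by rewrite -normc_gt0.
  - by rewrite -normc_gt0.
  - rewrite normcM normcV expRN ler_pdivlMr// mulrC ler_pdivrMr ?expR_gt0//.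
    by apply: le_trans (h _ _ A2 B1) _; rewrite ler_wpM2l.
  - rewrite normcM normcV ler_pdivrMr// mulrC.
    by apply: le_trans (h _ _ B2 A1) _; rewrite ler_wpM2l.
  - by lra.
  - by lra.
apply: (le_trans (zero_dist_le s px)); apply: (le_trans xs).
rewrite ler_pM2r ?invr_gt0//.
have -> : 10 ^+ 4 = 100 * 100 :> R by rewrite !exprS expr0; lra.
by lra.
Qed.

Lemma product_lower : class_Tminus mu -> 100 * 1000 < E -> (0 < n)%N ->
  5 / 2 * E <= n%:R ->
  (forall z, normc (z - cval s) <= expR E / n%:R ->
    normc ((phi mu n).[z] - (A * z ^+ n + B)) <= expR (- (5 * E))) ->
  (forall c1 K e : R, 0 < c1 -> 0 < K -> 0 <= e ->
    (forall u : T, normc (cval u - cval s) <= K / n%:R -> normc (phi mu n).[cval u] <= e) ->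
    1 <= normc (w s) * (256 * c1 + 128 * (e / c1) + 64 * (64 / K ^+ 2))) ->
  normc (w s) < expR E -> zero_dist (phi mu n) s <= E / n%:R ->
  expR (- 10 * E) <= normc (A * B).
Proof.
move=> muT E5 n0 En model kernel_le wE zd; rewrite leNgt; apply/negP; rewrite normcM => AB.
have nR : 0 < n%:R :> R by rewrite ltr0n.
have E0 : 0 < E by apply: lt_trans E5; rewrite mulr_gt0 ?ltr0n.
have EnR : 0 < E / n%:R by rewrite divr_gt0.
(* The excess over E / n is the slack of [zero_dist_root]. It gives |z|^n between exp(-5E/2) and
   exp(5E/4). *)
have [z pz zs] : exists2 z, root (phi mu n) z & normc (z - cval s) <= 5 / 4 * E / n%:R.
  apply: (zero_dist_root _ zd); first by rewrite size_phi.
  by rewrite -mulrA; lra.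
have Kn : normc (z - cval s) <= expR E / n%:R.
  by apply: (le_trans zs); rewrite ler_pM2r ?invr_gt0// ler_expR_linear// ltW.
have s0 : cval s != 0 by rewrite -normc_gt0 normc_cval.
pose v := z / cval s.
have v1 : normc (v - 1) <= 5 / 4 * E / n%:R.
  have -> : v - 1 = (z - cval s) / cval s by rewrite mulrBl mulfV.
  by rewrite normcM normcV normc_cval invr1 mulr1.
have zn : normc (z ^+ n) = normc (v ^+ n).
  by rewrite /v expr_div_n normcM normcV !normcX normc_cval expr1n invr1 mulr1.
have E54 : 0 <= 5 / 4 * E by lra.
have e54 : 5 / 2 * E = 2 * (5 / 4 * E) by lra.
have zup : normc (z ^+ n) <= expR (5 / 4 * E) by rewrite zn (expr_le_exp n0).
have zlo : expR (- (5 / 2 * E)) <= normc (z ^+ n).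
  by rewrite zn e54; apply: (expr_ge_exp n0) => //; rewrite -e54.
have ABz : normc (A * z ^+ n + B) <= expR (- (5 * E)).
  have := model z Kn.
  by move/rootP: pz => ->; rewrite sub0r (normcN (A * z ^+ n + B : Rcomplex R)).
have ABz1 : normc A * normc (z ^+ n) - normc B <= expR (- (5 * E)).
  by apply: le_trans ABz; rewrite -normcM normcD_ge.
have ABz2 : normc B - normc A * normc (z ^+ n) <= expR (- (5 * E)).
  by rewrite -normcM; apply: le_trans (normcD_ge _ _) _; rewrite [B + _]addrC.
have [Ae Be] := small_factors (normc_ge0 _) (normc_ge0 _) (ltW E0) zlo zup ABz2 ABz1 AB.
have e55 : expR (- (5 * E)) <= expR (- (5 / 2 * E)) by rewrite ler_expR; lra.
(* The constant is 2 + 2 + 1, for |A|, |B| and the error of the model. *)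
have phi_small (u : T) : normc (cval u - cval s) <= expR E / n%:R ->
    normc (phi mu n).[cval u] <= 5 * expR (- (5 / 2 * E)).
  move=> /model /(le_trans (normcB_ge _ _)).
  have : normc (A * cval u ^+ n + B) <= normc A + normc B.
    by rewrite (le_trans (normcD_le _ _))// normcM normcX normc_cval expr1n mulr1.
  have : expR (- (5 * E)) <= expR (- (5 / 2 * E)) by exact: e55.
  by clear -Ae Be; lra.
have e50 : 0 <= 5 * expR (- (5 / 2 * E)) by rewrite mulr_ge0// expR_ge0.
have := kernel_le _ _ _ (expR_gt0 (- (6 / 5 * E))) (expR_gt0 E) e50 phi_small.
apply/negP; rewrite -ltNge; apply: le_lt_trans (exponential_budget E5).
apply: ler_wpM2r; last exact: ltW.
apply: addr_ge0; last first.
  by rewrite mulr_ge0// divr_ge0// exprn_ge0// expR_ge0.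
by apply: addr_ge0; rewrite mulr_ge0 ?ler0n ?divr_ge0 ?expR_ge0 ?e50.
Qed.


End fixed_degree.
End zeros_near_the_point.

Lemma sum_ltn_leqs (n1 n2 n3 n4 n : nat) : (41 + n1 + n2 + n3 + n4 < n)%N ->
  [/\ (0 < n)%N, (n1 <= n)%N, (n2 <= n)%N, (n3 <= n)%N & (n4 <= n)%N].
Proof. by move=> nn; split; lia. Qed.

Theorem theorem3 (R : realType) (mu sigma : complex_measure (circle R) R)
    (w : circle R -> R[i]) (s : circle R) :
  class_Tminus mu ->
  lebesgue_decomposition mu w sigma ->
  E_set w sigma s ->
  forall eps : R, 0 < eps -> eps < 10 ^- 5 ->
  exists n0 : nat, (40 < n0)%N /\
  forall n : nat, (n0 < n)%N ->
    (eps <= normc (localA mu n s * localB mu n s) ->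
     zero_dist (phi mu n) s <= 10 ^+ 4 * eps^-1 * n%:R^-1) /\
    (normc (w s) < expR eps^-1 ->
     zero_dist (phi mu n) s <= eps^-1 * n%:R^-1 ->
     expR (- 10 * eps^-1) <= normc (localA mu n s * localB mu n s)).
Proof.
move=> muT dec Es eps eps0 eps5.
have [E epsE] : exists E, eps = E^-1 by exists eps^-1; rewrite invrK.
have E0 : 0 < E by rewrite -invr_gt0 -epsE.
have E5 : 100 * 1000 < E.
  rewrite -[ltLHS]invrK -[ltRHS]invrK -epsE ltf_pV2 ?posrE ?invr_gt0 ?mulr_gt0 ?ltr0n//.
  apply: (lt_le_trans eps5); rewrite lef_pV2 ?posrE ?mulr_gt0 ?exprn_gt0 ?ltr0n//.
  by rewrite !exprS expr0; clear; lra.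
have K10 : 0 <= 2 * (4 * E) + 17 by clear -E0; lra.
have d10 : 0 < E^-1 / 100 by rewrite -epsE; apply: divr_gt0 => //; rewrite ltr0n.
(* The same convergence is used at two scales: here radius (8E + 17) / n and error 1 / (100 E) for
   (i), then radius exp(E) / n and error exp(-5E) for (ii). *)
have [n1 Hn1] := local_model_cvg muT dec Es K10 d10.
have [n2 Hn2] := local_model_cvg muT dec Es (expR_ge0 E) (expR_gt0 (- (5 * E))).
have [n3 Hn3] := kernel_lower muT dec Es.
have [n4 n4E] : exists n4 : nat, 2 * (4 * E) + 16 <= n4%:R.
  have h : 0 <= 2 * (4 * E) + 16 by clear -E0; lra.
  by exists (Num.trunc (2 * (4 * E) + 16)).+1; have /andP[_ /ltW] := Num.Theory.truncn_itv h.
exists (41 + n1 + n2 + n3 + n4)%N; split; first by rewrite -!addnA ltn_addr.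
move=> n /sum_ltn_leqs[n0 n1n n2n n3n n4n].
have nE : 2 * (4 * E) + 16 <= n%:R by apply: (le_trans n4E); rewrite ler_nat.
rewrite epsE invrK; split.
  by apply: zero_dist_upper => //; exact: Hn1.
apply: product_lower => //; [|exact: Hn2|exact: Hn3].
by clear -E0 nE; lra.
Qed.
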